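(* Suppose that $M\subset\mathbb{C}^{n+1}$, $n\ge 2$, is a real-analytic Levi-flat CR singular submanifold of type C.1 or type C.0 at the origin. Let $S\subset M$ denote the CR singular set of $M$. Then near the origin $S$ is a submanifold of (real) dimension $2n-2$, and at a generic point $S$ is either CR Levi-flat of dimension $2n-2$ (CR dimension $n-2$) or a complex submanifold of complex dimension $n-1$. Furthermore, if $M$ is of type C.1, then at the origin $S$ is a CR Levi-flat submanifold of dimension $2n-2$ (CR dimension $n-2$).
   Context: For a real submanifold $M$ of complex Euclidean space with complex structure $J$, $T^c_pM=T_pM\cap J(T_pM)$. $M$ is CR at $p$ if $\dim T^c_qM$ is constant for $q\in M$ near $p$; $M_{CR}$ is the set of such points, and the CR singular set is $M\setminus M_{CR}$. The CR dimension at a CR point is $\dim_{\mathbb{C}}T^c_pM$. A CR submanifold is Levi-flat if its Levi-map vanishes identically (equivalently, $T^cM$ is involutive; in particular totally real submanifolds are Levi-flat); a CR singular $M$ is Levi-flat if $M_{CR}$ is. $M$ is of type C.1 (resp. C.0) at the origin if in suitable holomorphic coordinates $(z,w)\in\mathbb{C}^n\times\mathbb{C}$ it is given near $0$ by $w=\bar z_1z_2+\bar z_1^2+O(3)$ (resp. $w=\bar z_1z_2+O(3)$). ''Generic point'' of $S$ means a point of some dense open subset of $S$ near the origin. *)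

(* Defs.v *)
From mathcomp Require Export all_boot all_order all_algebra.
From mathcomp Require Export all_classical all_reals all_analysis.
From mathcomp Require Export complex.
Set Implicit Arguments.
Unset Strict Implicit.
Unset Printing Implicit Defensive.
Export Order.TTheory GRing.Theory Num.Theory.
Export numFieldNormedType.Exports.
Local Open Scope classical_set_scope.
Local Open Scope ring_scope.

(** * Real-analytic functions *)

Definition exponent m K (a : {ffun 'I_m -> 'I_K}) : {ffun 'I_m -> nat} :=
  [ffun i => nat_of_ord (a i)].

(* [f] is the sum, on a polydisc around [p] (`|h| is the sup norm), of a
   multivariate power series that converges absolutely on the closed polydisc.
   Partial sums are taken over the boxes of multi-indices [0, K[^m. *)
Definition analytic_at (R : realType) m (f : 'rV[R]_m -> R) (p : 'rV[R]_m) :=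
  exists (c : {ffun 'I_m -> nat} -> R) (r C : R),
    [/\ 0 < r,
        forall K, \sum_(a : {ffun 'I_m -> 'I_K})
                    `|c (exponent a)| * r ^+ (\sum_i a i)%N <= C &
        forall h : 'rV[R]_m, `|h| < r ->
          \sum_(a : {ffun 'I_m -> 'I_K})
             c (exponent a) * \prod_i h 0 i ^+ a i @[K --> \oo]
          --> f (p + h)].

Definition analytic_map_at (R : realType) m k
    (f : 'rV[R]_m -> 'rV[R]_k) (p : 'rV[R]_m) :=
  forall j, analytic_at (fun x => f x 0 j) p.

(** * Real submanifolds of R^m *)

(* Near [p], [M] is the zero set of a real-analytic map to R^(m - d) that is a
   submersion at [p]; ['J rho p] acts on row vectors, so that [row_full] says
   that the differential is onto. *)
Definition submanifold_at (R : realType) m (d : nat) (M : set 'rV[R]_m)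
    (p : 'rV[R]_m) :=
  [/\ M p, (d <= m)%N &
    exists rho : 'rV[R]_m -> 'rV[R]_(m - d),
      [/\ analytic_map_at rho p, row_full ('J rho p) &
          \forall x \near p, M x <-> rho x = 0]].

Definition submanifold (R : realType) m (d : nat) (M : set 'rV[R]_m) :=
  forall p, M p -> submanifold_at d M p.

Definition tangent_space (R : realType) m (M : set 'rV[R]_m) (p : 'rV[R]_m) :
    set 'rV[R]_m :=
  [set v | exists gamma : R -> 'rV[R]_m,
     [/\ gamma 0 = p, \forall t \near (0 : R), M (gamma t) &
         is_derive (0 : R) (1 : R) gamma v]].

(* [A] is a linear subspace of R^m of dimension [k]. *)
Definition has_dim (R : realType) m (A : set 'rV[R]_m) (k : nat) :=
  exists B : 'M[R]_(k, m), row_free B /\ forall v, A v <-> (v <= B)%MS.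

Definition lie_bracket (R : realType) m (X Y : 'rV[R]_m -> 'rV[R]_m)
    (p : 'rV[R]_m) : 'rV[R]_m :=
  'D_(X p) Y p - 'D_(Y p) X p.

(** * Complex Euclidean space *)

(* C^N is R^(N + N): the N real parts followed by the N imaginary parts. *)
Definition ccoord (R : realType) N (x : 'rV[R]_(N + N)) (j : 'I_N) : R[i] :=
  Complex (x 0 (lshift N j)) (x 0 (rshift N j)).

(* Multiplication by the imaginary unit. *)
Definition Jstr (R : realType) N (v : 'rV[R]_(N + N)) : 'rV[R]_(N + N) :=
  row_mx (- rsubmx v) (lsubmx v).

(* A real-analytic map satisfying the Cauchy-Riemann equations near [p]. *)
Definition holomorphic_at (R : realType) N K
    (f : 'rV[R]_(N + N) -> 'rV[R]_(K + K)) (p : 'rV[R]_(N + N)) :=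
  analytic_map_at f p /\
  \forall x \near p, forall v, 'd f x (Jstr v) = Jstr ('d f x v).

Definition complex_submanifold_at (R : realType) N (k : nat)
    (M : set 'rV[R]_(N + N)) (p : 'rV[R]_(N + N)) :=
  [/\ M p, (k <= N)%N &
    exists h : 'rV[R]_(N + N) -> 'rV[R]_((N - k) + (N - k)),
      [/\ holomorphic_at h p, row_full ('J h p) &
          \forall x \near p, M x <-> h x = 0]].

(** * CR geometry *)

Definition Tc (R : realType) N (M : set 'rV[R]_(N + N)) (p : 'rV[R]_(N + N)) :
    set 'rV[R]_(N + N) :=
  tangent_space M p `&` [set Jstr v | v in tangent_space M p].

Definition CR_points (R : realType) N (M : set 'rV[R]_(N + N)) :
    set 'rV[R]_(N + N) :=
  [set p | M p /\ exists k, \forall q \near p, M q -> has_dim (Tc M q) k].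

Definition CR_singular_set (R : realType) N (M : set 'rV[R]_(N + N)) :=
  M `\` CR_points M.

(* The complex dimension of T^c_p M is half its real dimension. *)
Definition has_CR_dim (R : realType) N (M : set 'rV[R]_(N + N))
    (p : 'rV[R]_(N + N)) (k : nat) :=
  CR_points M p /\ has_dim (Tc M p) (2 * k).

(* A germ at [p] of section of T^c M, given by an ambient extension. *)
Definition Tc_section_at (R : realType) N (M : set 'rV[R]_(N + N))
    (p : 'rV[R]_(N + N)) (X : 'rV[R]_(N + N) -> 'rV[R]_(N + N)) :=
  analytic_map_at X p /\ \forall q \near p, M q -> Tc M q (X q).

(* The Levi map T^c_p M x T^c_p M -> T_p M / T^c_p M sends (X p, Y p) to the
   class of [X, Y] p, for sections X and Y of T^c M.  It is tensorial, so it is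
   determined by the real-analytic sections when M is real-analytic. *)
Definition Levi_map_vanishes_at (R : realType) N (M : set 'rV[R]_(N + N))
    (p : 'rV[R]_(N + N)) :=
  forall X Y, Tc_section_at M p X -> Tc_section_at M p Y ->
    Tc M p (lie_bracket X Y p).

Definition Levi_flat (R : realType) N (M : set 'rV[R]_(N + N)) :=
  forall p, CR_points M p -> Levi_map_vanishes_at M p.

(* Near [p], [M] is a Levi-flat CR submanifold of real dimension [d] and CR
   dimension [k]. *)
Definition CR_Levi_flat_at (R : realType) N (d k : nat)
    (M : set 'rV[R]_(N + N)) (p : 'rV[R]_(N + N)) :=
  [/\ submanifold_at d M p, has_CR_dim M p k &
      \forall q \near p, CR_points M q -> Levi_map_vanishes_at M q].

(** * Types C.1 and C.0 at the origin *)

(* A germ of biholomorphism fixing the origin, with its inverse germ. *)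
Definition holomorphic_coordinates (R : realType) N
    (Phi Psi : 'rV[R]_(N + N) -> 'rV[R]_(N + N)) :=
  [/\ Phi 0 = 0, holomorphic_at Phi 0 /\ holomorphic_at Psi 0,
      \forall x \near (0 : 'rV[R]_(N + N)), Psi (Phi x) = x &
      \forall y \near (0 : 'rV[R]_(N + N)), Phi (Psi y) = y].

(* The coordinates (z, w) of C^n x C = C^(n + 1). *)
Definition zpart (R : realType) n (x : 'rV[R]_(n.+1 + n.+1)) : 'rV[R]_(n + n) :=
  row_mx (\row_(j < n) x 0 (lshift n.+1 (widen_ord (leqnSn n) j)))
         (\row_(j < n) x 0 (rshift n.+1 (widen_ord (leqnSn n) j))).

Definition wpart (R : realType) n (x : 'rV[R]_(n.+1 + n.+1)) : R[i] :=
  ccoord x ord_max.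

(* In suitable holomorphic coordinates (z, w), [M] is given near the origin by
   w = Q(z) + O(3). *)
Definition has_form (R : realType) n (Q : 'rV[R]_(n + n) -> R[i])
    (M : set 'rV[R]_(n.+1 + n.+1)) :=
  exists Phi Psi, exists rho : 'rV[R]_(n + n) -> R[i],
    [/\ holomorphic_coordinates Phi Psi,
        analytic_at (fun z => complex.Re (rho z)) 0 /\
        analytic_at (fun z => complex.Im (rho z)) 0,
        exists C : R, \forall z \near (0 : 'rV[R]_(n + n)),
          Normc.normc (rho z - Q z) <= C * `|z| ^+ 3 &
        \forall x \near (0 : 'rV[R]_(n.+1 + n.+1)),
          M x <-> wpart (Phi x) = rho (zpart (Phi x))].

(* The hypothesis 2 <= n provides the first two indices 0 and 1 of 'I_n. *)
Definition z1 (R : realType) n (hn : (2 <= n)%N) (z : 'rV[R]_(n + n)) : R[i] :=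
  ccoord z (Ordinal (ltnW hn)).

Definition z2 (R : realType) n (hn : (2 <= n)%N) (z : 'rV[R]_(n + n)) : R[i] :=
  ccoord z (Ordinal hn).

Definition type_C1 (R : realType) n (hn : (2 <= n)%N)
    (M : set 'rV[R]_(n.+1 + n.+1)) :=
  has_form (fun z => conjc (z1 hn z) * z2 hn z + conjc (z1 hn z) ^+ 2) M.

Definition type_C0 (R : realType) n (hn : (2 <= n)%N)
    (M : set 'rV[R]_(n.+1 + n.+1)) :=
  has_form (fun z => conjc (z1 hn z) * z2 hn z) M.

(* Main.v *)
Require Import Defs.
From HB Require Import structures.
From mathcomp Require Import ring lra zify.
Set Implicit Arguments.
Unset Strict Implicit.
Unset Printing Implicit Defensive.
Local Open Scope classical_set_scope.
Local Open Scope ring_scope.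

(** Why the theorem holds.

    Near the origin [M] is, in the given coordinates, the graph [w = rho z] of an
    analytic function on C^n, and everything is read on C^n through the antilinear
    form [dbar rho z], [v |-> D rho v + i D rho (J v)].  A tangent vector of the graph
    is complex when it lies over the kernel of this form, so the complex tangent
    space has real dimension [2 n - 2] where the form is not zero and [2 n] where it
    is zero: the CR singular points lie over the zeros of [dbar rho].  The derivative
    [W u v] of the form in the direction [u] is the half sum of a part [L u v] linear
    in [u], the complex Hessian, and of a part [H u v] antilinear in [u], which is
    symmetric.  Levi-flatness of [M] says that [L] vanishes on pairs of null vectors
    of a nonzero form ([levi_null]); with denominators cleared this becomes an
    identity between analytic functions valid at every point ([levi_identity]).

    The third order estimate fixes the values at the origin: for the first two
    coordinate vectors [E1] and [E2], [L E2 E1 = 4], the other values of [L] on them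
    are zero, and [H E1 E1] is [8] for type C.1 and [0] for type C.0.  The rest only
    uses that these values persist approximately.  Put [mu z = dbar rho z E1].

    - The identity forces [dbar rho z = 0] as soon as [mu z = 0] ([mu_zero]).  As the
      set [mu = 0] is transverse to the complex line of [E2], the implicit function
      theorem makes it an analytic submanifold of dimension [2 n - 2]
      ([section_near0], [singular_submanifold]).

    - On [mu = 0] the terms of second order in the identity say that the ratio
      [W u b / W u E1] satisfies a quadratic equation with a single small root.  So it
      does not depend on [u] ([grad_dbar_ratio]): all derivatives of the form
      [dbar rho] are multiples of one antilinear form [ratio], and [H] is a multiple
      of the square of [ratio] ([hess02_ratio]).

    - Where [H E1 E1] vanishes identically, the tangent spaces of [mu = 0] are complex,
      the retraction onto this set along [E2] is holomorphic, and so is [rho] on it: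
      the CR singular set is a complex submanifold ([singular_complex]).

    - Where [H E1 E1] is not zero, the complex tangent space of the singular set is
      the kernel of [ratio] in the tangent space, of complex dimension [n - 2]
      ([CR_equations_onto]).  On it the Levi form of [M] vanishes to second order in
      the transverse direction [E2], because in the identity it is multiplied by
      [mu] twice and the other terms are of fourth order ([levi_second_order]).  Its
      derivative along [E2] is what obstructs [ratio] from vanishing on a bracket of
      two sections, so the singular set is Levi-flat ([singular_Levi_flat]).

    The points where [H E1 E1] is not zero or is locally zero form an open dense
    subset of the singular set, and the origin is one of the former for type C.1.

    The calculus needed for this is that of real power series.  A series is bounded
    by the weighted l1 norm of its coefficients, a complete norm for which monomials
    are extremal, so that a statement about a series and its norm need only be
    checked on monomials, sums and normally convergent series ([l1_series_ind]).
    Products, substitution, derivatives and the contraction that proves the implicit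
    function theorem are all obtained in this way. *)

(** * Power series with summable coefficients *)

Section AbsoluteSeries.
Variable R : realType.
Implicit Types (u D : nat -> R).

(** The tail estimate is in terms of the majorant, so that it is uniform in any
    parameter on which only the terms depend. *)
Lemma dominated_seriesP u D (C : R) :
  (forall k, `|u k| <= D k) -> (forall n, \sum_(k < n) D k <= C) ->
  exists l, [/\ \sum_(k < n) u k @[n --> \oo] --> l,
    exists S, [/\ \sum_(k < n) D k @[n --> \oo] --> S, S <= C &
      forall n, `|l - \sum_(k < n) u k| <= S - \sum_(k < n) D k] &
    `|l| <= C].
Proof.
move=> uD DC.
have D0 k : 0 <= D k by exact: le_trans (uD k).
have ndD : nondecreasing_seq (fun n => \sum_(k < n) D k).
  by apply/nondecreasing_seqP => n; rewrite big_ord_recr /= lerDl.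
have cvD : cvgn (fun n => \sum_(k < n) D k).
  by apply: nondecreasing_is_cvgn => //; exists C => _ [n _ <-].
have sE (v : nat -> R) : (fun n => \sum_(k < n) v k) = series v :> (nat -> R).
  by apply/funext => n; rewrite /series /= big_mkord.
have cvu : cvgn (series u).
  apply: normed_cvg; apply: (@series_le_cvg _ _ D) => //=.
  by rewrite -sE.
pose l := limn (series u); pose S := limn (fun n => \sum_(k < n) D k).
have ul : \sum_(k < n) u k @[n --> \oo] --> l by rewrite sE.
have DS : \sum_(k < n) D k @[n --> \oo] --> S by [].
have SC : S <= C by apply: limr_le => //; apply: nearW.
have tail n : `|l - \sum_(k < n) u k| <= S - \sum_(k < n) D k.
  have h1 : `|\sum_(k < N) u k - \sum_(k < n) u k| @[N --> \oo] -->
      `|l - \sum_(k < n) u k|.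
    by apply: cvg_norm; apply: cvgB => //; exact: cvg_cst.
  have h2 : \sum_(k < N) D k - \sum_(k < n) D k @[N --> \oo] -->
      S - \sum_(k < n) D k.
    by apply: cvgB => //; exact: cvg_cst.
  apply: (ler_cvg_to h1 h2); near=> N.
  have nN : (n <= N)%N by near: N; exact: nbhs_infty_ge.
  rewrite -!(big_mkord xpredT) /= !(big_cat_nat (n := n) (m := 0) (p := N)) //=.
  by rewrite ![_ + \sum_(n <= _ < _) _]addrC !addrK;
  by apply: (le_trans (ler_norm_sum _ _ _)); exact: ler_sum.
exists l; split => //; first by exists S; split.
by have := tail 0%N; rewrite !big_ord0 !subr0 => /le_trans; apply.
Unshelve. all: by end_near. Qed.

End AbsoluteSeries.

Lemma cvgn_le_bound (R : realType) (u : nat -> R) l C :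
  u n @[n --> \oo] --> l -> (forall n, u n <= C) -> l <= C.
Proof. by move=> ul uC; apply: (ler_cvg_to ul (cvg_cst C)); exact: nearW. Qed.

Lemma exponent_inj m K : injective (@exponent m K).
Proof.
move=> a b /ffunP ab; apply/ffunP => i; apply: val_inj => /=.
by have := ab i; rewrite !ffunE.
Qed.

Section BoxSums.
Variables (R : realType) (m : nat).
Implicit Types (F G : {ffun 'I_m -> nat} -> R).

Definition box_sum F K := \sum_(a : {ffun 'I_m -> 'I_K}) F (exponent a).

Lemma eq_box_sum F G K : F =1 G -> box_sum F K = box_sum G K.
Proof. by move=> FG; apply: eq_bigr => a _; rewrite FG. Qed.

Lemma ler_box_sum F G K : (forall a, F a <= G a) -> box_sum F K <= box_sum G K.
Proof. by move=> FG; apply: ler_sum => a _. Qed.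

Lemma box_sum_ge0 F K : (forall a, 0 <= F a) -> 0 <= box_sum F K.
Proof. by move=> F0; apply: sumr_ge0. Qed.

Lemma norm_box_sum F K : `|box_sum F K| <= box_sum (fun a => `|F a|) K.
Proof. exact: ler_norm_sum. Qed.

Lemma box_sumD F G K :
  box_sum (fun a => F a + G a) K = box_sum F K + box_sum G K.
Proof. by rewrite /box_sum big_split. Qed.

Lemma box_sumB F G K :
  box_sum (fun a => F a - G a) K = box_sum F K - box_sum G K.
Proof. by rewrite /box_sum big_split /= sumrN. Qed.

Lemma box_sum_sum n (F : nat -> {ffun 'I_m -> nat} -> R) K :
  box_sum (fun a => \sum_(k < n) F k a) K = \sum_(k < n) box_sum (F k) K.
Proof. by rewrite /box_sum exchange_big. Qed.

Lemma cvg_box_sum (F : nat -> {ffun 'I_m -> nat} -> R) G K :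
  (forall a, F k a @[k --> \oo] --> G a) ->
  box_sum (F k) K @[k --> \oo] --> box_sum G K.
Proof.
move=> FG; rewrite /box_sum.
apply: cvg_big => [|a _]; [exact: add_continuous|exact: FG].
Qed.

Lemma box_sum_widen F K L : (K <= L)%N ->
  box_sum F K =
  \sum_(a : {ffun 'I_m -> 'I_L} | [forall i, (a i < K)%N]) F (exponent a).
Proof.
move=> KL; pose h (a : {ffun 'I_m -> 'I_K}) := [ffun i => widen_ord KL (a i)].
have eh a : exponent (h a) = exponent a by apply/ffunP => i; rewrite !ffunE.
have hinj : injective h by move=> a b /(congr1 (@exponent _ _)); rewrite !eh => /exponent_inj.
rewrite /box_sum; under eq_bigr do rewrite -eh.
rewrite -(big_imset (fun a => F (exponent a))) /=; last by move=> ? ? _ _; exact: hinj.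
apply: eq_bigl => a; apply/imsetP/forallP => [[b _ ->] i|aK].
  by rewrite ffunE /=.
exists [ffun i => Ordinal (aK i)] => //.
by apply/ffunP => i; rewrite !ffunE; exact: val_inj.
Qed.

Lemma box_sum_delta F a K : (forall b, b != a -> F b = 0) ->
  box_sum F K = if [forall i, (a i < K)%N] then F a else 0.
Proof.
move=> Fa; case: ifPn => [/forallP aK|/forallPn[i aK]].
  pose a' := [ffun i => Ordinal (aK i)].
  have ea : exponent a' = a by apply/ffunP => i; rewrite !ffunE.
  rewrite /box_sum (bigD1 a') //= ea big1 ?addr0 // => b ba'.
  by apply: Fa; apply: contra ba' => /eqP ba; apply/eqP/exponent_inj; rewrite ba ea.
rewrite /box_sum big1 // => b _; apply: Fa; apply: contra aK => /eqP <-.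
by rewrite ffunE.
Qed.

Lemma box_exhaust (a : {ffun 'I_m -> nat}) :
  exists N, forall K, (N <= K)%N -> [forall i, (a i < K)%N].
Proof.
exists (\max_i a i).+1 => K NK; apply/forallP => i.
by apply: leq_trans NK; rewrite ltnS; exact: leq_bigmax.
Qed.

End BoxSums.

Lemma ltr_mx_norm (R : realType) m n (A : 'M[R]_(m, n)) (s : R) : 0 < s ->
  (`|A| < s) <-> (forall i j, `|A i j| < s).
Proof.
move=> s0; rewrite {1}/Num.Def.normr /= mx_normrE; split.
  by move=> /bigmax_ltP[_ H] i j; exact: (H (i, j)).
by move=> H; apply/bigmax_ltP; split => // -[i j] _; exact: H.
Qed.

Lemma ler_mx_norm (R : realType) m n (A : 'M[R]_(m, n)) (s : R) : 0 <= s ->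
  (`|A| <= s) <-> (forall i j, `|A i j| <= s).
Proof.
move=> s0; rewrite {1}/Num.Def.normr /= mx_normrE; split.
  by move=> /bigmax_leP[_ H] i j; exact: (H (i, j)).
by move=> H; apply/bigmax_leP; split => // -[i j] _; exact: H.
Qed.

Lemma coord_le_norm (R : realType) m n (A : 'M[R]_(m, n)) i j : `|A i j| <= `|A|.
Proof. exact: (ler_mx_norm A (normr_ge0 A)).1. Qed.

Section SummableSeries.
Variables (R : realType) (m : nat).
Implicit Types (f g : 'rV[R]_m -> R) (a : {ffun 'I_m -> nat}) (h : 'rV[R]_m).

Definition monomial a h : R := \prod_i h 0 i ^+ a i.
Definition degree a := (\sum_i a i)%N.

(** Power series at the origin graded by the weighted l1 norm of the coefficients:
    [C] bounds the norm at radius [s].  Unlike the sup norm, this norm makes every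
    operation on series a computation on monomials. *)
Definition l1_series (s C : R) f := exists c : {ffun 'I_m -> nat} -> R,
  (forall K, box_sum (fun a => `|c a| * s ^+ degree a) K <= C) /\
  forall h, `|h| < s ->
    box_sum (fun a => c a * monomial a h) K @[K --> \oo] --> f h.

Lemma norm_monomial a h s : `|h| < s -> `|monomial a h| <= s ^+ degree a.
Proof.
move=> hs; rewrite /monomial /degree normr_prod expr_sum.
apply: ler_prod => i _; rewrite normr_ge0 /= normrX.
by apply: lerXn2r; rewrite ?nnegrE ?(le_trans _ (ltW hs)) ?(coord_le_norm h) //.
Qed.

Lemma eq_l1_series s C f g : (forall h, `|h| < s -> f h = g h) ->
  l1_series s C f -> l1_series s C g.
Proof.
by move=> fg [c [cC cf]]; exists c; split => // h hs; rewrite -fg //; exact: cf.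
Qed.

Lemma l1_series_le s C C' f : C <= C' -> l1_series s C f -> l1_series s C' f.
Proof.
by move=> CC [c [cC cf]]; exists c; split => // K; exact: le_trans CC.
Qed.

Lemma l1_series_restrict s s' C f : 0 <= s' -> s' <= s ->
  l1_series s C f -> l1_series s' C f.
Proof.
move=> s0 ss [c [cC cf]]; exists c; split => [K|h hs]; last first.
  by apply: cf; exact: lt_le_trans ss.
apply: le_trans (cC K); apply: ler_box_sum => a.
by apply: ler_wpM2l => //; apply: lerXn2r; rewrite ?nnegrE // (le_trans s0).
Qed.

Lemma l1_series_ge0 s C f : 0 <= s -> l1_series s C f -> 0 <= C.
Proof.
move=> s0 [c [cC _]]; apply: le_trans (cC 0%N); apply: box_sum_ge0 => a.
by rewrite mulr_ge0 ?exprn_ge0.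
Qed.

Lemma l1_series_bound s C f h : `|h| < s -> l1_series s C f -> `|f h| <= C.
Proof.
move=> hs [c [cC cf]]; apply: (cvgn_le_bound (cvg_norm (cf h hs))) => K.
apply: le_trans (cC K); apply: le_trans (norm_box_sum _ _) _.
apply: ler_box_sum => a; rewrite normrM.
by apply: ler_wpM2l => //; exact: norm_monomial.
Qed.

Lemma l1_series_monomial s t a : 0 < s ->
  l1_series s (`|t| * s ^+ degree a) (fun h => t * monomial a h).
Proof.
move=> s0; exists (fun b => if b == a then t else 0); split => [K|h hs].
  rewrite (@box_sum_delta _ _ _ a) => [|b /negPf ->]; last by rewrite normr0 mul0r.
  by rewrite eqxx; case: ifP => // _; rewrite mulr_ge0 ?exprn_ge0 // ltW.
have [N aN] := box_exhaust a; apply: cvg_near_cst; near=> K.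
rewrite (@box_sum_delta _ _ _ a) => [|b /negPf ->]; last by rewrite mul0r.
by rewrite eqxx aN //; near: K; exact: nbhs_infty_ge.
Unshelve. all: by end_near. Qed.

Lemma l1_seriesD s C D f g : 0 <= s -> l1_series s C f -> l1_series s D g ->
  l1_series s (C + D) (fun h => f h + g h).
Proof.
move=> s0 [c [cC cf]] [d [dD dg]]; exists (fun a => c a + d a); split => [K|h hs].
  apply: (@le_trans _ _ (box_sum (fun a => `|c a| * s ^+ degree a) K +
      box_sum (fun a => `|d a| * s ^+ degree a) K)).
    rewrite -box_sumD; apply: ler_box_sum => a; rewrite -mulrDl.
    by apply: ler_wpM2r; [exact: exprn_ge0|exact: ler_normD].
  by apply: lerD.
rewrite (_ : (fun K => _) = fun K => box_sum (fun a => c a * monomial a h) K +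
    box_sum (fun a => d a * monomial a h) K).
  by apply: cvgD; [exact: cf|exact: dg].
by apply/funext => K; rewrite -box_sumD; apply: eq_box_sum => a; rewrite mulrDl.
Qed.

Lemma l1_seriesZ s C t f : l1_series s C f ->
  l1_series s (`|t| * C) (fun h => t * f h).
Proof.
move=> [c [cC cf]]; exists (fun a => t * c a); split => [K|h hs].
  rewrite (_ : box_sum _ _ = `|t| * box_sum (fun a => `|c a| * s ^+ degree a) K).
    exact: ler_wpM2l.
  by rewrite /box_sum mulr_sumr; apply: eq_bigr => a _; rewrite normrM mulrA.
rewrite (_ : (fun K => _) = fun K => t * box_sum (fun a => c a * monomial a h) K).
  by apply: cvgM; [exact: cvg_cst|exact: cf].
apply/funext => K; rewrite /box_sum mulr_sumr.
by apply: eq_bigr => a _; rewrite mulrA.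
Qed.

(** Completeness of the weighted l1 space of coefficients: a normally
    convergent series of power series is again a power series. *)
Lemma l1_series_sum s C (D : nat -> R) (F : nat -> 'rV[R]_m -> R) f :
  0 < s -> (forall k, l1_series s (D k) (F k)) ->
  (forall n, \sum_(k < n) D k <= C) ->
  (forall h, `|h| < s -> \sum_(k < n) F k h @[n --> \oo] --> f h) ->
  l1_series s C f.
Proof.
move=> s0 /choice[c cP] DC Ff.
have cD k a : `|c k a * s ^+ degree a| <= D k.
  have [N /(_ N (leqnn N)) aN] := box_exhaust a.
  apply: le_trans ((cP k).1 N).
  pose G b := if b == a then `|c k a * s ^+ degree a| else 0.
  have -> : `|c k a * s ^+ degree a| = box_sum G N.
    by rewrite (@box_sum_delta _ _ _ a) ?aN /G ?eqxx // => b /negPf ->.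
  apply: ler_box_sum => b; rewrite /G; case: eqP => [->|_].
    by rewrite normrM (ger0_norm (exprn_ge0 _ (ltW s0))).
  by rewrite mulr_ge0 ?exprn_ge0 // ltW.
have w0 a : 0 < s ^+ degree a by exact: exprn_gt0.
have D0 k : 0 <= D k by exact: le_trans (cD k [ffun=> 0%N]).
have [S [DS SC tailS]] : exists S, [/\ \sum_(k < n) D k @[n --> \oo] --> S, S <= C &
    forall n, 0 <= S - \sum_(k < n) D k].
  have [|l [_ [S [DS SC tS]] _]] := @dominated_seriesP R D D C _ DC.
    by move=> k; rewrite ger0_norm.
  by exists S; split => // n; exact: le_trans (tS n).
pose limit_coef a l := \sum_(k < n) c k a @[n --> \oo] --> (l : R).
have limit_coefP a : exists l, limit_coef a l.
  have [k|n|l [cl _ _]] := @dominated_seriesP R (fun k => c k a)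
      (fun k => D k / s ^+ degree a) (C / s ^+ degree a).
  - by rewrite ler_pdivlMr // -{1}(ger0_norm (ltW (w0 a))) -normrM.
  - by rewrite -mulr_suml ler_pM2r ?invr_gt0.
  by exists l.
have [e eP] := choice limit_coefP.
have tail_coef n K :
    box_sum (fun a => `|e a - \sum_(k < n) c k a| * s ^+ degree a) K <=
    S - \sum_(k < n) D k.
  have h1 : box_sum (fun a => `|\sum_(k < N) c k a - \sum_(k < n) c k a| *
      s ^+ degree a) K @[N --> \oo] -->
      box_sum (fun a => `|e a - \sum_(k < n) c k a| * s ^+ degree a) K.
    apply: cvg_box_sum => a; apply: cvgM; last exact: cvg_cst.
    by apply: cvg_norm; apply: cvgB; [exact: eP|exact: cvg_cst].
  have h2 : \sum_(k < N) D k - \sum_(k < n) D k @[N --> \oo] -->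
      S - \sum_(k < n) D k.
    by apply: cvgB => //; exact: cvg_cst.
  apply: (ler_cvg_to h1 h2); near=> N.
  have nN : (n <= N)%N by near: N; exact: nbhs_infty_ge.
  have split_sum (V : nmodType) (v : nat -> V) :
      \sum_(k < N) v k = \sum_(k < n) v k + \sum_(n <= k < N) v k.
    by rewrite -!(big_mkord xpredT) (big_cat_nat (n := n)).
  rewrite (split_sum R D) addrAC subrr add0r.
  apply: (@le_trans _ _ (\sum_(n <= k < N)
      box_sum (fun a => `|c k a| * s ^+ degree a) K)); last first.
    by apply: ler_sum => k _; exact: (cP k).1.
  rewrite /box_sum exchange_big /=; apply: ler_sum => a _.
  rewrite (split_sum R (c ^~ (exponent a))) addrAC subrr add0r -mulr_suml.
  by apply: ler_wpM2r; [exact: ltW|exact: ler_norm_sum].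
exists e; split => [K|h hs].
  apply: le_trans SC; have := tail_coef 0%N K.
  rewrite big_ord0 subr0; apply: le_trans; apply: ler_box_sum => a.
  by rewrite big_ord0 subr0.
have tail_val n : `|f h - \sum_(k < n) F k h| <= S - \sum_(k < n) D k.
  have [k||l [Fl [S' [DS' _ tl]] _]] := @dominated_seriesP R (F ^~ h) D C.
  - by apply: (l1_series_bound hs); exists (c k).
  - exact: DC.
  have <- : l = f h by apply: cvg_unique Fl (Ff h hs).
  by have <- : S' = S by apply: cvg_unique DS' DS.
apply/cvgrPdist_le => eps eps0.
have eps3 : 0 < eps / 3 by rewrite divr_gt0.
have [n Tn] : exists n, S - \sum_(k < n) D k <= eps / 3.
  move/cvgrPdist_le : DS => /(_ _ eps3)[n _ /(_ n (leqnn n)) /=].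
  by rewrite (ger0_norm (tailS n)) => Tn; exists n.
have fin : box_sum (fun a => \sum_(k < n) c k a * monomial a h) K @[K --> \oo] -->
    \sum_(k < n) F k h.
  rewrite (_ : (fun K => _) = fun K => \sum_(k < n)
      box_sum (fun a => c k a * monomial a h) K); last first.
    apply/funext => K.
    exact: (box_sum_sum n (fun k a => c k a * monomial a h)).
  by apply: cvg_big => [|k _]; [exact: add_continuous|exact: (cP k).2 h hs].
move/cvgrPdist_le : fin => /(_ _ eps3); apply: filterS => K finK.
have -> : f h - box_sum (fun a => e a * monomial a h) K =
    (f h - \sum_(k < n) F k h) +
    (\sum_(k < n) F k h - box_sum (fun a => \sum_(k < n) c k a * monomial a h) K) +
    - box_sum (fun a => (e a - \sum_(k < n) c k a) * monomial a h) K.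
  have -> : box_sum (fun a => (e a - \sum_(k < n) c k a) * monomial a h) K =
      box_sum (fun a => e a * monomial a h) K -
      box_sum (fun a => \sum_(k < n) c k a * monomial a h) K.
    by rewrite -box_sumB; apply: eq_box_sum => a; rewrite mulrBl mulr_suml.
  by ring.
apply: le_trans (ler_normD _ _) _.
have -> : eps = eps / 3 + eps / 3 + eps / 3 by field.
apply: lerD.
  by apply: le_trans (ler_normD _ _) _; apply: lerD => //; exact: le_trans Tn.
rewrite normrN; apply: le_trans Tn; apply: le_trans (tail_coef n K).
apply: le_trans (norm_box_sum _ _) _; apply: ler_box_sum => a.
by rewrite normrM; apply: ler_wpM2l => //; exact: norm_monomial.
Unshelve. all: by end_near. Qed.

(** A power series is the normally convergent sum of its blocks of monomials between
    consecutive boxes.  So a property of the pair (function, bound) need only be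
    checked on monomials, finite sums and normally convergent sums; this is how the
    operations on power series (product, substitution, differentiation) are treated. *)
Lemma l1_series_ind s (P : ('rV[R]_m -> R) -> R -> Prop) : 0 < s ->
  (forall t a, P (fun h => t * monomial a h) (`|t| * s ^+ degree a)) ->
  (forall f g C D, P f C -> P g D -> P (fun h => f h + g h) (C + D)) ->
  (forall (F : nat -> 'rV[R]_m -> R) D f C, (forall k, P (F k) (D k)) ->
    (forall n, \sum_(k < n) D k <= C) ->
    (forall h, `|h| < s -> \sum_(k < n) F k h @[n --> \oo] --> f h) -> P f C) ->
  forall f C, l1_series s C f -> P f C.
Proof.
move=> s0 Pmon Padd Psum f C [c [cC cf]].
(* [block K] sums over the multi-indices in the box [K] but not in the box [K.-1] *)
pose inner K (a : {ffun 'I_m -> 'I_K}) := [forall i, (a i < K.-1)%N].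
pose block K (G : {ffun 'I_m -> nat} -> R) : R := if K is 0%N then box_sum G 0
  else \sum_(a : {ffun 'I_m -> 'I_K} | ~~ inner K a) G (exponent a).
have block_sum G n : \sum_(K < n.+1) block K G = box_sum G n.
  elim: n => [|n IH]; first by rewrite big_ord1.
  rewrite big_ord_recr /= IH (box_sum_widen _ (leqnSn n)) /box_sum.
  by rewrite [RHS](bigID (@inner n.+1)).
have P0 : P (fun=> 0) 0.
  have := Pmon 0 [ffun=> 0%N]; rewrite normr0 mul0r.
  by congr P; apply/funext => h; rewrite mul0r.
have Pbig K (Q : pred {ffun 'I_m -> 'I_K}) :
    P (fun h => \sum_(a | Q a) c (exponent a) * monomial (exponent a) h)
      (\sum_(a | Q a) `|c (exponent a)| * s ^+ degree (exponent a)).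
  rewrite -fct_sumE; elim/big_ind2 : _ => //.
  move=> g1 C1 g2 C2 P1 P2; exact: Padd.
apply: (Psum (fun K h => block K (fun a => c a * monomial a h))
  (fun K => block K (fun a => `|c a| * s ^+ degree a))).
- by case=> [|K]; rewrite /block; exact: Pbig.
- case=> [|n]; last by rewrite block_sum.
  rewrite big_ord0; apply: le_trans (cC 0%N); apply: box_sum_ge0 => a.
  by rewrite mulr_ge0 ?exprn_ge0 // ltW.
- move=> h hs; rewrite -(@cvg_shiftS _ (fun n => \sum_(k < n) _)) /=.
  rewrite (_ : (fun n => _) = box_sum (fun a => c a * monomial a h)); first exact: cf.
  by apply/funext => n; exact: block_sum.
Qed.

End SummableSeries.

(** * Products and substitution of power series *)

Section SeriesAlgebra.
Variables (R : realType) (m : nat).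
Implicit Types (f g : 'rV[R]_m -> R) (a : {ffun 'I_m -> nat}) (h : 'rV[R]_m).

(** Same induction, with monomials built one variable at a time. *)
Lemma l1_series_coord_ind s (P : ('rV[R]_m -> R) -> R -> Prop) : 0 < s ->
  (forall t, P (fun=> t) `|t|) ->
  (forall i f C, P f C -> P (fun h => h 0 i * f h) (s * C)) ->
  (forall f g C D, P f C -> P g D -> P (fun h => f h + g h) (C + D)) ->
  (forall (F : nat -> 'rV[R]_m -> R) D f C, (forall k, P (F k) (D k)) ->
    (forall n, \sum_(k < n) D k <= C) ->
    (forall h, `|h| < s -> \sum_(k < n) F k h @[n --> \oo] --> f h) -> P f C) ->
  forall f C, l1_series s C f -> P f C.
Proof.
move=> s0 Pcst Pcoord Padd Psum; apply: l1_series_ind => // t a.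
rewrite (_ : (fun h => _) = fun h => (\prod_i h 0 i ^+ a i) * t); last first.
  by apply/funext => h; rewrite mulrC.
rewrite mulrC /degree expr_sum.
elim: (index_enum _) => [|i r IH].
  by rewrite big_nil mul1r; under eq_fun do rewrite big_nil mul1r.
rewrite big_cons; under eq_fun do rewrite big_cons.
elim: (a i) => [|n IHn].
  by rewrite expr0 mul1r; under eq_fun do rewrite expr0 mul1r.
rewrite exprS -!mulrA; under eq_fun do rewrite exprS -!mulrA.
by apply: Pcoord; rewrite mulrA; under eq_fun do rewrite mulrA.
Qed.

Lemma l1_series_cst s (t : R) : 0 < s -> l1_series s `|t| (fun _ : 'rV[R]_m => t).
Proof.
move=> s0; have := @l1_series_monomial R m s t [ffun=> 0%N] s0.
rewrite /degree big1 ?mulr1 => [|i _]; last by rewrite ffunE.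
apply: eq_l1_series => h _; rewrite /monomial big1 ?mulr1 // => i _.
by rewrite ffunE.
Qed.

Lemma l1_series_coordM s C i f : 0 < s -> l1_series s C f ->
  l1_series s (s * C) (fun h => h 0 i * f h).
Proof.
move=> s0; move: f C; apply: (l1_series_ind s0).
- move=> t a; pose a' := [ffun j => (a j + (j == i))%N].
  have := @l1_series_monomial R m s t a' s0.
  have -> : degree a' = (degree a).+1.
    rewrite /degree (eq_bigr (fun j => a j + (j == i))%N) => [|j _]; last by rewrite ffunE.
    rewrite big_split /= -[RHS]addn1; congr (_ + _)%N.
    by rewrite (bigD1 i) //= eqxx big1 // => j /negPf ->.
  rewrite exprS mulrCA; apply: eq_l1_series => h _.
  rewrite mulrCA /monomial; congr (_ * _).
  rewrite (bigD1 i) //= [in RHS](bigD1 i) //= mulrA ffunE eqxx addn1 exprS.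
  by congr (_ * _); apply: eq_bigr => j /negPf ji; rewrite ffunE ji addn0.
- move=> f g C D fC gD; rewrite mulrDr; under eq_fun do rewrite mulrDr.
  exact: l1_seriesD (ltW s0) fC gD.
- move=> F D f C FD DC Ff.
  apply: (l1_series_sum s0 FD) => [n|h hs].
    by rewrite -mulr_sumr; apply: ler_wpM2l => //; exact: ltW.
  under eq_fun do rewrite -mulr_sumr.
  by apply: cvgM; [exact: cvg_cst|exact: Ff].
Qed.

Lemma l1_series_coord s i : 0 < s -> l1_series s s (fun h : 'rV[R]_m => h 0 i).
Proof.
move=> s0; have := l1_series_coordM i s0 (l1_series_cst 1 s0).
by rewrite normr1 mulr1; apply: eq_l1_series => h _; rewrite mulr1.
Qed.

Lemma l1_seriesM s C D f g : 0 < s -> l1_series s C f -> l1_series s D g ->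
  l1_series s (C * D) (fun h => f h * g h).
Proof.
move=> s0 fC gD; move: f C fC; apply: (l1_series_coord_ind s0).
- by move=> t; exact: l1_seriesZ.
- move=> i f C fC; rewrite -mulrA; under eq_fun do rewrite -mulrA.
  exact: l1_series_coordM.
- move=> f1 f2 C1 C2 fC1 fC2; rewrite mulrDl; under eq_fun do rewrite mulrDl.
  exact: l1_seriesD (ltW s0) fC1 fC2.
- move=> F E f C FE EC Ff; apply: (l1_series_sum s0 FE) => [n|h hs].
    rewrite -mulr_suml; apply: ler_wpM2r => //.
    exact: l1_series_ge0 (ltW s0) gD.
  under eq_fun do rewrite -mulr_suml.
  by apply: cvgM; [exact: Ff|exact: cvg_cst].
Qed.

Lemma l1_seriesN s C f : l1_series s C f -> l1_series s C (fun h => - f h).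
Proof.
move=> /(l1_seriesZ (-1)); rewrite normrN1 mul1r.
by apply: eq_l1_series => h _; rewrite mulN1r.
Qed.

Lemma l1_series_sum_ord s n (C : 'I_n -> R) (F : 'I_n -> 'rV[R]_m -> R) : 0 < s ->
  (forall i, l1_series s (C i) (F i)) ->
  l1_series s (\sum_i C i) (fun h => \sum_i F i h).
Proof.
move=> s0 FC; elim: (index_enum _) => [|i r IH].
  rewrite big_nil; under eq_fun do rewrite big_nil.
  by have := l1_series_cst 0 s0; rewrite normr0.
rewrite big_cons; apply: eq_l1_series (l1_seriesD (ltW s0) (FC i) IH) => h _.
by rewrite big_cons.
Qed.

End SeriesAlgebra.

Section Substitution.
Variables (R : realType) (m k : nat).
Implicit Types (g : 'rV[R]_m -> 'rV[R]_k) (f : 'rV[R]_k -> R).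

Definition l1_map s r g := forall i, l1_series s r (fun h => g h 0 i).

Lemma l1_map_bound s r r' g h : 0 < r' -> r < r' -> l1_map s r g -> `|h| < s ->
  `|g h| < r'.
Proof.
move=> r0 rr gr hs; apply/(ltr_mx_norm _ r0) => i j; rewrite ord1.
exact: le_lt_trans (l1_series_bound hs (gr j)) rr.
Qed.

(** On monomials substitution is a product of power series; the majorant of the
    result is that of [f] evaluated at the norms of the coordinates of [g]. *)
Lemma l1_series_comp s r r' C f g : 0 < s -> 0 < r -> r' < r ->
  l1_series r C f -> l1_map s r' g -> l1_series s C (fun h => f (g h)).
Proof.
move=> s0 r0 rr fC gr; move: f C fC; apply: (l1_series_coord_ind r0).
- by move=> t; exact: l1_series_cst.
- move=> i f C fC; have := l1_seriesM s0 (gr i) fC; apply: l1_series_le.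
  by apply: ler_wpM2r (ltW rr); exact: l1_series_ge0 (ltW s0) fC.
- by move=> f1 f2 C1 C2; exact: l1_seriesD (ltW s0).
- move=> F D f C FD DC Ff; apply: (l1_series_sum s0 FD DC) => h hs.
  by apply: Ff; exact: l1_map_bound gr hs.
Qed.

(** Substitution is Lipschitz for the l1 norms; this makes the fixed point
    iteration of the implicit function theorem converge. *)
Lemma l1_series_comp_lipschitz s r r' eps C f g g' : 0 < s -> 0 <= eps ->
  0 < r' -> r' < r -> l1_series r C f -> l1_map s r' g -> l1_map s r' g' ->
  l1_map s eps (fun h => g h - g' h) ->
  l1_series s (C * eps / (r - r')) (fun h => f (g h) - f (g' h)).
Proof.
move=> s0 eps0 r'0 rr fC gr gr' gg.
have r0 : 0 < r by exact: lt_trans rr.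
have d0 : 0 < r - r' by rewrite subr_gt0.
pose P f C := l1_series s C (fun h => f (g' h)) /\
  l1_series s (C * eps / (r - r')) (fun h => f (g h) - f (g' h)).
suff [] : P f C by [].
move: f C fC; apply: (l1_series_coord_ind r0); rewrite /P {P}.
- move=> t; split; first exact: l1_series_cst.
  under eq_fun do rewrite subrr.
  apply: l1_series_le (@l1_series_cst R m s 0 s0).
  by rewrite normr0 divr_ge0 ?mulr_ge0 // ltW.
- move=> i f C [fC fL]; split.
    have := l1_seriesM s0 (gr' i) fC; apply: l1_series_le.
    by apply: ler_wpM2r (ltW rr); exact: l1_series_ge0 (ltW s0) fC.
  have := l1_seriesD (ltW s0) (l1_seriesM s0 (gr i) fL) (l1_seriesM s0 (gg i) fC).
  have -> : r' * (C * eps / (r - r')) + eps * C = r * C * eps / (r - r').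
    by field; rewrite gt_eqF.
  by apply: eq_l1_series => h _; rewrite !mxE; ring.
- move=> f1 f2 C1 C2 [fC1 L1] [fC2 L2]; split; first exact: l1_seriesD (ltW s0) fC1 fC2.
  have := l1_seriesD (ltW s0) L1 L2; rewrite -!mulrDl.
  by apply: eq_l1_series => h _; ring.
- move=> F D f C FD DC Ff; split.
    apply: (l1_series_sum s0 (fun k => (FD k).1) DC) => h hs.
    by apply: Ff; exact: l1_map_bound gr' hs.
  apply: (l1_series_sum s0 (fun k => (FD k).2)) => [n|h hs].
    rewrite -!mulr_suml; apply: ler_wpM2r; first by rewrite invr_ge0 ltW.
    exact: ler_wpM2r.
  under eq_fun do rewrite sumrB.
  by apply: cvgB; apply: Ff; [exact: l1_map_bound gr hs|exact: l1_map_bound gr' hs].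
Qed.

End Substitution.

(** * Differentiation of power series *)

Lemma series_bound (R : realType) (e D : nat -> R) C w l :
  0 <= w -> (forall k, `|e k| <= D k * w) -> (forall n, \sum_(k < n) D k <= C) ->
  \sum_(k < n) e k @[n --> \oo] --> l -> `|l| <= C * w.
Proof.
move=> w0 eD DC el; apply: (cvgn_le_bound (cvg_norm el)) => n.
apply: (le_trans (ler_norm_sum _ _ _)).
apply: (@le_trans _ _ ((\sum_(k < n) D k) * w)); last exact: ler_wpM2r.
by rewrite mulr_suml; apply: ler_sum => k _.
Qed.

Lemma series_cvg (R : realType) (e D : nat -> R) C w :
  0 <= w -> (forall k, `|e k| <= D k * w) -> (forall n, \sum_(k < n) D k <= C) ->
  \sum_(k < n) e k @[n --> \oo] --> limn (fun n => \sum_(k < n) e k).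
Proof.
move=> w0 eD DC.
have [|l [el _ _]] := dominated_seriesP (C := C * w) eD.
  by move=> n; rewrite -mulr_suml; apply: ler_wpM2r.
by rewrite (cvg_lim _ el).
Qed.

Section Derivatives.
Variables (R : realType) (m : nat).
Implicit Types (f g : 'rV[R]_m -> R) (h u : 'rV[R]_m).

Definition lin_part (d : 'I_m -> 'rV[R]_m -> R) h u := \sum_i u 0 i * d i h.

(** The constants are Cauchy estimates: at [s'] the derivative of order k of a
    polynomial with nonnegative coefficients is at most [k! / (s - s') ^ k] times its
    value at [s].  They are stable under multiplication by a coordinate, which
    multiplies [C] by [s]. *)
Lemma l1_series_derivatives s s' C f : 0 < s' -> s' < s -> l1_series s C f ->
  exists (d : 'I_m -> 'rV[R]_m -> R) (dd : 'I_m -> 'I_m -> 'rV[R]_m -> R),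
  [/\ forall i, l1_series s' (C / (s - s')) (d i),
      forall h u, `|h| < s' -> `|h + u| < s' ->
        `|f (h + u) - f h - lin_part d h u| <= C * ((s - s') ^- 2 * `|u| ^+ 2),
      forall i h u, `|h| < s' -> `|h + u| < s' ->
        `|d i (h + u) - d i h - lin_part (dd i) h u| <=
          C * (6 * (s - s') ^- 3 * `|u| ^+ 2) &
      forall i j h, `|h| < s' -> dd i j h = dd j i h].
Proof.
move=> s'0 ss fC; have s0 : 0 < s by exact: lt_trans ss.
set t := s - s'; have t0 : 0 < t by rewrite subr_gt0.
have st : s = s' + t by rewrite /t; ring.
have tn0 : t != 0 by rewrite gt_eqF.
pose P f C := l1_series s C f /\
  (forall h u, `|h| < s' -> `|h + u| < s' ->
     `|f (h + u) - f h| <= C * (t^-1 * `|u|)) /\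
  exists d dd, [/\ forall i, l1_series s' (C / t) (d i),
      forall h u, `|h| < s' -> `|h + u| < s' ->
        `|f (h + u) - f h - lin_part d h u| <= C * (t ^- 2 * `|u| ^+ 2),
      forall i h u, `|h| < s' -> `|h + u| < s' ->
        `|d i (h + u) - d i h| <= C * (2 * t ^- 2 * `|u|) &
      (forall i h u, `|h| < s' -> `|h + u| < s' ->
        `|d i (h + u) - d i h - lin_part (dd i) h u| <=
          C * (6 * t ^- 3 * `|u| ^+ 2)) /\
      (forall i j h, `|h| < s' ->
        dd i j h = dd j i h /\ `|dd i j h| <= C * (2 * t ^- 2))].
suff [_ [_ [d [dd [d1 d2 _ [d3 d4]]]]]] : P f C.
  by exists d, dd; split => // i j h /(d4 i j h)[].
have lin0 h u : lin_part (fun _ _ => 0) h u = 0.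
  by rewrite /lin_part big1 // => i _; rewrite mulr0.
move: f C fC; apply: (l1_series_coord_ind s0); rewrite /P {P}.
- move=> c; split; first exact: l1_series_cst.
  have t_ge0 : 0 <= t by exact: ltW.
  split=> [h u _ _|]; first by rewrite subrr normr0 !mulr_ge0 ?invr_ge0.
  exists (fun _ _ => 0), (fun _ _ _ => 0); split => [i|h u _ _|i h u _ _|].
  - apply: l1_series_le (@l1_series_cst R m s' 0 s'0).
    by rewrite normr0 divr_ge0.
  - by rewrite lin0 subrr subr0 normr0 !mulr_ge0 ?invr_ge0 ?exprn_ge0.
  - by rewrite subrr normr0 !mulr_ge0 ?invr_ge0 ?exprn_ge0.
  - split=> [i h u _ _|i j h _]; last by rewrite normr0 !mulr_ge0 ?invr_ge0 ?exprn_ge0.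
    by rewrite lin0 subrr subr0 normr0 !mulr_ge0 ?invr_ge0 ?exprn_ge0.
- move=> j f C [fC [fL [d [dd [d1 d2 d3 [d4 d5]]]]]].
  have C0 : 0 <= C by exact: l1_series_ge0 (ltW s0) fC.
  have hj h : `|h| < s' -> `|h 0 j| <= s'.
    by move=> hs; exact: le_trans (coord_le_norm h 0 j) (ltW hs).
  have fb h : `|h| < s' -> `|f h| <= C.
    by move=> hs; apply: l1_series_bound fC; exact: lt_trans ss.
  have db i h : `|h| < s' -> `|d i h| <= C * t^-1.
    by move=> hs; apply: l1_series_bound (d1 i).
  have prod_bound (x y a b : R) : `|x| <= a -> `|y| <= b -> `|x * y| <= a * b.
    by move=> xa yb; rewrite normrM; apply: ler_pM.
  split; first exact: l1_series_coordM.
  split=> [h u hs hus|].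
    have -> : (h + u) 0 j * f (h + u) - h 0 j * f h =
      (h + u) 0 j * (f (h + u) - f h) + u 0 j * f h by rewrite mxE; ring.
    have -> : s * C * (t^-1 * `|u|) = s' * (C * (t^-1 * `|u|)) + `|u| * C.
      by rewrite st; field.
    apply: (le_trans (ler_normD _ _)); apply: lerD; apply: prod_bound.
    - exact: hj.
    - exact: fL.
    - exact: coord_le_norm.
    - exact: fb.
  pose dl (i : 'I_m) : R := (i == j)%:R.
  have dl_le i : `|dl i| <= 1 by rewrite /dl; case: eqP; rewrite ?normr0 ?normr1.
  have lin_dl h u (d' : 'I_m -> 'rV[R]_m -> R) (c : 'rV[R]_m -> R) :
      lin_part (fun i h => h 0 j * d' i h + dl i * c h) h u =
      h 0 j * lin_part d' h u + u 0 j * c h.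
    rewrite /lin_part (eq_bigr (fun i => h 0 j * (u 0 i * d' i h) + dl i * (u 0 i * c h)));
      last by move=> i _; ring.
    rewrite big_split /= -mulr_sumr; congr (_ + _).
    rewrite (bigD1 j) //= /dl eqxx mul1r big1 ?addr0 // => i /negPf ->.
    by rewrite mul0r.
  exists (fun i h => h 0 j * d i h + dl i * f h).
  exists (fun i k h => h 0 j * dd i k h + dl k * d i h + dl i * d k h).
  split=> [i|h u hs hus|i h u hs hus|].
  - have fC' : l1_series s' C f by exact: l1_series_restrict (ltW s'0) (ltW ss) fC.
    have := l1_seriesD (ltW s'0) (l1_series_coordM j s'0 (d1 i)) (l1_seriesZ (dl i) fC').
    apply: l1_series_le.
    have -> : s * C / t = s' * (C / t) + C by rewrite st; field.
    by rewrite lerD2l -[leRHS]mul1r; exact: ler_wpM2r.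
  - rewrite lin_dl.
    have -> : (h + u) 0 j * f (h + u) - h 0 j * f h -
        (h 0 j * lin_part d h u + u 0 j * f h) =
      h 0 j * (f (h + u) - f h - lin_part d h u) + u 0 j * (f (h + u) - f h).
      by rewrite mxE; ring.
    have -> : s * C * (t ^- 2 * `|u| ^+ 2) = s' * (C * (t ^- 2 * `|u| ^+ 2)) +
        `|u| * (C * (t^-1 * `|u|)) by rewrite st; field.
    apply: (le_trans (ler_normD _ _)); apply: lerD; apply: prod_bound.
    - exact: hj.
    - exact: d2.
    - exact: coord_le_norm.
    - exact: fL.
  - have -> : (h + u) 0 j * d i (h + u) + dl i * f (h + u) -
        (h 0 j * d i h + dl i * f h) =
      (h + u) 0 j * (d i (h + u) - d i h) + u 0 j * d i h + dl i * (f (h + u) - f h).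
      by rewrite mxE; ring.
    have -> : s * C * (2 * t ^- 2 * `|u|) = s' * (C * (2 * t ^- 2 * `|u|)) +
        `|u| * (C * t^-1) + 1 * (C * (t^-1 * `|u|)) by rewrite st; field.
    apply: (le_trans (ler_normD _ _)); apply: lerD.
      apply: (le_trans (ler_normD _ _)); apply: lerD; apply: prod_bound.
      - exact: hj.
      - exact: d3.
      - exact: coord_le_norm.
      - exact: db.
    by apply: prod_bound => //; exact: fL.
  - split=> [i h u hs hus|i k h hs].
      have -> : lin_part (fun k h => h 0 j * dd i k h + dl k * d i h + dl i * d k h) h u =
          h 0 j * lin_part (dd i) h u + u 0 j * d i h + dl i * lin_part d h u.
        rewrite -lin_dl /lin_part mulr_sumr -big_split /=.
        by apply: eq_bigr => k _; ring.
      have -> : (h + u) 0 j * d i (h + u) + dl i * f (h + u) -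
          (h 0 j * d i h + dl i * f h) -
          (h 0 j * lin_part (dd i) h u + u 0 j * d i h + dl i * lin_part d h u) =
        h 0 j * (d i (h + u) - d i h - lin_part (dd i) h u) +
        u 0 j * (d i (h + u) - d i h) +
        dl i * (f (h + u) - f h - lin_part d h u).
        by rewrite mxE; ring.
      apply: (@le_trans _ _ (s' * (C * (6 * t ^- 3 * `|u| ^+ 2)) +
        `|u| * (C * (2 * t ^- 2 * `|u|)) + 1 * (C * (t ^- 2 * `|u| ^+ 2)))).
        apply: (le_trans (ler_normD _ _)); apply: lerD.
          apply: (le_trans (ler_normD _ _)); apply: lerD; apply: prod_bound.
          - exact: hj.
          - exact: d4.
          - exact: coord_le_norm.
          - exact: d3.
        by apply: prod_bound => //; exact: d2.
      have -> : s * C * (6 * t ^- 3 * `|u| ^+ 2) = s' * (C * (6 * t ^- 3 * `|u| ^+ 2)) +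
          `|u| * (C * (2 * t ^- 2 * `|u|)) + 1 * (C * (t ^- 2 * `|u| ^+ 2)) +
          3 * (C * (t ^- 2 * `|u| ^+ 2)) by rewrite st; field.
      by rewrite lerDl !mulr_ge0 ?invr_ge0 ?exprn_ge0 // ltW.
    have [sy bd] := d5 i k h hs; split; first by rewrite sy; ring.
    have -> : s * C * (2 * t ^- 2) = s' * (C * (2 * t ^- 2)) + 1 * (C * t^-1) +
        1 * (C * t^-1) by rewrite st; field.
    apply: (le_trans (ler_normD _ _)); apply: lerD; last by apply: prod_bound => //; exact: db.
    apply: (le_trans (ler_normD _ _)); apply: lerD; apply: prod_bound => //.
    - exact: hj.
    - exact: db.
- move=> f g C D [fC [fL [d [dd [d1 d2 d3 [d4 d5]]]]]] [gD [gL [e [ee [e1 e2 e3 [e4 e5]]]]]].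
  have linD (d' e' : 'I_m -> 'rV[R]_m -> R) h u :
      lin_part (fun i h => d' i h + e' i h) h u = lin_part d' h u + lin_part e' h u.
    by rewrite /lin_part -big_split /=; apply: eq_bigr => i _; rewrite mulrDr.
  have tri (x y a b w : R) : `|x| <= a * w -> `|y| <= b * w -> `|x + y| <= (a + b) * w.
    by move=> xa yb; rewrite mulrDl; apply: (le_trans (ler_normD _ _)); exact: lerD.
  split; first exact: l1_seriesD (ltW s0) fC gD.
  split=> [h u hs hus|].
    by rewrite opprD addrACA; apply: tri; [exact: fL|exact: gL].
  exists (fun i h => d i h + e i h), (fun i j h => dd i j h + ee i j h).
  split=> [i|h u hs hus|i h u hs hus|].
  - by rewrite mulrDl; exact: l1_seriesD (ltW s'0) (d1 i) (e1 i).
  - rewrite linD; set A := lin_part _ _ _; set B := lin_part _ _ _.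
    have -> : f (h + u) + g (h + u) - (f h + g h) - (A + B) =
      (f (h + u) - f h - A) + (g (h + u) - g h - B) by ring.
    by apply: tri; [exact: d2|exact: e2].
  - by rewrite opprD addrACA; apply: tri; [exact: d3|exact: e3].
  - split=> [i h u hs hus|i j h hs].
      rewrite linD; set A := lin_part _ _ _; set B := lin_part _ _ _.
      have -> : d i (h + u) + e i (h + u) - (d i h + e i h) - (A + B) =
        (d i (h + u) - d i h - A) + (e i (h + u) - e i h - B) by ring.
      by apply: tri; [exact: d4|exact: e4].
    have [sd bd] := d5 i j h hs; have [se be] := e5 i j h hs.
    by split; [rewrite sd se|exact: tri].
- move=> F D f C FD DC Ff.
  have FL k : forall h u, `|h| < s' -> `|h + u| < s' ->
    `|F k (h + u) - F k h| <= D k * (t^-1 * `|u|) := (FD k).2.1.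
  have /choice[d dP] := fun k => (FD k).2.2.
  have /choice[dd ddP] := dP.
  have Fs h : `|h| < s' -> \sum_(k < n) F k h @[n --> \oo] --> f h.
    by move=> hs; apply: Ff; exact: lt_trans ss.
  have t_ge0 : 0 <= t by exact: ltW.
  have ds i h : `|h| < s' ->
      \sum_(k < n) d k i h @[n --> \oo] --> limn (fun n => \sum_(k < n) d k i h).
    move=> hs; apply: (@series_cvg _ (fun k => d k i h) D C t^-1) => //;
      first by rewrite invr_ge0.
    by move=> k; have [/(_ i) d1 _ _ _] := ddP k; exact: l1_series_bound d1.
  have dds i j h : `|h| < s' ->
      \sum_(k < n) dd k i j h @[n --> \oo] --> limn (fun n => \sum_(k < n) dd k i j h).
    move=> hs; apply: (@series_cvg _ (fun k => dd k i j h) D C (2 * t ^- 2)) => //.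
      by rewrite !mulr_ge0 ?invr_ge0 ?exprn_ge0.
    by move=> k; have [_ _ _ [_ /(_ i j h hs)[]]] := ddP k.
  have lins (e : nat -> 'I_m -> 'rV[R]_m -> R) (l : 'I_m -> 'rV[R]_m -> R) h u :
      (forall i, \sum_(k < n) e k i h @[n --> \oo] --> l i h) ->
      \sum_(k < n) lin_part (e k) h u @[n --> \oo] --> lin_part l h u.
    move=> el; rewrite /lin_part; under eq_fun do rewrite exchange_big /=.
    apply: cvg_big => [|i _]; first exact: add_continuous.
    under eq_fun do rewrite -mulr_sumr.
    by apply: cvgM; [exact: cvg_cst|exact: el].
  split; first exact: l1_series_sum s0 (fun k => (FD k).1) DC Ff.
  split=> [h u hs hus|].
    apply: (@series_bound _ (fun k => F k (h + u) - F k h) D) => //.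
    - by rewrite !mulr_ge0 ?invr_ge0.
    - by move=> k; exact: FL.
    - by under eq_fun do rewrite sumrB; apply: cvgB; exact: Fs.
  exists (fun i h => limn (fun n => \sum_(k < n) d k i h)).
  exists (fun i j h => limn (fun n => \sum_(k < n) dd k i j h)).
  split=> [i|h u hs hus|i h u hs hus|].
  - apply: (@l1_series_sum _ _ _ _ (fun k => D k / t) (fun k => d k i)) => //.
    - by move=> k; have [/(_ i)] := ddP k.
    - by move=> n; rewrite -mulr_suml; apply: ler_wpM2r; rewrite ?invr_ge0.
    - by move=> h hs; exact: (ds i h hs).
  - apply: (@series_bound _ (fun k => F k (h + u) - F k h - lin_part (d k) h u) D) => //.
    - by rewrite !mulr_ge0 ?invr_ge0 ?exprn_ge0.
    - by move=> k; have [_ d2 _ _] := ddP k; exact: d2.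
    - under eq_fun do rewrite !sumrB.
      by apply: cvgB; [apply: cvgB; exact: Fs|apply: lins => i; exact: (ds i h hs)].
  - apply: (@series_bound _ (fun k => d k i (h + u) - d k i h) D) => //.
    - by rewrite !mulr_ge0 ?invr_ge0 ?exprn_ge0.
    - by move=> k; have [_ _ d3 _] := ddP k; exact: d3.
    - by under eq_fun do rewrite !sumrB; apply: cvgB; exact: ds.
  - split=> [i h u hs hus|i j h hs].
      apply: (@series_bound _
        (fun k => d k i (h + u) - d k i h - lin_part (dd k i) h u) D) => //.
      - by rewrite !mulr_ge0 ?invr_ge0 ?exprn_ge0.
      - by move=> k; have [_ _ _ [d4 _]] := ddP k; exact: d4.
      - under eq_fun do rewrite !sumrB.
        apply: cvgB; first by apply: cvgB; exact: (ds i).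
        by apply: (lins (fun k => dd k i)) => j; exact: (dds i j h hs).
    split.
      congr (limn _); apply/funext => n; apply: eq_bigr => k _.
      by have [_ _ _ [_ /(_ i j h hs)[]]] := ddP k.
    apply: (@series_bound _ (fun k => dd k i j h) D) => //.
    - by rewrite !mulr_ge0 ?invr_ge0 ?exprn_ge0.
    - by move=> k; have [_ _ _ [_ /(_ i j h hs)[]]] := ddP k.
    - exact: (dds i j h hs).
Qed.

End Derivatives.

(** * Analytic functions *)

Section Taylor.
Variables (R : realType) (m : nat).
Implicit Types (f g : 'rV[R]_m -> R) (h u : 'rV[R]_m).

(** The part of degree at least [k] of a series has norm at radius [r] at most
    [(r / s) ^+ k] times the norm at radius [s]. *)
Lemma l1_series_taylor s C f : 0 < s -> l1_series s C f ->
  exists (c : R) (b : 'I_m -> R), forall r, 0 < r -> r <= s ->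
    l1_series r (C * (r / s)) (fun h => f h - c) /\
    l1_series r (C * (r / s) ^+ 2) (fun h => f h - c - \sum_i h 0 i * b i).
Proof.
move=> s0 fC.
pose P f C := l1_series s C f /\ exists (c : R) (b : 'I_m -> R),
  [/\ `|c| <= C, forall i, `|b i| <= C * s^-1 & forall r, 0 < r -> r <= s ->
    l1_series r (C * (r / s)) (fun h => f h - c) /\
    l1_series r (C * (r / s) ^+ 2) (fun h => f h - c - \sum_i h 0 i * b i)].
suff [_ [c [b [_ _ H]]]] : P f C by exists c, b.
have si0 : 0 <= s^-1 by rewrite invr_ge0 ltW.
have sn0 : s != 0 by rewrite gt_eqF.
move: f C fC; apply: (l1_series_coord_ind s0); rewrite /P {P}.
- move=> t; split; first exact: l1_series_cst.
  exists t, (fun=> 0); split => [//|i|r r0 rs]; first by rewrite normr0 mulr_ge0.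
  have rs0 : 0 <= r / s by rewrite divr_ge0 // ltW.
  split.
    have := @l1_series_cst R m r 0 r0; rewrite normr0 => /(l1_series_le _) H.
    apply: (@eq_l1_series _ _ _ _ (fun=> 0)); first by move=> h _; rewrite subrr.
    by apply: H; rewrite mulr_ge0.
  have := @l1_series_cst R m r 0 r0; rewrite normr0 => /(l1_series_le _) H.
  apply: (@eq_l1_series _ _ _ _ (fun=> 0)).
    by move=> h _; rewrite subrr big1 ?subr0 // => i _; rewrite mulr0.
  by apply: H; rewrite mulr_ge0 ?exprn_ge0.
- move=> j f C [fC [c [b [cC bC H]]]]; split; first exact: l1_series_coordM.
  have C0 : 0 <= C by exact: le_trans cC.
  exists 0, (fun i => (i == j)%:R * c); split => [|i|r r0 rs].
  - by rewrite normr0 mulr_ge0 // ltW.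
  - rewrite normrM (_ : s * C * s^-1 = 1 * C); last by field.
    by apply: ler_pM => //; case: eqP; rewrite ?normr0 ?normr1.
  - have [H1 H2] := H r r0 rs; split.
      have := l1_series_coordM j r0 (l1_series_restrict (ltW r0) rs fC).
      rewrite (_ : r * C = s * C * (r / s)); last by field.
      by apply: eq_l1_series => h _; rewrite subr0.
    have := l1_series_coordM j r0 H1.
    rewrite (_ : r * (C * (r / s)) = s * C * (r / s) ^+ 2); last by field.
    apply: eq_l1_series => h _; rewrite subr0 (bigD1 j) //= eqxx mul1r big1.
      by ring.
    by move=> i /negPf ->; rewrite mul0r mulr0.
- move=> f g C D [fC [c [b [cC bC H]]]] [gD [d [e [dD eD K]]]].
  split; first exact: l1_seriesD (ltW s0) fC gD.
  exists (c + d), (fun i => b i + e i); split => [|i|r r0 rs].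
  - by apply: (le_trans (ler_normD _ _)); exact: lerD.
  - by rewrite mulrDl; apply: (le_trans (ler_normD _ _)); exact: lerD.
  - have [H1 H2] := H r r0 rs; have [K1 K2] := K r r0 rs; split.
      have := l1_seriesD (ltW r0) H1 K1; rewrite -mulrDl.
      by apply: eq_l1_series => h _; ring.
    have := l1_seriesD (ltW r0) H2 K2; rewrite -mulrDl.
    apply: eq_l1_series => h _; under [in RHS]eq_bigr do rewrite mulrDr.
    by rewrite big_split /=; ring.
- move=> F D f C FD DC Ff.
  have /choice[c cP] := fun k => (FD k).2.
  have /choice[b bP] := cP.
  have cs : \sum_(k < n) c k @[n --> \oo] --> limn (fun n => \sum_(k < n) c k).
    apply: (@series_cvg _ c D C 1) => // k.
    by have [] := bP k; rewrite mulr1.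
  have bs i : \sum_(k < n) b k i @[n --> \oo] --> limn (fun n => \sum_(k < n) b k i).
    apply: (@series_cvg _ (b ^~ i) D C s^-1) => // k.
    by have [_ /(_ i)] := bP k.
  split; first exact: l1_series_sum s0 (fun k => (FD k).1) DC Ff.
  exists (limn (fun n => \sum_(k < n) c k)), (fun i => limn (fun n => \sum_(k < n) b k i)).
  split => [|i|r r0 rs].
  - rewrite -[C]mulr1; apply: (@series_bound _ c D) => // k.
    by rewrite mulr1; have [] := bP k.
  - apply: (@series_bound _ (b ^~ i) D) => // k.
    by have [_ /(_ i)] := bP k.
  - have rs0 : 0 <= r / s by rewrite divr_ge0 // ltW.
    have lts h : `|h| < r -> `|h| < s by move=> /lt_le_trans; apply.
    split.
      apply: (@l1_series_sum _ _ _ _ (fun k => D k * (r / s)) (fun k h => F k h - c k)) => //.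
      + by move=> k; have [_ _ /(_ r r0 rs)[]] := bP k.
      + by move=> n; rewrite -mulr_suml; apply: ler_wpM2r.
      + move=> h /lts hs; under eq_fun do rewrite sumrB.
        by apply: cvgB => //; exact: Ff.
    apply: (@l1_series_sum _ _ _ _ (fun k => D k * (r / s) ^+ 2)
        (fun k h => F k h - c k - \sum_i h 0 i * b k i)) => //.
    + by move=> k; have [_ _ /(_ r r0 rs)[]] := bP k.
    + by move=> n; rewrite -mulr_suml; apply: ler_wpM2r => //; exact: exprn_ge0.
    + move=> h /lts hs; under eq_fun do rewrite !sumrB exchange_big /=.
      apply: cvgB; first by apply: cvgB => //; exact: Ff.
      apply: cvg_big => [|i _]; first exact: add_continuous.
      under eq_fun do rewrite -mulr_sumr.
      by apply: cvgM; [exact: cvg_cst|exact: bs].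
Qed.

(** The constant term is the value at the origin because the remainder at radius
    [r] is at most [C * (r / s)], for every [r]. *)
Lemma l1_series_taylor0 s C f : 0 < s -> l1_series s C f ->
  exists b : 'I_m -> R, forall r, 0 < r -> r <= s ->
    l1_series r (C * (r / s)) (fun h => f h - f 0) /\
    l1_series r (C * (r / s) ^+ 2) (fun h => f h - f 0 - \sum_i h 0 i * b i).
Proof.
move=> s0 fC; have [c [b H]] := l1_series_taylor s0 fC; exists b.
suff -> : f 0 = c by [].
have C0 : 0 <= C := l1_series_ge0 (ltW s0) fC.
have C1 : 0 < C + 1 by exact: ltr_wpDl.
apply/eqP; rewrite -subr_eq0 -normr_eq0 eq_le normr_ge0 andbT leNgt; apply/negP.
set e := `|f 0 - c| => e0; pose t := Num.min 1 (e / (C + 1)).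
have t0 : 0 < t by rewrite lt_min ltr01 divr_gt0.
have t1 : t <= 1 by rewrite ge_min lexx.
have te : t * (C + 1) <= e by rewrite -ler_pdivlMr // ge_min lexx orbT.
have st0 : 0 < s * t by rewrite mulr_gt0.
have [|Hd _] := H (s * t) st0; first by rewrite -[leRHS]mulr1 ler_pM2l.
have := l1_series_bound (h := 0) _ Hd; rewrite normr0 => /(_ st0).
rewrite -/e mulrAC divff ?mul1r ?gt_eqF //.
by nra.
Qed.

Lemma l1_series_subr0 s C f r : 0 < s -> l1_series s C f -> 0 < r -> r <= s ->
  l1_series r (C * (r / s)) (fun h => f h - f 0).
Proof.
by move=> s0 fC r0 rs; have [b /(_ r r0 rs)[]] := l1_series_taylor0 s0 fC.
Qed.

(** Lipschitz dependence of a substitution, applied to two constant maps. *)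
Lemma l1_series_lipschitz s C f h h' : 0 < s -> l1_series s C f ->
  `|h| <= s / 2 -> `|h'| <= s / 2 -> `|f h - f h'| <= 2 * C / s * `|h - h'|.
Proof.
move=> s0 fC hs h's; have s2 : 0 < s / 2 by rewrite divr_gt0.
have ss2 : s / 2 < s by lra.
have cst_map (v : 'rV[R]_m) t : `|v| <= t -> l1_map 1 t (fun _ : 'rV[R]_m => v).
  move=> vt i; apply: l1_series_le (@l1_series_cst R m 1 (v 0 i) ltr01).
  exact: le_trans (coord_le_norm v 0 i) vt.
have := l1_series_comp_lipschitz ltr01 (normr_ge0 (h - h')) s2 ss2 fC
  (cst_map h _ hs) (cst_map h' _ h's) (cst_map (h - h') _ (lexx _)).
move=> /(l1_series_bound (h := 0)); rewrite normr0 => /(_ ltr01).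
suff -> : C * `|h - h'| / (s - s / 2) = 2 * C / s * `|h - h'| by [].
by field; rewrite gt_eqF.
Qed.

End Taylor.

Lemma diff_littleo (R : realType) (V W : normedModType R) (f : V -> W)
    (g : {linear V -> W}) x : continuous g ->
  (forall eps : R, 0 < eps -> \forall u \near (0 : V),
     `|f (x + u) - f x - g u| <= eps * `|u|) ->
  differentiable f x /\ 'd f x = g :> (V -> W).
Proof.
move=> gc fg; have fe : f \o shift x = cst (f x) + g +o_ 0 id.
  apply/eqaddoP => eps /fg; apply: filterS => u.
  rewrite -[X in _ -> `|X| <= _]/(f (u + x) - (f x + g u)) opprD addrA.
  by rewrite [u + x]addrC.
have ge := diff_unique gc fe.
by split; [apply/diff_locallyP; rewrite ge|exact: ge].
Qed.

Section AnalyticAt.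
Variable R : realType.

Lemma analytic_atP m (f : 'rV[R]_m -> R) p : analytic_at f p <->
  exists s C, 0 < s /\ l1_series s C (fun h => f (p + h)).
Proof.
have eqm c (h : 'rV[R]_m) K : \sum_(a : {ffun 'I_m -> 'I_K})
    c (exponent a) * \prod_i h 0 i ^+ a i = box_sum (fun a => c a * monomial a h) K.
  apply: eq_bigr => a _; congr (_ * _); apply: eq_bigr => i _.
  by rewrite ffunE.
have eqn c (r : R) K : \sum_(a : {ffun 'I_m -> 'I_K})
    `|c (exponent a)| * r ^+ (\sum_i a i)%N =
    box_sum (fun a => `|c a| * r ^+ degree a) K.
  apply: eq_bigr => a _; rewrite /degree; congr (_ * _ ^+ _).
  by apply: eq_bigr => i _; rewrite ffunE.
split=> [[c [s [C [s0 cC cf]]]]|[s [C [s0 [c [cC cf]]]]]].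
  exists s, C; split => //; exists c; split => [K|h hs]; first by rewrite -eqn.
  have := cf h hs.
  by rewrite (_ : (fun K => _) = box_sum (fun a => c a * monomial a h)) //; exact/funext.
exists c, s, C; split => // [K|h hs]; first by rewrite eqn.
by under eq_fun do rewrite eqm; exact: cf.
Qed.

Lemma analytic_cst m (c : R) (p : 'rV[R]_m) : analytic_at (fun=> c) p.
Proof. by apply/analytic_atP; exists 1, `|c|; split => //; exact: l1_series_cst. Qed.

Lemma analytic_coord m (i : 'I_m) p : analytic_at (fun x : 'rV[R]_m => x 0 i) p.
Proof.
apply/analytic_atP; exists 1, (`|p 0 i| + 1); split => //.
have := l1_seriesD ler01 (@l1_series_cst R m 1 (p 0 i) ltr01) (l1_series_coord i ltr01).
by apply: eq_l1_series => h _; rewrite mxE.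
Qed.

(** The smaller of the two radii serves both series. *)
Lemma analytic_at_common m (f g : 'rV[R]_m -> R) p :
  analytic_at f p -> analytic_at g p -> exists s C D, [/\ 0 < s,
    l1_series s C (fun h => f (p + h)) & l1_series s D (fun h => g (p + h))].
Proof.
move=> /analytic_atP[s [C [s0 fC]]] /analytic_atP[t [D [t0 gD]]].
have m0 : 0 < Num.min s t by rewrite lt_min s0.
exists (Num.min s t), C, D; split => //.
  by apply: l1_series_restrict fC; [exact: ltW|rewrite ge_min lexx].
by apply: l1_series_restrict gD; [exact: ltW|rewrite ge_min lexx orbT].
Qed.

Lemma analyticD m (f g : 'rV[R]_m -> R) p :
  analytic_at f p -> analytic_at g p -> analytic_at (fun x => f x + g x) p.
Proof.
move=> fp gp; have [s [C [D [s0 fC gD]]]] := analytic_at_common fp gp.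
by apply/analytic_atP; exists s, (C + D); split => //; exact: l1_seriesD (ltW s0) fC gD.
Qed.

Lemma analyticM m (f g : 'rV[R]_m -> R) p :
  analytic_at f p -> analytic_at g p -> analytic_at (fun x => f x * g x) p.
Proof.
move=> fp gp; have [s [C [D [s0 fC gD]]]] := analytic_at_common fp gp.
by apply/analytic_atP; exists s, (C * D); split => //; exact: l1_seriesM s0 fC gD.
Qed.

Lemma analyticN m (f : 'rV[R]_m -> R) p :
  analytic_at f p -> analytic_at (fun x => - f x) p.
Proof.
move=> /analytic_atP[s [C [s0 fC]]]; apply/analytic_atP; exists s, C; split => //.
exact: l1_seriesN.
Qed.

Lemma analyticB m (f g : 'rV[R]_m -> R) p :
  analytic_at f p -> analytic_at g p -> analytic_at (fun x => f x - g x) p.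
Proof. by move=> fp /analyticN; exact: analyticD. Qed.

Lemma analytic_sum m n (F : 'I_n -> 'rV[R]_m -> R) p :
  (forall i, analytic_at (F i) p) -> analytic_at (fun x => \sum_i F i x) p.
Proof.
move=> Fp; elim: (index_enum _) => [|i r IH].
  rewrite (_ : (fun x => _) = fun=> 0); first exact: analytic_cst.
  by apply/funext => x; rewrite big_nil.
rewrite (_ : (fun x => _) = fun x => F i x + \sum_(j <- r) F j x).
  exact: analyticD.
by apply/funext => x; rewrite big_cons.
Qed.

Lemma analytic_eq_near m (f g : 'rV[R]_m -> R) p :
  (\forall x \near p, f x = g x) -> analytic_at f p -> analytic_at g p.
Proof.
move=> /nbhs_ballP[e /= e0 fg] /analytic_atP[s [C [s0 fC]]].
have m0 : 0 < Num.min s e by rewrite lt_min s0.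
apply/analytic_atP; exists (Num.min s e), C; split => //.
apply: (@eq_l1_series _ _ _ _ (fun h => f (p + h))) => [h|]; last first.
  by apply: l1_series_restrict fC; [exact: ltW|rewrite ge_min lexx].
rewrite lt_min => /andP[_ he]; apply: fg.
by rewrite -ball_normE /= opprD addrA subrr sub0r normrN.
Qed.

(** Recentring is the substitution of a translation. *)
Lemma analytic_near m (f : 'rV[R]_m -> R) p :
  analytic_at f p -> \forall q \near p, analytic_at f q.
Proof.
move=> /analytic_atP[s [C [s0 fC]]].
have s20 : 0 < s / 2 by rewrite divr_gt0.
near=> q; have qp : `|q - p| < s / 2.
  by near: q; apply: (@cvgr_distC_lt _ _ _ _ _ _ _ (@cvg_id _ _)).
apply/analytic_atP; exists (s / 4), C; split; first by rewrite divr_gt0.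
apply: (@eq_l1_series _ _ _ _ (fun h => f (p + ((q - p) + h)))).
  by move=> h _; rewrite addrA subrKC.
apply: (@l1_series_comp R m m _ s (s / 2 + s / 4) _ (fun h => f (p + h))
  (fun h => q - p + h)) => //; first by rewrite divr_gt0.
  by lra.
move=> i; have s4 : 0 < s / 4 by rewrite divr_gt0.
have := l1_seriesD (ltW s4) (@l1_series_cst R m _ ((q - p) 0 i) s4) (l1_series_coord i s4).
move=> /(l1_series_le (_ : _ <= s / 2 + s / 4)) H.
apply: (@eq_l1_series _ _ _ _ (fun h => (q - p) 0 i + h 0 i)).
  by move=> h _; rewrite [RHS]mxE.
by apply: H; rewrite lerD2r; apply: le_trans (ltW qp); exact: coord_le_norm.
Unshelve. all: by end_near. Qed.

Lemma analytic_map_l1 m k (g : 'rV[R]_m -> 'rV[R]_k) p :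
  analytic_map_at g p -> exists s C, [/\ 0 < s, 0 <= C & l1_map s C (fun h => g (p + h))].
Proof.
move=> gp; have /choice[s sP] := fun i => (analytic_atP _ _).1 (gp i).
have /choice[C CP] := sP.
have s0 i : 0 < s i by have [] := CP i.
have C0 i : 0 <= C i by have [/ltW/l1_series_ge0] := CP i; apply.
(* a positive lower bound of all the radii, even if there are none *)
pose t := (1 + \sum_i (s i)^-1)^-1.
have sum0 : 0 <= \sum_i (s i)^-1 by apply: sumr_ge0 => i _; rewrite invr_ge0 ltW.
have t0 : 0 < t by rewrite invr_gt0 ltr_pwDl.
exists t, (\sum_i C i); split => //; first exact: sumr_ge0.
move=> i; have [_] := CP i; move/(l1_series_restrict (ltW t0)) => H.
apply: l1_series_le (H _); first by rewrite (bigD1 i) //= lerDl sumr_ge0.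
rewrite -[leRHS]invrK lef_pV2 ?posrE ?invr_gt0 ?ltr_pwDl //.
by rewrite (bigD1 i) //= addrCA lerDl addr_ge0 // sumr_ge0 // => j _; rewrite invr_ge0 ltW.
Qed.

Lemma analytic_comp m k (f : 'rV[R]_k -> R) (g : 'rV[R]_m -> 'rV[R]_k) p :
  analytic_at f (g p) -> analytic_map_at g p -> analytic_at (fun x => f (g x)) p.
Proof.
move=> /analytic_atP[s [C [s0 fC]]] /analytic_map_l1[t [D [t0 D0 gD]]].
have D1 : 0 < D + 1 by exact: ltr_wpDl.
pose r := Num.min t (s * t / (2 * (D + 1))).
have r0 : 0 < r by rewrite lt_min t0 divr_gt0 ?mulr_gt0.
have rt : r <= t by rewrite ge_min lexx.
have rs : D * (r / t) <= s / 2.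
  have : r * (2 * (D + 1)) <= s * t by rewrite -ler_pdivlMr ?mulr_gt0 // ge_min lexx orbT.
  move=> H; rewrite mulrA ler_pdivrMr // mulrAC ler_pdivlMr //.
  by apply: le_trans H; nra.
apply/analytic_atP; exists r, C; split => //.
apply: (@eq_l1_series _ _ _ _ (fun h => f (g p + (g (p + h) - g p)))).
  by move=> h _; rewrite subrKC.
apply: (@l1_series_comp R m k _ s (s / 2) _ (fun h => f (g p + h))
  (fun h => g (p + h) - g p)) => //; first by lra.
move=> i; have := l1_series_subr0 t0 (gD i) r0 rt => /(l1_series_le rs).
by apply: eq_l1_series => h _; rewrite addr0 !mxE.
Qed.

Lemma analytic_map_comp m k l (f : 'rV[R]_k -> 'rV[R]_l) (g : 'rV[R]_m -> 'rV[R]_k) p :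
  analytic_map_at f (g p) -> analytic_map_at g p -> analytic_map_at (fun x => f (g x)) p.
Proof. by move=> fp gp j; exact: analytic_comp (fp j) gp. Qed.

Lemma analytic_map_near m k (g : 'rV[R]_m -> 'rV[R]_k) p :
  analytic_map_at g p -> \forall q \near p, analytic_map_at g q.
Proof.
move=> gp; pose P j q := analytic_at (fun x => g x 0 j) q.
suff : \forall q \near p, forall j, P j q by [].
by apply: (@filter_forall _ _ P (nbhs p)) => j; exact: analytic_near (gp j).
Qed.

Lemma diff_lin_form m (f : 'rV[R]_m -> R) (b : 'I_m -> R) x :
  (forall eps, 0 < eps -> exists2 e, 0 < e & forall u, `|u| < e ->
     `|f (x + u) - f x - \sum_i u 0 i * b i| <= eps * `|u|) ->
  differentiable f x /\ forall u, 'd f x u = \sum_i u 0 i * b i.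
Proof.
move=> fb; set g := fun u : 'rV[R]_m => \sum_i u 0 i * b i.
have glin : linear g.
  move=> c u v; rewrite /g scaler_sumr -big_split /=; apply: eq_bigr => i _.
  by rewrite !mxE mulrDl -mulrA.
pose gM := GRing.isLinear.Build _ _ _ _ _ glin.
pose gL : {linear 'rV[R]_m -> R} := HB.pack g gM.
have gc : continuous gL.
  move=> u; rewrite (_ : (gL : 'rV[R]_m -> R) =
    \sum_i ((fun v : 'rV[R]_m => v 0 i) * cst (b i))); last first.
    by apply/funext => v; rewrite fct_sumE.
  apply: differentiable_continuous; apply: differentiable_sum => i.
  by apply: differentiableM; [exact: differentiable_coord|exact: differentiable_cst].
suff [fx fd] : differentiable f x /\ 'd f x = gL :> ('rV[R]_m -> R^o).
  by split => // u; rewrite fd.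
apply: (diff_littleo gc) => eps /fb[e e0 fe].
near=> u; apply: fe; near: u; exact: (@nbhs0_lt _ 'rV[R]_m _ e0).
Unshelve. all: by end_near. Qed.

Lemma diff_quadratic m (f : 'rV[R]_m -> R) (b : 'I_m -> R) x (e K : R) : 0 < e ->
  (forall u, `|u| < e -> `|f (x + u) - f x - \sum_i u 0 i * b i| <= K * `|u| ^+ 2) ->
  differentiable f x /\ forall u, 'd f x u = \sum_i u 0 i * b i.
Proof.
move=> e0 fK; apply: diff_lin_form => eps eps0.
have K1 : 0 < `|K| + 1 by exact: ltr_wpDl.
exists (Num.min e (eps / (`|K| + 1))) => [|u]; first by rewrite lt_min e0 divr_gt0.
rewrite lt_min => /andP[ue uK].
apply: le_trans (fK u ue) _; rewrite expr2 mulrA; apply: ler_wpM2r => //.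
move: uK; rewrite ltr_pdivlMr // => /ltW; apply: le_trans.
rewrite mulrC; apply: ler_wpM2l => //.
by apply: le_trans (ler_norm K) _; rewrite lerDl.
Qed.

(** The series of partial derivatives approximate increments up to a quadratic
    error; by uniqueness of the differential they are the differentials of [f]
    and of its directional derivatives. *)
Lemma analytic_derivatives m (f : 'rV[R]_m -> R) p : analytic_at f p ->
  [/\ differentiable f p,
      forall u, analytic_at (fun x => 'd f x u) p &
      forall u v, 'd (fun x => 'd f x u) p v = 'd (fun x => 'd f x v) p u].
Proof.
move=> /analytic_atP[s [C [s0 fC]]].
have s2 : 0 < s / 2 by rewrite divr_gt0.
have [|d [dd [d1 d2 d3 d4]]] := l1_series_derivatives s2 _ fC; first by lra.
set t := s - s / 2 in d1 d2 d3.
have inb (h : 'rV[R]_m) : `|h| < s / 2 ->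
    exists2 e : R, 0 < e & forall u, `|u| < e -> `|h + u| < s / 2.
  move=> hs; exists (s / 2 - `|h|) => [|u ue]; first by rewrite subr_gt0.
  by apply: le_lt_trans (ler_normD _ _) _; rewrite -ltrBrDl.
have fd (h : 'rV[R]_m) : `|h| < s / 2 ->
    differentiable f (p + h) /\ forall u, 'd f (p + h) u = \sum_i u 0 i * d i h.
  move=> hs; have [e e0 eP] := inb h hs.
  apply: (@diff_quadratic _ _ _ _ e (C * t ^- 2)) => // u ue.
  by rewrite -[p + h + u]addrA -mulrA; apply: d2 => //; exact: eP.
have near_p (x : 'rV[R]_m) : `|x - p| < s / 2 -> x = p + (x - p) by rewrite subrKC.
have nbhs_p : \forall x \near p, `|x - p| < s / 2.
  by apply: filterS (nbhsx_ballx p (s / 2) s2) => x; rewrite -ball_normE /= distrC.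
have df (u : 'rV[R]_m) : \forall x \near p, \sum_i u 0 i * d i (x - p) = 'd f x u.
  apply: filterS nbhs_p => x xp.
  by have [_ /(_ u)] := fd _ xp; rewrite -near_p.
have n0 : `|0 : 'rV[R]_m| < s / 2 by rewrite normr0.
have dd0 (u : 'rV[R]_m) v :
    'd (fun x => 'd f x u) p v = \sum_j v 0 j * \sum_i u 0 i * dd i j 0.
  have [|_ ->] // := @diff_quadratic _ (fun x => 'd f x u)
    (fun j => \sum_i u 0 i * dd i j 0) p (s / 2)
      (\sum_i `|u 0 i| * (C * (6 * t ^- 3))) s2 _.
  move=> {}v vs.
  have df_eq w : `|w| < s / 2 -> 'd f (p + w) u = \sum_i u 0 i * d i w.
    by move=> ws; have [_ ->] := fd _ ws.
  have df_p : 'd f p u = \sum_i u 0 i * d i 0 by rewrite -(df_eq 0 n0) addr0.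
  suff H : `|\sum_i u 0 i * d i v - \sum_i u 0 i * d i 0 -
      \sum_j v 0 j * \sum_i u 0 i * dd i j 0| <=
      (\sum_i `|u 0 i| * (C * (6 * t ^- 3))) * `|v| ^+ 2.
    by move: H; rewrite -(df_eq v vs) -df_p.
  rewrite (_ : _ - _ = \sum_i u 0 i * (d i v - d i 0 - lin_part (dd i) 0 v)).
    rewrite mulr_suml; apply: (le_trans (ler_norm_sum _ _ _)).
    apply: ler_sum => i _; rewrite normrM -!mulrA; apply: ler_wpM2l => //.
    by have := d3 i 0 v n0; rewrite add0r -!mulrA; apply.
  under [RHS]eq_bigr do rewrite !mulrBr.
  rewrite !sumrB; congr (_ - _ - _).
  under eq_bigr do rewrite mulr_sumr; rewrite exchange_big /=.
  by apply: eq_bigr => i _; rewrite /lin_part mulr_sumr; apply: eq_bigr => j _; ring.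
split.
- by have := fd 0 n0; rewrite addr0 => -[].
- move=> u; apply: analytic_eq_near (df u) _.
  apply: analytic_sum => i; apply: analyticM; first exact: analytic_cst.
  apply/analytic_atP; exists (s / 2), (C / t); split => //.
  by apply: eq_l1_series (d1 i) => h _; rewrite addrAC subrr add0r.
- move=> u v; apply: etrans (dd0 u v) (etrans _ (esym (dd0 v u))).
  under eq_bigr do rewrite mulr_sumr; rewrite exchange_big /=.
  apply: eq_bigr => i _; rewrite mulr_sumr; apply: eq_bigr => j _.
  by rewrite d4 ?normr0 // mulrCA.
Qed.

(** At radius [r] the remainder of second order has norm O(r^2), hence on half of
    that polydisc it is Lipschitz with constant O(r). *)
Lemma taylor_strict m (f : 'rV[R]_m -> R) p s C (b : 'I_m -> R) : 0 < s -> 0 <= C ->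
  (forall r, 0 < r -> r <= s -> l1_series r (C * (r / s) ^+ 2)
     (fun h => f (p + h) - f (p + 0) - \sum_i h 0 i * b i)) ->
  forall eps, 0 < eps -> exists2 e, 0 < e &
    forall x y, `|x - p| < e -> `|y - p| < e ->
    `|f x - f y - \sum_i (x - y) 0 i * b i| <= eps * `|x - y|.
Proof.
move=> s0 C0 Hb e' e'0; have C1 : 0 < 2 * (C + 1) by rewrite mulr_gt0 // ltr_wpDl.
have lip r : 0 < r -> r <= s -> forall h h', `|h| <= r / 2 -> `|h'| <= r / 2 ->
    `|f (p + h) - f (p + h') - \sum_i (h - h') 0 i * b i| <=
    2 * C * r / s ^+ 2 * `|h - h'|.
  move=> r0 rs h h' hr h'r.
  have := l1_series_lipschitz r0 (Hb r r0 rs) hr h'r.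
  rewrite (_ : 2 * (C * (r / s) ^+ 2) / r = 2 * C * r / s ^+ 2); last first.
    by field; rewrite !gt_eqF.
  congr (`|_| <= _); rewrite (_ : \sum_i (h - h') 0 i * b i =
    \sum_i h 0 i * b i - \sum_i h' 0 i * b i); first by ring.
  by rewrite -sumrB; apply: eq_bigr => i _; rewrite !mxE mulrBl.
pose r := Num.min s (e' * s ^+ 2 / (2 * (C + 1))).
have r0 : 0 < r by rewrite lt_min s0 divr_gt0 // mulr_gt0 // exprn_gt0.
have rs : r <= s by rewrite ge_min lexx.
have re : 2 * C * r / s ^+ 2 <= e'.
  have : r * (2 * (C + 1)) <= e' * s ^+ 2 by rewrite -ler_pdivlMr // ge_min lexx orbT.
  by rewrite ler_pdivrMr ?exprn_gt0 //; nra.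
exists (r / 2) => [|x y xr yr]; first by rewrite divr_gt0.
have := lip r r0 rs (x - p) (y - p) (ltW xr) (ltW yr).
rewrite !subrKC opprB addrA subrK => /le_trans; apply.
exact: ler_wpM2r.
Qed.

Lemma taylor_diff m (f : 'rV[R]_m -> R) p s C (b : 'I_m -> R) : 0 < s -> 0 <= C ->
  (forall r, 0 < r -> r <= s -> l1_series r (C * (r / s) ^+ 2)
     (fun h => f (p + h) - f (p + 0) - \sum_i h 0 i * b i)) ->
  differentiable f p /\ forall u, 'd f p u = \sum_i u 0 i * b i.
Proof.
move=> s0 C0 /(taylor_strict s0 C0) key.
apply: diff_lin_form => e' /key[e e0 H]; exists e => // u ue.
by have := H (p + u) p; rewrite [p + u]addrC addrK subrr normr0; exact.
Qed.

(** Strict differentiability.  It yields the uniqueness of derivatives and the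
    implicit function theorem without any mean value argument. *)
Lemma analytic_strict m (f : 'rV[R]_m -> R) p eps : analytic_at f p -> 0 < eps ->
  exists2 e, 0 < e & forall x y, `|x - p| < e -> `|y - p| < e ->
    `|f x - f y - 'd f p (x - y)| <= eps * `|x - y|.
Proof.
move=> fp eps0; have [s [C [s0 fC]]] := (analytic_atP f p).1 fp.
have [b Hb] := l1_series_taylor0 s0 fC.
have C0 : 0 <= C := l1_series_ge0 (ltW s0) fC.
have H2 r : 0 < r -> r <= s -> l1_series r (C * (r / s) ^+ 2)
     (fun h => f (p + h) - f (p + 0) - \sum_i h 0 i * b i).
  by move=> r0 rs; have [] := Hb r r0 rs.
have [_ dE] := taylor_diff s0 C0 H2.
have [e e0 H] := taylor_strict s0 C0 H2 eps0; exists e => // x y xe ye.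
by have := H x y xe ye; rewrite -dE.
Qed.

End AnalyticAt.

(** * The analytic implicit function theorem *)

Lemma row_mx_norm_le (R : realType) m k (x : 'rV[R]_m) (y : 'rV[R]_k) t : 0 <= t ->
  `|x| <= t -> `|y| <= t -> `|row_mx x y| <= t.
Proof.
move=> t0 xt yt; apply/(ler_mx_norm _ t0) => i j; rewrite ord1 mxE.
by case: splitP => l _; [apply: le_trans xt|apply: le_trans yt]; exact: coord_le_norm.
Qed.

Section ContractionFixedPoint.
Variables (R : realType) (m k : nat) (s rho C : R).
Variables (ell : 'I_k -> 'rV[R]_m -> R) (r : 'I_k -> 'rV[R]_(m + k) -> R).
Hypotheses (s0 : 0 < s) (rho0 : 0 < rho) (s_rho : s <= rho / 4).
Hypothesis ell_small : forall j, l1_series s (rho / 8) (ell j).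
Hypothesis r_series : forall j, l1_series rho C (r j).
Hypothesis C_small : C <= rho / 4.

(** A map [x |-> y] with [y = ell x + r (x, y)] is a fixed point of [step]; the
    bounds make [step] a contraction of the ball of radius [rho / 2], for the
    l1 norm of power series as well as pointwise. *)
Let step (y : 'rV[R]_m -> 'rV[R]_k) : 'rV[R]_m -> 'rV[R]_k :=
  fun x => \row_j (ell j x + r j (row_mx x (y x))).
Let iterate l := iter l step (fun=> 0).
(* the norm of an iterate is at most [rho / 8] from [ell] plus [rho / 4] from [r] *)
Let q := 3 * rho / 8.

Let q0 : 0 < q. Proof. by move: rho0; rewrite /q; lra. Qed.
Let q_rho : q < rho / 2. Proof. by move: rho0; rewrite /q; lra. Qed.
Let rho2_0 : 0 < rho / 2. Proof. by move: rho0; lra. Qed.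
Let rho2 : rho / 2 < rho. Proof. by move: rho0; lra. Qed.

Let graph_map t (y : 'rV[R]_m -> 'rV[R]_k) : s <= t -> l1_map s t y ->
  l1_map s t (fun x => row_mx x (y x)).
Proof.
move=> st yt i; case: (split_ordP i) => j ->.
  apply: l1_series_le st _; apply: eq_l1_series (@l1_series_coord R m s j s0) => h _.
  by rewrite row_mxEl.
by apply: eq_l1_series (yt j) => h _; rewrite row_mxEr.
Qed.

Let iterate_bound l : l1_map s q (iterate l).
Proof.
elim: l => [|l IH] j.
  apply: l1_series_le (@eq_l1_series _ _ _ _ (fun=> 0) _ _ (@l1_series_cst R m s 0 s0)).
    by rewrite normr0 ltW.
  by move=> h _; rewrite /iterate /= mxE.
have sq : s <= q by rewrite /q; (move: rho0 s_rho C_small; lra).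
have qr : q < rho by exact: lt_trans rho2.
have := l1_seriesD (ltW s0) (ell_small j)
  (l1_series_comp s0 rho0 qr (r_series j) (graph_map sq IH)).
move=> /(l1_series_le (_ : _ <= q)) H; apply: eq_l1_series (H _) => [h _|].
  by rewrite /iterate /= [RHS]mxE.
by rewrite /q; (move: rho0 s_rho C_small; lra).
Qed.

Let iterate_diff l : l1_map s (rho / 2 * 2^-1 ^+ l)
  (fun x => iterate l.+1 x - iterate l x).
Proof.
elim: l => [|l IH] j.
  rewrite expr0 mulr1; apply: l1_series_le (ltW q_rho) _.
  apply: eq_l1_series (iterate_bound 1 j) => h _.
  by rewrite /iterate /= subr0.
set e := rho / 2 * 2^-1 ^+ l in IH *.
have e0 : 0 <= e by rewrite mulr_ge0 ?exprn_ge0 ?invr_ge0 // ltW.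
have s2 : s <= rho / 2 by (move: rho0 s_rho C_small; lra).
have ib l' : l1_map s (rho / 2) (iterate l').
  by move=> i; apply: l1_series_le (ltW q_rho) (iterate_bound l' i).
have gd : l1_map s e (fun x => row_mx x (iterate l.+1 x) - row_mx x (iterate l x)).
  move=> i; case: (split_ordP i) => j' ->.
    apply: l1_series_le (@eq_l1_series _ _ _ _ (fun=> 0) _ _ (@l1_series_cst R m s 0 s0)).
      by rewrite normr0.
    by move=> h _; rewrite opp_row_mx add_row_mx row_mxEl subrr mxE.
  by apply: eq_l1_series (IH j') => h _; rewrite opp_row_mx add_row_mx row_mxEr.
have := l1_series_comp_lipschitz s0 e0 rho2_0 rho2 (r_series j)
  (graph_map s2 (ib l.+1)) (graph_map s2 (ib l)) gd.
have H : C * e / (rho - rho / 2) <= rho / 2 * 2^-1 ^+ l.+1.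
  have rr : 0 < rho - rho / 2 by rewrite subr_gt0.
  have -> : rho / 2 * 2^-1 ^+ l.+1 = e / 2 by rewrite /e exprSr !mulrA.
  rewrite (ler_pdivrMr _ _ rr).
  have -> : e / 2 * (rho - rho / 2) = rho / 4 * e by field.
  exact: ler_wpM2r.
by move=> /(l1_series_le H); apply: eq_l1_series => h _; rewrite /iterate /= !mxE; ring.
Qed.

Let limit x : 'rV[R]_k := \row_j limn (fun n => iterate n x 0 j).

Let iterate_tele n x j : iterate n x 0 j =
  \sum_(l < n) (iterate l.+1 x - iterate l x) 0 j.
Proof.
elim: n => [|n IH]; first by rewrite big_ord0 /iterate /= mxE.
have E (a b : 'rV[R]_k) : (a - b) 0 j = a 0 j - b 0 j by rewrite !mxE.
transitivity (iterate n x 0 j + (iterate n.+1 x - iterate n x) 0 j).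
  by rewrite E; ring.
by rewrite IH big_ord_recr.
Qed.

Let geo_sum n : \sum_(l < n) rho / 2 * 2^-1 ^+ l <= rho.
Proof.
suff -> : \sum_(l < n) rho / 2 * 2^-1 ^+ l = rho - rho * 2^-1 ^+ n.
  by rewrite gerBl mulr_ge0 ?exprn_ge0 ?invr_ge0 // ltW.
elim: n => [|n IH]; first by rewrite big_ord0 expr0; ring.
by rewrite big_ord_recr /= IH exprSr; field.
Qed.

Let iterate_cvg x j : `|x| < s -> iterate n x 0 j @[n --> \oo] --> limit x 0 j.
Proof.
move=> xs; rewrite mxE; under eq_fun do rewrite iterate_tele.
apply: (@series_cvg _ (fun l => (iterate l.+1 x - iterate l x) 0 j)
  (fun l => rho / 2 * 2^-1 ^+ l) rho 1) => // l.
by rewrite mulr1; exact: l1_series_bound xs (iterate_diff l j).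
Qed.

Let limit_series : l1_map s rho limit.
Proof.
move=> j; apply: (l1_series_sum s0 (fun l => iterate_diff l j)) => [n|h hs].
  exact: geo_sum.
by under eq_fun do rewrite -iterate_tele; exact: iterate_cvg.
Qed.

Let limit_bound x : `|x| < s -> `|limit x| <= q.
Proof.
move=> xs; apply/(ler_mx_norm _ (ltW q0)) => i j; rewrite ord1.
apply: (cvgn_le_bound (cvg_norm (@iterate_cvg x j xs))) => n.
exact: l1_series_bound xs (iterate_bound n j).
Qed.

Let r_lipschitz x y y' j : `|x| < s -> `|y| <= rho / 2 -> `|y'| <= rho / 2 ->
  `|r j (row_mx x y) - r j (row_mx x y')| <= 2^-1 * `|y - y'|.
Proof.
move=> xs yr y'r; have xr : `|x| <= rho / 2.
  by apply: le_trans (ltW xs) _; (move: rho0 s_rho C_small; lra).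
have := l1_series_lipschitz rho0 (r_series j)
  (row_mx_norm_le (ltW rho2_0) xr yr) (row_mx_norm_le (ltW rho2_0) xr y'r).
rewrite opp_row_mx add_row_mx subrr => /le_trans; apply.
apply: ler_pM => //.
- by rewrite divr_ge0 ?mulr_ge0 ?(l1_series_ge0 (ltW rho0) (r_series j)) // ltW.
- by rewrite ler_pdivrMr //; move: C_small; lra.
- by apply: row_mx_norm_le => //; rewrite normr0.
Qed.

Let limit_fixed x j : `|x| < s -> limit x 0 j = ell j x + r j (row_mx x (limit x)).
Proof.
move=> xs; have := @iterate_cvg x j xs; rewrite -(cvg_shiftS (fun n => iterate n x 0 j)).
move=> /cvg_unique; apply => //.
have -> : (fun n => iterate n.+1 x 0 j) =
    fun n => ell j x + r j (row_mx x (iterate n x)).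
  by apply/funext => n; rewrite /iterate /= mxE.
apply: cvgD; first exact: cvg_cst.
have vec : iterate n x @[n --> \oo] --> limit x.
  apply/cvgrPdist_le => e e0.
  have : \forall n \near \oo, forall j', `|limit x 0 j' - iterate n x 0 j'| <= e.
    pose P j' n := `|limit x 0 j' - iterate n x 0 j'| <= e.
    apply: (@filter_forall _ _ P) => j'.
    by have /cvgrPdist_le := @iterate_cvg x j' xs; apply.
  apply: filterS => n H; apply/(ler_mx_norm _ (ltW e0)) => i j'.
  by rewrite ord1 !mxE; have := H j'; rewrite mxE.
apply/cvgrPdist_le => e e0; move/cvgrPdist_le : vec => /(_ e e0).
apply: filterS => n H; apply: le_trans (r_lipschitz j xs _ _) _.
- exact: le_trans (limit_bound xs) (ltW q_rho).
- apply/(ler_mx_norm _ (ltW rho2_0)) => i j'; rewrite ord1.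
  apply: le_trans (ltW q_rho); exact: l1_series_bound xs (iterate_bound n j').
- by apply: le_trans H; rewrite ler_piMl // invf_le1 // ler1n.
Qed.

Lemma contraction_fixed_point : exists2 y : 'rV[R]_m -> 'rV[R]_k, l1_map s rho y &
  forall x : 'rV[R]_m, `|x| < s -> `|y x| < rho / 2 /\
    forall y' : 'rV[R]_k, `|y'| < rho / 2 ->
      ((forall j, y' 0 j = ell j x + r j (row_mx x y')) <-> y' = y x).
Proof.
exists limit; first exact: limit_series.
move=> x xs; have lb := le_lt_trans (limit_bound xs) q_rho; split => // y' yr.
split=> [fix_y|-> j]; last exact: limit_fixed.
have : `|y' - limit x| <= 2^-1 * `|y' - limit x|.
  apply/(ler_mx_norm _ (_ : 0 <= 2^-1 * `|y' - limit x|)) => [|i j].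
    by rewrite mulr_ge0 // invr_ge0.
  rewrite ord1 2!mxE fix_y limit_fixed // opprD addrACA subrr add0r.
  by apply: r_lipschitz => //; exact: ltW.
move=> H; apply/eqP; rewrite -subr_eq0 -normr_eq0 eq_le normr_ge0 andbT.
by move: H; set a := `|_|; (move: rho0 s_rho C_small; lra).
Qed.

End ContractionFixedPoint.

(** The analytic implicit function theorem, normalised so that the derivative in
    the unknown [y] is the identity: the equation is then a fixed point problem
    for a contraction, and power series of bounded norm form a complete space. *)
Theorem analytic_implicit (R : realType) m k (F : 'rV[R]_(m + k) -> 'rV[R]_k) :
  analytic_map_at F 0 -> F 0 = 0 ->
  (forall (y : 'rV[R]_k) j, 'd (fun x => F x 0 j) 0 (row_mx 0 y) = y 0 j) ->
  exists g : 'rV[R]_m -> 'rV[R]_k, [/\ analytic_map_at g 0, g 0 = 0 &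
    exists e d, [/\ 0 < e, 0 < d & forall x : 'rV[R]_m, `|x| < e -> `|g x| < d /\
      forall y : 'rV[R]_k, `|y| < d -> (F (row_mx x y) = 0 <-> y = g x)]].
Proof.
move=> Fan F0 dF; have [s [C [s0 C0 FC]]] := analytic_map_l1 Fan.
have /choice[b bP] := fun j => l1_series_taylor0 s0 (FC j).
have dE j y : \sum_i (row_mx 0 y : 'rV[R]_(m + k)) 0 i * b j i = y 0 j.
  rewrite -dF.
  have [|_ ->] // := @taylor_diff _ _ (fun x => F x 0 j) 0 s C (b j) s0 C0.
  by move=> t t0 ts; have [] := bP j t t0 ts.
have C1 : 0 < 4 * (C + 1) by rewrite mulr_gt0 // ltr_wpDl.
(* at this radius the remainder of second order has norm at most [rho / 4] *)
pose rho := Num.min s (s ^+ 2 / (4 * (C + 1))).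
have rho0 : 0 < rho by rewrite lt_min s0 divr_gt0 // exprn_gt0.
have rho_s : rho <= s by rewrite ge_min lexx.
have C_small : C * (rho / s) ^+ 2 <= rho / 4.
  have : rho * (4 * (C + 1)) <= s ^+ 2 by rewrite -ler_pdivlMr // ge_min lexx orbT.
  rewrite (_ : C * (rho / s) ^+ 2 = C * rho ^+ 2 / s ^+ 2); last by field; rewrite gt_eqF.
  by rewrite (ler_pdivrMr _ _ (exprn_gt0 2 s0)); nra.
pose ell j (x : 'rV[R]_m) := - \sum_i x 0 i * b j (lshift k i).
pose B := \sum_j \sum_i `|b j (lshift k i)|.
have B0 : 0 <= B by apply: sumr_ge0 => j _; exact: sumr_ge0.
have B1 : 0 < 8 * (B + 1) by rewrite mulr_gt0 // ltr_wpDl.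
(* at this radius the linear part in [x] has norm at most [rho / 8] *)
pose e := Num.min (rho / 4) (rho / (8 * (B + 1))).
have e0 : 0 < e by rewrite lt_min !divr_gt0.
have e_rho : e <= rho / 4 by rewrite ge_min lexx.
have ell_small j : l1_series e (rho / 8) (ell j).
  apply: l1_seriesN.
  have := l1_series_sum_ord e0 (fun i => l1_seriesZ (b j (lshift k i)) (l1_series_coord i e0)).
  rewrite -mulr_suml => /(l1_series_le (_ : _ <= rho / 8)) H.
  apply: eq_l1_series (H _) => [h _|].
    by apply: eq_bigr => i _; rewrite mulrC.
  have : e * (8 * (B + 1)) <= rho by rewrite -ler_pdivlMr // ge_min lexx orbT.
  have : \sum_i `|b j (lshift k i)| <= B.
    by rewrite /B (bigD1 j) //= lerDl; apply: sumr_ge0 => ? _; exact: sumr_ge0.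
  by nra.
pose r j h := - (F h 0 j - \sum_i h 0 i * b j i).
have r_series j : l1_series rho (C * (rho / s) ^+ 2) (r j).
  apply: l1_seriesN; have [_] := bP j rho rho0 rho_s.
  by apply: eq_l1_series => h _; rewrite add0r addr0 F0 mxE subr0.
have [g gr gP] := contraction_fixed_point e0 rho0 e_rho ell_small r_series C_small.
have FE x y : F (row_mx x y) = 0 <-> forall j, y 0 j = ell j x + r j (row_mx x y).
  have E j : \sum_i (row_mx x y) 0 i * b j i = - ell j x + y 0 j.
    rewrite -(dE j y) /ell opprK !big_split_ord /=.
    rewrite [X in _ = _ + (X + _)]big1 ?add0r => [|i _]; last first.
      by rewrite row_mxEl mxE mul0r.
    congr (_ + _); apply: eq_bigr => i _; first by rewrite row_mxEl.
    by rewrite !row_mxEr.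
  split=> [Fxy j|H]; first by rewrite /r Fxy mxE E; ring.
  apply/rowP => j; rewrite mxE; have := H j; rewrite /r E => Hj.
  by move: Hj; set a := F _ _ _; set c := ell _ _; set d := y _ _; lra.
have n0 : `|0 : 'rV[R]_m| < e by rewrite normr0.
exists g; split.
- move=> j; apply/analytic_atP; exists e, rho; split => //.
  by apply: eq_l1_series (gr j) => h _; rewrite add0r.
- have [_ /(_ 0)] := gP 0 n0; rewrite normr0 divr_gt0 // => /(_ isT)[H _].
  by rewrite -H //; apply/FE; rewrite row_mx0.
- exists e, (rho / 2); split => //; first by rewrite divr_gt0.
  by move=> x /gP[g1 g2]; split => // y /g2 <-; exact: FE.
Qed.

(** * Directional derivatives of analytic maps *)

Lemma continuous_normP (R : realType) (V W : normedModType R) (f : V -> W) x :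
  {for x, continuous f} <->
  forall eps : R, 0 < eps -> \forall y \near x, `|f x - f y| <= eps.
Proof. by split => [/cvgrPdist_le|H]; last exact/cvgrPdist_le. Qed.

(** The directional derivative, locked: unification must not unfold the Fréchet
    derivative. *)
HB.lock Definition der (R : realType) m (f : 'rV[R]_m -> R) (x u : 'rV[R]_m) : R :=
  'd f x u.

Section RealDerivative.
Variables (R : realType) (m : nat).
Implicit Types (f g : 'rV[R]_m -> R) (x u v : 'rV[R]_m).

Lemma derE f x u : 'd f x u = der f x u.
Proof. by rewrite der.unlock. Qed.

Lemma der_addr f x u v : der f x (u + v) = der f x u + der f x v.
Proof. by rewrite der.unlock linearD. Qed.

Lemma der_scaler f x (c : R) u : der f x (c *: u) = c * der f x u.
Proof. by rewrite der.unlock linearZ. Qed.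

Lemma der_oppr f x u : der f x (- u) = - der f x u.
Proof. by rewrite der.unlock linearN. Qed.

Lemma analytic_differentiable f x : analytic_at f x -> differentiable f x.
Proof. by move=> /analytic_derivatives[]. Qed.

Lemma analytic_continuous f x : analytic_at f x -> {for x, continuous f}.
Proof. by move=> /analytic_differentiable; exact: differentiable_continuous. Qed.

Lemma analytic_der f x u : analytic_at f x -> analytic_at (fun y => der f y u) x.
Proof.
by move=> /analytic_derivatives[_ /(_ u) H _]; rewrite der.unlock; exact: H.
Qed.

Lemma der_sym f x u v : analytic_at f x ->
  der (fun y => der f y u) x v = der (fun y => der f y v) x u.
Proof.
by move=> /analytic_derivatives[_ _ H]; rewrite der.unlock; exact: H.
Qed.

Lemma der_strict f p eps : analytic_at f p -> 0 < eps ->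
  exists2 e, 0 < e & forall x y, `|x - p| < e -> `|y - p| < e ->
    `|f x - f y - der f p (x - y)| <= eps * `|x - y|.
Proof.
by move=> fp /(analytic_strict fp)[e e0 H]; rewrite der.unlock; exists e.
Qed.

Lemma der_unique f x u (d : R) :
  (forall eps, 0 < eps -> exists2 e, 0 < e & forall t, 0 < t -> t < e ->
    `|f (x + t *: u) - f x - t * d| <= eps * t) ->
  analytic_at f x -> der f x u = d.
Proof.
move=> fd fx; apply/eqP; rewrite -subr_eq0 -normr_eq0 eq_le normr_ge0 andbT leNgt.
apply/negP => h0; set a := `|_| in h0.
pose U := `|u| + 1; have U0 : 0 < U by exact: ltr_wpDl.
have [e e0 H] := fd (a / 4) (divr_gt0 h0 (ltr0n _ 4)).
have [e' e'0 H'] := der_strict fx (divr_gt0 h0 (mulr_gt0 (ltr0n _ 4) U0)).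
pose t := Num.min (e / 2) (e' / (2 * U)).
have t0 : 0 < t by rewrite lt_min !divr_gt0 // mulr_gt0.
have te : t < e by apply: (@le_lt_trans _ _ (e / 2)); [rewrite ge_min lexx|lra].
have tU : t * `|u| < e'.
  have : t * (2 * U) <= e' by rewrite -ler_pdivlMr ?mulr_gt0 // ge_min lexx orbT.
  by rewrite /U; have := normr_ge0 u; nra.
have := H' (x + t *: u) x; rewrite [x + _ - x]addrAC subrr add0r normr0 normrZ.
rewrite (gtr0_norm t0) => /(_ tU e'0); rewrite der_scaler => H1; have := H t t0 te => H2.
have : t * a <= a / (4 * U) * (t * `|u|) + a / 4 * t.
  have -> : t * a = `|(f (x + t *: u) - f x - t * d) - (f (x + t *: u) - f x - t * der f x u)|.
    by rewrite /a -{1}(gtr0_norm t0) -normrM; congr `|_|; ring.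
  by rewrite [leRHS]addrC; apply: (le_trans (ler_normB _ _)); exact: lerD.
have : a / (4 * U) * (t * `|u|) <= a / 4 * t.
  rewrite (_ : a / (4 * U) * (t * `|u|) = a / 4 * t * (`|u| / U)); last first.
    by field; rewrite gt_eqF.
  rewrite -[leRHS]mulr1; apply: ler_wpM2l; first by rewrite !mulr_ge0 ?invr_ge0 // ltW.
  by rewrite ler_pdivrMr // mul1r /U lerDl.
nra.
Qed.

Lemma der_eq_near f g x u : (\forall y \near x, f y = g y) -> analytic_at f x ->
  der f x u = der g x u.
Proof.
move=> fg fx; have gx := analytic_eq_near fg fx.
apply: der_unique fx => eps eps0.
have U0 : 0 < `|u| + 1 by exact: ltr_wpDl.
have eU : 0 < eps / (`|u| + 1) by rewrite divr_gt0.
have [e e0 H] := der_strict gx eU.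
move/nbhs_ballP : fg => [e' /= e'0 fg].
exists (Num.min e e' / (`|u| + 1)) => [|t t0]; first by rewrite divr_gt0 // lt_min e0.
rewrite ltr_pdivlMr // lt_min => /andP[te te'].
have tu : t * `|u| <= t * (`|u| + 1) by rewrite ler_pM2l // lerDl.
have -> : f (x + t *: u) = g (x + t *: u).
  apply: fg; rewrite -ball_normE /= opprD addNKr normrN normrZ gtr0_norm //.
  exact: le_lt_trans te'.
have -> : f x = g x by apply: fg; exact: ballxx.
have := H (x + t *: u) x; rewrite [x + _ - x]addrAC subrr add0r normr0 normrZ (gtr0_norm t0).
move=> /(_ (le_lt_trans tu te) e0); rewrite der_scaler => /le_trans; apply.
rewrite mulrAC ler_pdivrMr // -mulrA; apply: ler_wpM2l => //; exact: ltW.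
Qed.

Lemma der_cst (c : R) x u : der (fun=> c) x u = 0.
Proof. by rewrite der.unlock diff_cst. Qed.

Lemma derD f g x u : analytic_at f x -> analytic_at g x ->
  der (fun y => f y + g y) x u = der f x u + der g x u.
Proof.
move=> /analytic_differentiable fx /analytic_differentiable gx.
rewrite der.unlock.
by rewrite (_ : (fun y => _) = f + g) // diffD.
Qed.

Lemma derN f x u : analytic_at f x -> der (fun y => - f y) x u = - der f x u.
Proof.
move=> /analytic_differentiable fx; rewrite der.unlock.
by rewrite (_ : (fun y => _) = - f) // diffN.
Qed.

Lemma derM f g x u : analytic_at f x -> analytic_at g x ->
  der (fun y => f y * g y) x u = f x * der g x u + g x * der f x u.
Proof.
move=> /analytic_differentiable fx /analytic_differentiable gx.
rewrite der.unlock.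
by rewrite (_ : (fun y => _) = f * g) // diffM.
Qed.

Lemma der_linear f (ell : 'rV[R]_m -> R) x u : analytic_at f x ->
  (forall t : R, f (x + t *: u) = f x + t * ell u) -> der f x u = ell u.
Proof.
move=> fx H; apply: der_unique fx => eps eps0; exists 1 => // t t0 _.
have -> : f (x + t *: u) - f x - t * ell u = 0 by rewrite H; ring.
by rewrite normr0 mulr_ge0 // ltW.
Qed.

Lemma der_sum_delta f x u : der f x u = \sum_i u 0 i * der f x (delta_mx 0 i).
Proof.
rewrite der.unlock {1}(row_sum_delta u) linear_sum; apply: eq_bigr => i _.
by rewrite linearZ.
Qed.

Lemma analytic_der_dir f x u : analytic_at (fun v => der f x v) u.
Proof.
rewrite (_ : (fun v => _) = fun v => \sum_i v 0 i * der f x (delta_mx 0 i)).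
  by apply: analytic_sum => i; apply: analyticM; [exact: analytic_coord|exact: analytic_cst].
by apply/funext => v; exact: der_sum_delta.
Qed.

Lemma der_coord i x u : der (fun y : 'rV[R]_m => y 0 i) x u = u 0 i.
Proof.
apply: (der_linear (ell := fun v => v 0 i)) => [|t]; first exact: analytic_coord.
by rewrite !mxE.
Qed.

End RealDerivative.

HB.lock Definition mder (R : realType) m k (g : 'rV[R]_m -> 'rV[R]_k) (x u : 'rV[R]_m) :
  'rV[R]_k := \row_j der (fun y => g y 0 j) x u.

Section MapDerivative.
Variables (R : realType) (m k : nat).
Implicit Types (g : 'rV[R]_m -> 'rV[R]_k) (f : 'rV[R]_k -> R) (x u v : 'rV[R]_m).

Lemma mder_coord g x u j : mder g x u 0 j = der (fun y => g y 0 j) x u.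
Proof. by rewrite mder.unlock mxE. Qed.

Lemma mder_addr g x u v : mder g x (u + v) = mder g x u + mder g x v.
Proof. by apply/rowP => j; rewrite mxE !mder_coord der_addr. Qed.

Lemma mder_scaler g x (c : R) u : mder g x (c *: u) = c *: mder g x u.
Proof. by apply/rowP => j; rewrite mxE !mder_coord der_scaler. Qed.

Lemma mder_oppr g x u : mder g x (- u) = - mder g x u.
Proof. by apply/rowP => j; rewrite mxE !mder_coord der_oppr. Qed.

Lemma analytic_map_strict g p eps : analytic_map_at g p -> 0 < eps ->
  exists2 e, 0 < e & forall x y, `|x - p| < e -> `|y - p| < e ->
    `|g x - g y - mder g p (x - y)| <= eps * `|x - y|.
Proof.
move=> gp eps0; have /choice[e eP] : forall j, exists e, 0 < e /\
    forall x y, `|x - p| < e -> `|y - p| < e ->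
    `|g x 0 j - g y 0 j - der (fun z => g z 0 j) p (x - y)| <= eps * `|x - y|.
  by move=> j; have [e e0 H] := der_strict (gp j) eps0; exists e.
have sum0 : 0 <= \sum_j (e j)^-1.
  by apply: sumr_ge0 => j _; rewrite invr_ge0 ltW //; have [] := eP j.
exists (1 + \sum_j (e j)^-1)^-1 => [|x y xe ye]; first by rewrite invr_gt0 ltr_pwDl.
apply/(ler_mx_norm _ (_ : 0 <= eps * `|x - y|)) => [|i j].
  by rewrite mulr_ge0 // ltW.
have [ej H] := eP j.
have le_e : (1 + \sum_j (e j)^-1)^-1 <= e j.
  rewrite -[leRHS]invrK lef_pV2 ?posrE ?invr_gt0 ?ltr_pwDl //.
  rewrite (bigD1 j) //= addrCA lerDl addr_ge0 // sumr_ge0 // => l _.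
  by rewrite invr_ge0 ltW //; have [] := eP l.
rewrite ord1 !mxE mder_coord; apply: H; exact: lt_le_trans le_e.
Qed.

Lemma analytic_map_continuous g x : analytic_map_at g x -> {for x, continuous g}.
Proof.
move=> gx; apply/continuous_normP => e e0.
have H j : \forall y \near x, `|g x 0 j - g y 0 j| <= e.
  by have /continuous_normP := analytic_continuous (gx j); apply.
have : \forall y \near x, forall j, `|g x 0 j - g y 0 j| <= e.
  exact: (@filter_forall _ _ (fun j y => `|g x 0 j - g y 0 j| <= e) (nbhs x)).
apply: filterS => y Hy; apply/(ler_mx_norm _ (ltW e0)) => i j.
by rewrite ord1 !mxE.
Qed.

Lemma analytic_map_diff g x : analytic_map_at g x ->
  differentiable g x /\ 'd g x = mder g x :> ('rV[R]_m -> 'rV[R]_k).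
Proof.
move=> gx; have glin : linear (mder g x).
  by move=> c u v; rewrite mder_addr mder_scaler.
pose gM := GRing.isLinear.Build _ _ _ _ _ glin.
pose gL : {linear 'rV[R]_m -> 'rV[R]_k} := HB.pack (mder g x) gM.
have gc : continuous gL.
  move=> u; apply: analytic_map_continuous => j.
  rewrite (_ : (fun v => _) = fun v => der (fun y => g y 0 j) x v).
    exact: analytic_der_dir.
  by apply/funext => v; exact: mder_coord.
have [] := @diff_littleo R _ _ g gL x gc _; last by [].
move=> eps /(analytic_map_strict gx)[e e0 H].
near=> u; have ue : `|u| < e by near: u; exact: (@nbhs0_lt _ 'rV[R]_m _ e0).
have := H (x + u) x; rewrite [x + u - x]addrAC subrr add0r normr0; exact.
Unshelve. all: by end_near. Qed.

Lemma mderE g x u : analytic_map_at g x -> 'd g x u = mder g x u.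
Proof. by move=> /analytic_map_diff[_ ->]. Qed.

Lemma deriveE_mder g x u : analytic_map_at g x -> 'D_u g x = mder g x u.
Proof. by move=> gx; have [dg <-] := analytic_map_diff gx; exact: deriveE. Qed.

Lemma der_comp f g x u : analytic_at f (g x) -> analytic_map_at g x ->
  der (fun y => f (g y)) x u = der f (g x) (mder g x u).
Proof.
move=> fx /analytic_map_diff[gx dg]; rewrite -dg der.unlock.
by rewrite (_ : (fun y => _) = f \o g) // (diff_comp gx (analytic_differentiable fx)).
Qed.

Lemma mder_eq_near g g' x u : (\forall y \near x, g y = g' y) -> analytic_map_at g x ->
  mder g x u = mder g' x u.
Proof.
move=> gg gx; apply/rowP => j; rewrite !mder_coord; apply: der_eq_near => //.
by apply: filterS gg => y ->.
Qed.

End MapDerivative.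

Lemma mder_comp (R : realType) m k l (f : 'rV[R]_k -> 'rV[R]_l)
    (g : 'rV[R]_m -> 'rV[R]_k) x u : analytic_map_at f (g x) -> analytic_map_at g x ->
  mder (fun y => f (g y)) x u = mder f (g x) (mder g x u).
Proof.
move=> fx gx; apply/rowP => j; rewrite !mder_coord.
exact: (der_comp u (fx j) gx).
Qed.

Lemma analytic_map_id (R : realType) m (x : 'rV[R]_m) : analytic_map_at id x.
Proof. by move=> j; exact: analytic_coord. Qed.

Lemma mder_id (R : realType) m (x u : 'rV[R]_m) : mder id x u = u.
Proof. by apply/rowP => j; rewrite mder_coord der_coord. Qed.

Section ComplexDerivative.
Variables (R : realType) (m : nat).
Implicit Types (f g : 'rV[R]_m -> R[i]) (x u v : 'rV[R]_m).

Definition canalytic f x := analytic_at (fun y => complex.Re (f y)) x /\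
  analytic_at (fun y => complex.Im (f y)) x.

Definition cder f x u : R[i] :=
  Complex (der (fun y => complex.Re (f y)) x u) (der (fun y => complex.Im (f y)) x u).

Lemma complex_eqP (a b : R[i]) :
  complex.Re a = complex.Re b -> complex.Im a = complex.Im b -> a = b.
Proof. by case: a b => [a1 a2] [b1 b2] /= -> ->. Qed.

Lemma ReM (a b : R[i]) : complex.Re (a * b) =
  complex.Re a * complex.Re b - complex.Im a * complex.Im b.
Proof. by case: a b => [a1 a2] [b1 b2]. Qed.

Lemma ImM (a b : R[i]) : complex.Im (a * b) =
  complex.Re a * complex.Im b + complex.Im a * complex.Re b.
Proof. by case: a b => [a1 a2] [b1 b2] /=; rewrite addrC; congr (_ + _); rewrite mulrC. Qed.

Lemma ReD (a b : R[i]) : complex.Re (a + b) = complex.Re a + complex.Re b.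
Proof. by case: a b => [a1 a2] [b1 b2]. Qed.

Lemma ImD (a b : R[i]) : complex.Im (a + b) = complex.Im a + complex.Im b.
Proof. by case: a b => [a1 a2] [b1 b2]. Qed.

Lemma ReN (a : R[i]) : complex.Re (- a) = - complex.Re a.
Proof. by case: a. Qed.

Lemma ImN (a : R[i]) : complex.Im (- a) = - complex.Im a.
Proof. by case: a. Qed.

Lemma ReJ (a : R[i]) : complex.Re (conjc a) = complex.Re a.
Proof. by case: a. Qed.

Lemma ImJ (a : R[i]) : complex.Im (conjc a) = - complex.Im a.
Proof. by case: a. Qed.

Lemma cder_addr f x u v : cder f x (u + v) = cder f x u + cder f x v.
Proof. by apply: complex_eqP; rewrite ?ReD ?ImD /= der_addr. Qed.

Lemma cder_scaler f x (c : R) u : cder f x (c *: u) = Complex c 0 * cder f x u.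
Proof. by apply: complex_eqP; rewrite ?ReM ?ImM /= der_scaler ?mul0r ?subr0 ?addr0. Qed.

Lemma cder_oppr f x u : cder f x (- u) = - cder f x u.
Proof. by apply: complex_eqP; rewrite ?ReN ?ImN /= der_oppr. Qed.

Lemma canalytic_cst (c : R[i]) x : canalytic (fun=> c) x.
Proof. by split; exact: analytic_cst. Qed.

Lemma canalyticD f g x : canalytic f x -> canalytic g x ->
  canalytic (fun y => f y + g y) x.
Proof.
by move=> [f1 f2] [g1 g2]; split; under eq_fun do rewrite ?ReD ?ImD; exact: analyticD.
Qed.

Lemma canalyticN f x : canalytic f x -> canalytic (fun y => - f y) x.
Proof.
by move=> [f1 f2]; split; under eq_fun do rewrite ?ReN ?ImN; exact: analyticN.
Qed.

Lemma canalyticB f g x : canalytic f x -> canalytic g x ->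
  canalytic (fun y => f y - g y) x.
Proof. by move=> fx /canalyticN; exact: canalyticD. Qed.

Lemma canalyticM f g x : canalytic f x -> canalytic g x ->
  canalytic (fun y => f y * g y) x.
Proof.
move=> [f1 f2] [g1 g2]; split; under eq_fun do rewrite ?ReM ?ImM.
  by apply: analyticB; exact: analyticM.
by apply: analyticD; exact: analyticM.
Qed.

Lemma canalyticJ f x : canalytic f x -> canalytic (fun y => conjc (f y)) x.
Proof.
move=> [f1 f2]; split; first by under eq_fun do rewrite ReJ.
by under eq_fun do rewrite ImJ; exact: analyticN.
Qed.

Lemma canalytic_near f x : canalytic f x -> \forall y \near x, canalytic f y.
Proof. by move=> [/analytic_near f1 /analytic_near f2]; near do split.
Unshelve. all: by end_near. Qed.

Lemma canalytic_eq_near f g x : (\forall y \near x, f y = g y) ->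
  canalytic f x -> canalytic g x.
Proof.
move=> fg [f1 f2]; split; [apply: analytic_eq_near f1|apply: analytic_eq_near f2];
  by apply: filterS fg => y ->.
Qed.

Lemma canalytic_cder f x u : canalytic f x -> canalytic (fun y => cder f y u) x.
Proof. by move=> [f1 f2]; split; exact: analytic_der. Qed.

Lemma cder_cst (c : R[i]) x u : cder (fun=> c) x u = 0.
Proof. by rewrite /cder !der_cst. Qed.

Lemma cderD f g x u : canalytic f x -> canalytic g x ->
  cder (fun y => f y + g y) x u = cder f x u + cder g x u.
Proof.
move=> [f1 f2] [g1 g2]; apply: complex_eqP; rewrite ?ReD ?ImD /= -derD //.
  by congr (der _ _ _); apply/funext => y; rewrite ReD.
by congr (der _ _ _); apply/funext => y; rewrite ImD.
Qed.

Lemma cderN f x u : canalytic f x -> cder (fun y => - f y) x u = - cder f x u.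
Proof.
move=> [f1 f2]; apply: complex_eqP; rewrite ?ReN ?ImN /= -derN //.
  by congr (der _ _ _); apply/funext => y; rewrite ReN.
by congr (der _ _ _); apply/funext => y; rewrite ImN.
Qed.

Lemma cderB f g x u : canalytic f x -> canalytic g x ->
  cder (fun y => f y - g y) x u = cder f x u - cder g x u.
Proof. by move=> fx gx; rewrite cderD ?cderN //; exact: canalyticN. Qed.

Lemma cderM f g x u : canalytic f x -> canalytic g x ->
  cder (fun y => f y * g y) x u = cder f x u * g x + f x * cder g x u.
Proof.
move=> [f1 f2] [g1 g2].
have E1 : (fun y => complex.Re (f y * g y)) = fun y =>
  complex.Re (f y) * complex.Re (g y) + - (complex.Im (f y) * complex.Im (g y)).
  by apply/funext => y; rewrite ReM.
have E2 : (fun y => complex.Im (f y * g y)) = fun y =>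
  complex.Re (f y) * complex.Im (g y) + complex.Im (f y) * complex.Re (g y).
  by apply/funext => y; rewrite ImM.
have a1 := analyticM f1 g1; have a2 := analyticM f2 g2.
have a3 := analyticM f1 g2; have a4 := analyticM f2 g1.
apply: complex_eqP; rewrite ?ReD ?ImD ?ReM ?ImM /= ?E1 ?E2.
  by rewrite (derD _ a1 (analyticN a2)) (derN _ a2) !derM //; ring.
by rewrite (derD _ a3 a4) !derM //; ring.
Qed.

Lemma cderZ (c : R[i]) f x u : canalytic f x ->
  cder (fun y => c * f y) x u = c * cder f x u.
Proof.
by move=> fx; rewrite cderM // ?cder_cst ?mul0r ?add0r //; exact: canalytic_cst.
Qed.

Lemma cderJ f x u : canalytic f x ->
  cder (fun y => conjc (f y)) x u = conjc (cder f x u).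
Proof.
move=> [f1 f2]; apply: complex_eqP; rewrite ?ReJ ?ImJ /= -?derN //.
  by congr (der _ _ _); apply/funext => y; rewrite ReJ.
by congr (der _ _ _); apply/funext => y; rewrite ImJ.
Qed.

Lemma cder_sym f x u v : canalytic f x ->
  cder (fun y => cder f y u) x v = cder (fun y => cder f y v) x u.
Proof.
by move=> [f1 f2]; apply: complex_eqP => /=; exact: der_sym.
Qed.

Lemma cder_eq_near f g x u : (\forall y \near x, f y = g y) -> canalytic f x ->
  cder f x u = cder g x u.
Proof.
move=> fg [f1 f2]; apply: complex_eqP => /=; apply: der_eq_near => //;
  by apply: filterS fg => y ->.
Qed.

End ComplexDerivative.

Lemma canalytic_comp (R : realType) m k (f : 'rV[R]_k -> R[i]) (g : 'rV[R]_m -> 'rV[R]_k) x :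
  canalytic f (g x) -> analytic_map_at g x -> canalytic (fun y => f (g y)) x.
Proof.
move=> [f1 f2] gx; split; first exact: (analytic_comp f1 gx).
exact: (analytic_comp f2 gx).
Qed.

Lemma cder_comp (R : realType) m k (f : 'rV[R]_k -> R[i]) (g : 'rV[R]_m -> 'rV[R]_k) x u :
  canalytic f (g x) -> analytic_map_at g x ->
  cder (fun y => f (g y)) x u = cder f (g x) (mder g x u).
Proof.
move=> [f1 f2] gx; apply: complex_eqP; first exact: (der_comp u f1 gx).
exact: (der_comp u f2 gx).
Qed.

(** The value [g x] is named because it is usually known in a simpler form. *)
Lemma cder_comp_at (R : realType) m k (f : 'rV[R]_k -> R[i]) (g : 'rV[R]_m -> 'rV[R]_k)
    x y u : g x = y -> canalytic f y -> analytic_map_at g x ->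
  canalytic (fun z => f (g z)) x /\
  cder (fun z => f (g z)) x u = cder f y (mder g x u).
Proof. by move=> <- fy gx; split; [exact: canalytic_comp|exact: cder_comp]. Qed.

(** * Complex scalars and the dbar derivative *)

Notation normc := Normc.normc.

Section ComplexScalars.
Variable R : realType.

Definition ii : R[i] := Complex 0 1.

Lemma ii_mul (a : R[i]) : ii * (ii * a) = - a.
Proof. by rewrite mulrA -expr2 sqr_i mulN1r. Qed.

Lemma conjcM (a b : R[i]) : conjc (a * b) = conjc a * conjc b.
Proof. exact: rmorphM. Qed.

Lemma conjcN (a : R[i]) : conjc (- a) = - conjc a.
Proof. exact: rmorphN. Qed.

Lemma conjcB (a b : R[i]) : conjc (a - b) = conjc a - conjc b.
Proof. exact: rmorphB. Qed.

Lemma conjc_ii : conjc ii = - ii.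
Proof. by apply: complex_eqP => /=; rewrite ?oppr0. Qed.

Lemma complex_split (c : R[i]) :
  c = Complex (complex.Re c) 0 + ii * Complex (complex.Im c) 0.
Proof. by case: c => a b; apply: complex_eqP; rewrite ?ReD ?ImD ?ReM ?ImM /=; ring. Qed.

Lemma conjc_split (c : R[i]) :
  conjc c = Complex (complex.Re c) 0 - ii * Complex (complex.Im c) 0.
Proof.
by case: c => a b; apply: complex_eqP; rewrite ?ReD ?ImD ?ReN ?ImN ?ReM ?ImM /=; ring.
Qed.

Lemma normc_conj (a : R[i]) : normc (conjc a) = normc a.
Proof. by case: a => x y /=; rewrite sqrrN. Qed.

Lemma normc_ge0 (a : R[i]) : 0 <= normc a.
Proof. by case: a => x y /=; exact: sqrtr_ge0. Qed.

Lemma normc_eq0 (a : R[i]) : (normc a == 0) = (a == 0).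
Proof.
by apply/eqP/eqP => [/Normc.eq0_normc //|->]; exact: Normc.normc0.
Qed.

Lemma normc_gt0 (a : R[i]) : (0 < normc a) = (a != 0).
Proof. by rewrite lt_neqAle normc_ge0 andbT eq_sym normc_eq0. Qed.

Lemma normcB_le (a b : R[i]) : normc (a - b) <= normc a + normc b.
Proof. by rewrite -(normcN b); exact: le_normcD. Qed.

Lemma normc_ii : normc ii = 1 :> R.
Proof. by rewrite /= expr0n expr1n add0r sqrtr1. Qed.

Lemma normc_half (a : R[i]) : normc (a / 2) = normc a / 2.
Proof.
rewrite Normc.normcM Normc.normcV; congr (_ / _).
by rewrite -[2 : R[i]]/(1 + 1) /= addr0 expr0n /= addr0 sqrtr_sqr ger0_norm.
Qed.

Lemma Re_le_normc (a : R[i]) : `|complex.Re a| <= normc a.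
Proof. by case: a => x y /=; rewrite -sqrtr_sqr ler_wsqrtr // lerDl sqr_ge0. Qed.

Lemma Im_le_normc (a : R[i]) : `|complex.Im a| <= normc a.
Proof. by case: a => x y /=; rewrite -sqrtr_sqr ler_wsqrtr // lerDr sqr_ge0. Qed.

Lemma normc_le_ReIm (a : R[i]) : normc a <= `|complex.Re a| + `|complex.Im a|.
Proof.
case: a => x y /=; rewrite -[leRHS]ger0_norm ?addr_ge0 // -sqrtr_sqr.
rewrite ler_wsqrtr // sqrrD !real_normK ?num_real //.
by rewrite -addrA lerD2l lerDr mulrn_wge0 // mulr_ge0.
Qed.

End ComplexScalars.
Arguments ii {R}.

HB.lock Definition cscale (R : realType) N (c : R[i]) (u : 'rV[R]_(N + N)) :=
  complex.Re c *: u + complex.Im c *: Jstr u.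

Section ComplexStructure.
Variables (R : realType) (N : nat).
Implicit Types (u v : 'rV[R]_(N + N)) (c : R[i]).

Lemma Jstr_add u v : Jstr (u + v) = Jstr u + Jstr v.
Proof.
by apply/rowP => j; rewrite /Jstr !mxE; case: splitP => k _; rewrite !mxE ?opprD.
Qed.

Lemma Jstr_scale (t : R) u : Jstr (t *: u) = t *: Jstr u.
Proof.
by apply/rowP => j; rewrite /Jstr !mxE; case: splitP => k _; rewrite !mxE ?mulrN.
Qed.

Lemma Jstr_opp u : Jstr (- u) = - Jstr u.
Proof. by rewrite -scaleN1r Jstr_scale scaleN1r. Qed.

Lemma JstrK u : Jstr (Jstr u) = - u.
Proof.
by rewrite /Jstr row_mxKl row_mxKr -{3}[u]hsubmxK opp_row_mx.
Qed.

Lemma Jstr_cscale c u : Jstr (cscale c u) = cscale (ii * c) u.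
Proof.
rewrite cscale.unlock Jstr_add !Jstr_scale JstrK ReM ImM /= scalerN.
by rewrite !mul0r !mul1r sub0r add0r scaleNr addrC.
Qed.

Lemma cscaleD c d u : cscale (c + d) u = cscale c u + cscale d u.
Proof. by rewrite cscale.unlock ReD ImD !scalerDl addrACA. Qed.

Lemma cscaleN c u : cscale (- c) u = - cscale c u.
Proof. by rewrite cscale.unlock ReN ImN !scaleNr -opprD. Qed.

Lemma cscale0 u : cscale 0 u = 0.
Proof. by rewrite cscale.unlock /= !scale0r addr0. Qed.

Lemma cscale1 u : cscale 1 u = u.
Proof. by rewrite cscale.unlock /= scale1r scale0r addr0. Qed.

Lemma cscale_ii u : cscale ii u = Jstr u.
Proof. by rewrite cscale.unlock /= scale1r scale0r add0r. Qed.

Lemma cscale_real (t : R) u : cscale (Complex t 0) u = t *: u.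
Proof. by rewrite cscale.unlock /= scale0r addr0. Qed.

End ComplexStructure.

(** Twice the dbar derivative, evaluated on a real vector; it is antilinear. *)
HB.lock Definition dbar (R : realType) n (rho : 'rV[R]_(n + n) -> R[i])
    (z v : 'rV[R]_(n + n)) : R[i] :=
  cder rho z v + ii * cder rho z (Jstr v).

HB.lock Definition grad_dbar (R : realType) n (rho : 'rV[R]_(n + n) -> R[i])
    (z u v : 'rV[R]_(n + n)) : R[i] :=
  cder (fun y => dbar rho y v) z u.

(** Twice the parts of [grad_dbar] that are linear, respectively antilinear, in the
    first vector: the complex Hessian and the antiholomorphic one. *)
HB.lock Definition levi (R : realType) n (rho : 'rV[R]_(n + n) -> R[i])
    (z u v : 'rV[R]_(n + n)) : R[i] :=
  grad_dbar rho z u v - ii * grad_dbar rho z (Jstr u) v.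

HB.lock Definition hess02 (R : realType) n (rho : 'rV[R]_(n + n) -> R[i])
    (z u v : 'rV[R]_(n + n)) : R[i] :=
  grad_dbar rho z u v + ii * grad_dbar rho z (Jstr u) v.

Section DbarCalculus.
Variables (R : realType) (n : nat) (rho : 'rV[R]_(n + n) -> R[i]).
Implicit Types (z u v b : 'rV[R]_(n + n)) (c : R[i]).

Local Notation dbar := (dbar rho).
Local Notation grad_dbar := (grad_dbar rho).
Local Notation levi := (levi rho).
Local Notation hess02 := (hess02 rho).

Lemma cder_dbar z u v : cder (fun y => dbar y v) z u = grad_dbar z u v.
Proof. by rewrite grad_dbar.unlock. Qed.

Lemma dbar_addr z u v : dbar z (u + v) = dbar z u + dbar z v.
Proof. by rewrite dbar.unlock Jstr_add !cder_addr mulrDr addrACA. Qed.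

Lemma dbar_scaler z (t : R) v : dbar z (t *: v) = Complex t 0 * dbar z v.
Proof. by rewrite dbar.unlock Jstr_scale !cder_scaler mulrDr mulrCA. Qed.

Lemma dbar_J z v : dbar z (Jstr v) = - ii * dbar z v.
Proof. by rewrite dbar.unlock JstrK cder_oppr mulrDr !mulNr mulrN ii_mul opprK addrC. Qed.

Lemma dbar_cscale z c v : dbar z (cscale c v) = conjc c * dbar z v.
Proof. by rewrite cscale.unlock dbar_addr !dbar_scaler dbar_J conjc_split; ring. Qed.

Lemma dbar_oppr z v : dbar z (- v) = - dbar z v.
Proof. by rewrite dbar.unlock Jstr_opp !cder_oppr mulrN -opprD. Qed.

Lemma grad_dbar_addl z u u' v :
  grad_dbar z (u + u') v = grad_dbar z u v + grad_dbar z u' v.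
Proof. by rewrite grad_dbar.unlock cder_addr. Qed.

Lemma grad_dbar_scalel z (t : R) u v :
  grad_dbar z (t *: u) v = Complex t 0 * grad_dbar z u v.
Proof. by rewrite grad_dbar.unlock cder_scaler. Qed.

Lemma grad_dbar_oppl z u v : grad_dbar z (- u) v = - grad_dbar z u v.
Proof. by rewrite grad_dbar.unlock cder_oppr. Qed.

Lemma levi_addl z u u' v : levi z (u + u') v = levi z u v + levi z u' v.
Proof. by rewrite levi.unlock Jstr_add !grad_dbar_addl; ring. Qed.

Lemma levi_cscalel z c u v : levi z (cscale c u) v = c * levi z u v.
Proof.
rewrite levi.unlock Jstr_cscale cscale.unlock !grad_dbar_addl !grad_dbar_scalel ReM ImM /=.
rewrite !mul0r !mul1r sub0r add0r [c in RHS]complex_split.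
have -> : Complex (- complex.Im c) 0 = - Complex (complex.Im c) 0 :> R[i].
  by apply: complex_eqP => /=; rewrite ?oppr0.
have := ii_mul (grad_dbar z (Jstr u) v).
set a := Complex (complex.Re c) 0; set b := Complex (complex.Im c) 0.
move=> E; transitivity (a * grad_dbar z u v + b * grad_dbar z (Jstr u) v +
  ii * b * grad_dbar z u v - ii * a * grad_dbar z (Jstr u) v); first by ring.
have {1}-> : grad_dbar z (Jstr u) v = - (ii * (ii * grad_dbar z (Jstr u) v)).
  by rewrite E opprK.
ring.
Qed.

Lemma hess02_addl z u u' v : hess02 z (u + u') v = hess02 z u v + hess02 z u' v.
Proof. by rewrite hess02.unlock Jstr_add !grad_dbar_addl; ring. Qed.

Lemma hess02_cscalel z c u v : hess02 z (cscale c u) v = conjc c * hess02 z u v.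
Proof.
rewrite hess02.unlock Jstr_cscale cscale.unlock !grad_dbar_addl !grad_dbar_scalel ReM ImM /=.
rewrite !mul0r !mul1r sub0r add0r [in RHS]conjc_split.
have -> : Complex (- complex.Im c) 0 = - Complex (complex.Im c) 0 :> R[i].
  by apply: complex_eqP => /=; rewrite ?oppr0.
have := ii_mul (grad_dbar z (Jstr u) v).
set a := Complex (complex.Re c) 0; set b := Complex (complex.Im c) 0.
move=> E; transitivity (a * grad_dbar z u v + b * grad_dbar z (Jstr u) v -
  ii * b * grad_dbar z u v + ii * a * grad_dbar z (Jstr u) v); first by ring.
have {1}-> : grad_dbar z (Jstr u) v = - (ii * (ii * grad_dbar z (Jstr u) v)).
  by rewrite E opprK.
ring.
Qed.

Lemma grad_dbarE z u v : grad_dbar z u v = (levi z u v + hess02 z u v) / 2.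
Proof. by rewrite levi.unlock hess02.unlock; field. Qed.

Lemma grad_dbar_JE z u v :
  grad_dbar z (Jstr u) v = ii * (levi z u v - hess02 z u v) / 2.
Proof.
have := ii_mul (grad_dbar z (Jstr u) v); rewrite levi.unlock hess02.unlock => E.
transitivity (- (ii * (ii * grad_dbar z (Jstr u) v))); first by rewrite E opprK.
by field.
Qed.

Section AtAnalyticPoint.
Variable z : 'rV[R]_(n + n).
Hypothesis rho_z : canalytic rho z.

Lemma canalytic_dbar v : canalytic (fun y => dbar y v) z.
Proof.
rewrite dbar.unlock; apply: canalyticD; first exact: canalytic_cder.
by apply: canalyticM; [exact: canalytic_cst|exact: canalytic_cder].
Qed.

Lemma canalytic_grad_dbar u v : canalytic (fun y => grad_dbar y u v) z.
Proof. by rewrite grad_dbar.unlock; exact: canalytic_cder (canalytic_dbar v). Qed.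

Lemma canalytic_levi u v : canalytic (fun y => levi y u v) z.
Proof.
rewrite levi.unlock; apply: canalyticB; first exact: canalytic_grad_dbar.
by apply: canalyticM; [exact: canalytic_cst|exact: canalytic_grad_dbar].
Qed.

Lemma canalytic_hess02 u v : canalytic (fun y => hess02 y u v) z.
Proof.
rewrite hess02.unlock; apply: canalyticD; first exact: canalytic_grad_dbar.
by apply: canalyticM; [exact: canalytic_cst|exact: canalytic_grad_dbar].
Qed.

Lemma grad_dbar_addr u v v' : grad_dbar z u (v + v') = grad_dbar z u v + grad_dbar z u v'.
Proof.
rewrite grad_dbar.unlock -(cderD u (canalytic_dbar v) (canalytic_dbar v')).
by congr (cder _ _ _); apply/funext => y; exact: dbar_addr.
Qed.

Lemma grad_dbar_cscaler u c v : grad_dbar z u (cscale c v) = conjc c * grad_dbar z u v.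
Proof.
rewrite grad_dbar.unlock -(cderZ (conjc c) u (canalytic_dbar v)).
by congr (cder _ _ _); apply/funext => y; exact: dbar_cscale.
Qed.

Lemma grad_dbar_Jr u v : grad_dbar z u (Jstr v) = - ii * grad_dbar z u v.
Proof. by rewrite -cscale_ii grad_dbar_cscaler conjc_ii. Qed.

Lemma levi_addr u v v' : levi z u (v + v') = levi z u v + levi z u v'.
Proof. by rewrite levi.unlock !grad_dbar_addr; ring. Qed.

Lemma levi_cscaler u c v : levi z u (cscale c v) = conjc c * levi z u v.
Proof. by rewrite levi.unlock !grad_dbar_cscaler; ring. Qed.

(** Second derivatives of [rho] are symmetric; the part antilinear in both vectors
    inherits this, the part [levi] does not. *)
Lemma hess02_sym u v : hess02 z u v = hess02 z v u.
Proof.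
have E a b : grad_dbar z a b = cder (fun y => cder rho y b) z a +
    ii * cder (fun y => cder rho y (Jstr b)) z a.
  rewrite grad_dbar.unlock dbar.unlock cderD; last 2 first.
  - exact: canalytic_cder.
  - by apply: canalyticM; [exact: canalytic_cst|exact: canalytic_cder].
  by rewrite cderZ //; exact: canalytic_cder.
rewrite hess02.unlock !E (cder_sym v u) // (cder_sym (Jstr v) u) // (cder_sym v (Jstr u)) //.
by rewrite (cder_sym (Jstr v) (Jstr u)) //; ring.
Qed.

End AtAnalyticPoint.

End DbarCalculus.

(** * Levi-flat graphs *)

Section FlatGraph.
Variables (R : realType) (n : nat) (rho : 'rV[R]_(n + n) -> R[i]).
Variables (E1 E2 : 'rV[R]_(n + n)) (B : set 'rV[R]_(n + n)).
Implicit Types (z u v b : 'rV[R]_(n + n)) (c : R[i]).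

Local Notation w := (dbar rho).
Local Notation W := (grad_dbar rho).
Local Notation L := (levi rho).
Local Notation H := (hess02 rho).
Local Notation mu := (fun z => dbar rho z E1).

(** Levi-flatness of the graph of [rho] over [B], read in the coordinate space:
    the exterior derivative of the form [dbar rho] vanishes on its kernel, at the
    CR points. *)
Definition flat_graph := forall z v v', B z -> (exists b, w z b != 0) ->
  w z v = 0 -> w z v' = 0 -> W z v v' = W z v' v.

(** Open conditions that hold near the origin for types C.0 and C.1; the value of [L]
    on [(E2, E1)] dominates the others. *)
Definition near_model := forall z, B z ->
  [/\ 3 <= normc (L z E2 E1),
     [/\ normc (L z E1 E1) <= 2^-1, normc (L z E1 E2) <= 2^-1 & normc (L z E2 E2) <= 2^-1],
     normc (H z E2 E1) <= 2^-1 /\ normc (H z E2 E2) <= 2^-1 &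
     normc (w z E2) * normc (cder (fun y => L y E1 E1) z E2) <= 2^-1].

Hypothesis B_open : open B.
Hypothesis rho_analytic : forall z, B z -> canalytic rho z.
Hypothesis rho_flat : flat_graph.
Hypothesis rho_model : near_model.

(** On the kernel, which is stable under [Jstr], flatness exchanges the two vectors
    of [W], and [W] is antilinear in the second one.  So it is antilinear in the
    first one as well, and [L] is its linear part. *)
Lemma levi_null z v v' : B z -> (exists b, w z b != 0) -> w z v = 0 -> w z v' = 0 ->
  L z v v' = 0.
Proof.
move=> Bz bz vz v'z; rewrite levi.unlock (rho_flat Bz bz vz v'z).
have wJ : w z (Jstr v) = 0 by rewrite dbar_J vz mulr0.
rewrite (rho_flat Bz bz wJ v'z) (grad_dbar_Jr (rho_analytic Bz)).
by rewrite mulNr mulrN ii_mul opprK subrr.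
Qed.

(** Clearing denominators: [conj mu b - conj (w b) E1] lies in the kernel for every
    [b], and is zero where [dbar rho] vanishes. *)
Lemma levi_identity z b b' : B z ->
  conjc (mu z) * mu z * L z b b' - conjc (mu z) * w z b' * L z b E1
  - conjc (w z b) * mu z * L z E1 b' + conjc (w z b) * w z b' * L z E1 E1 = 0.
Proof.
move=> Bz; have az := rho_analytic Bz.
have [wz|wz] := pselect (exists b0, w z b0 != 0); last first.
  have w0 b0 : w z b0 = 0.
    by apply/eqP; apply: contrapT => /negP wc; apply: wz; exists b0.
  by rewrite !w0; ring.
pose V b0 := cscale (conjc (mu z)) b0 + cscale (- conjc (w z b0)) E1.
have wV b0 : w z (V b0) = 0.
  rewrite /V dbar_addr !dbar_cscale conjcN !conjcK; ring.
have := levi_null Bz wz (wV b) (wV b').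
rewrite /V !levi_addl !levi_cscalel !(levi_addr az) !(levi_cscaler az).
by rewrite conjcN !conjcK => <-; ring.
Qed.

(** The Levi term dominates the derivative of [mu] in the direction [E2], so the
    zero set of [mu] is transverse to the complex line of [E2]. *)
Lemma transversal_ge1 z : B z ->
  1 <= normc (W z E2 E1) /\ 1 <= normc (W z (Jstr E2) E1).
Proof.
move=> Bz; have [L21 _ [H21 _] _] := rho_model Bz.
rewrite grad_dbarE grad_dbar_JE !normc_half Normc.normcM normc_ii mul1r.
split.
  have := le_normcD (L z E2 E1 + H z E2 E1) (- H z E2 E1).
  by rewrite addrK normcN; lra.
have := le_normcD (L z E2 E1 - H z E2 E1) (H z E2 E1).
by rewrite subrK; lra.
Qed.

(** If [mu p = 0] but [w p E2 != 0], differentiating the identity for [b = b' = E2]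
    in the direction [E2] gives [L21 D mu ~ L12 D mu + (w E2) (D L11)], whose left
    hand side is too large. *)
Lemma mu_zero_E2 p : B p -> mu p = 0 -> w p E2 = 0.
Proof.
move=> Bp mp; apply/eqP; apply: contrapT => /negP nup.
have ap := rho_analytic Bp.
have [L21 [_ L12 _] _ K] := rho_model Bp.
have [Wp _] := transversal_ge1 Bp.
have L11 : L p E1 E1 = 0.
  have := levi_identity E2 E2 Bp; rewrite mp conjc0 !(mul0r, mulr0) !subr0 add0r.
  move/eqP; rewrite !mulf_eq0 conjc_eq0 (negPf nup) /=.
  by move/eqP.
have nearB : \forall y \near p, B y by exact: open_nbhs_nbhs.
pose T y := conjc (mu y) * mu y * L y E2 E2 - conjc (mu y) * w y E2 * L y E2 E1
  - conjc (w y E2) * mu y * L y E1 E2 + conjc (w y E2) * w y E2 * L y E1 E1.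
have a1 : canalytic mu p by exact: canalytic_dbar.
have a2 : canalytic (fun y => w y E2) p by exact: canalytic_dbar.
have a1' := canalyticJ a1; have a2' := canalyticJ a2.
have aL u v : canalytic (fun y => L y u v) p by exact: canalytic_levi.
have := cder_eq_near E2 (f := T) (g := fun=> 0) (x := p).
rewrite cder_cst => H0; have : cder T p E2 = 0.
  apply: H0; first by apply: filterS nearB => y /(levi_identity E2 E2).
  by apply: canalyticD; [apply: canalyticB; [apply: canalyticB|]|];
    apply: canalyticM => //; exact: canalyticM.
have aM f g : canalytic f p -> canalytic g p -> canalytic (fun y => f y * g y) p.
  exact: canalyticM.
have a11 := aM _ _ a1' a1; have a12 := aM _ _ a1' a2; have a21 := aM _ _ a2' a1.
have a22 := aM _ _ a2' a2.
have b1 := aM _ _ a11 (aL E2 E2); have b2 := aM _ _ a12 (aL E2 E1).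
have b3 := aM _ _ a21 (aL E1 E2); have b4 := aM _ _ a22 (aL E1 E1).
rewrite /T (cderD _ (canalyticB (canalyticB b1 b2) b3) b4).
rewrite (cderB _ (canalyticB b1 b2) b3) (cderB _ b1 b2).
rewrite (cderM _ a11 (aL E2 E2)) (cderM _ a12 (aL E2 E1)) (cderM _ a21 (aL E1 E2)).
rewrite (cderM _ a22 (aL E1 E1)) (cderM _ a1' a1) (cderM _ a1' a2) (cderM _ a2' a1).
rewrite !(cderJ _ a1) L11 mp conjc0 !(mul0r, mulr0, addr0, add0r, sub0r).
rewrite (cder_dbar rho p E2 E1).
set nu := w p E2 in nup K *; set m := W p E2 E1 in Wp *.
set D := cder _ p E2 in K *.
move=> E.
have E' : conjc m * nu * L p E2 E1 = conjc nu * nu * D - conjc nu * m * L p E1 E2.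
  by apply/eqP; rewrite -subr_eq0 -oppr_eq0 -E; apply/eqP; ring.
have : normc m * normc nu * normc (L p E2 E1) <=
    normc nu * normc nu * normc D + normc nu * normc m * normc (L p E1 E2).
  rewrite -{1}(normc_conj m) -2!Normc.normcM E'.
  by apply: (le_trans (normcB_le _ _)); rewrite !Normc.normcM !normc_conj.
have nu0 : 0 < normc nu by rewrite normc_gt0.
have : normc m * (normc nu * 3) <= normc m * (normc nu * normc (L p E2 E1)).
  by rewrite ler_wpM2l ?normc_ge0 // ler_wpM2l ?normc_ge0.
have : normc nu * (normc nu * normc D) <= normc nu * 2^-1.
  by rewrite ler_wpM2l ?normc_ge0.
have : normc nu * (normc m * normc (L p E1 E2)) <= normc nu * (normc m * 2^-1).
  by rewrite ler_wpM2l ?normc_ge0 // ler_wpM2l ?normc_ge0.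
have : normc nu * 1 <= normc nu * normc m by rewrite ler_wpM2l ?normc_ge0.
lra.
Qed.

(** The CR singular points are the zeros of [mu] alone: at a CR point where [mu]
    vanishes both [E1] and [E2] would be null vectors, although [L z E2 E1] is large. *)
Lemma mu_zero p : B p -> mu p = 0 -> forall b, w p b = 0.
Proof.
move=> Bp mp b; apply/eqP; apply: contrapT => /negP wb.
have := levi_null Bp (ex_intro _ b wb) (mu_zero_E2 Bp mp) mp => L21.
by have [] := rho_model Bp; rewrite L21 Normc.normc0; lra.
Qed.

End FlatGraph.

(** * Order of vanishing along a line *)

Lemma der_quadratic (R : realType) m (f : 'rV[R]_m -> R) p : analytic_at f p ->
  exists K e, [/\ 0 <= K, 0 < e & forall u, `|u| < e ->
    `|f (p + u) - f p - der f p u| <= K * `|u| ^+ 2].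
Proof.
move=> /analytic_atP[s [C [s0 fC]]].
have C0 : 0 <= C := l1_series_ge0 (ltW s0) fC.
have [b Hb] := l1_series_taylor0 s0 fC.
have H2 r : 0 < r -> r <= s -> l1_series r (C * (r / s) ^+ 2)
     (fun h => f (p + h) - f (p + 0) - \sum_i h 0 i * b i).
  by move=> r0 rs; have [] := Hb r r0 rs.
have [_ dE] := taylor_diff s0 C0 H2.
exists (C * 4 / s ^+ 2), (s / 2); split; last 1 first.
- move=> u us; rewrite -derE dE.
  have [->|u0] := eqVneq u 0.
    rewrite addr0 subrr sub0r normrN normr0 expr0n mulr0 big1 ?normr0 // => i _.
    by rewrite mxE mul0r.
  have nu0 : 0 < `|u| by rewrite normr_gt0.
  have u2 : 0 < 2 * `|u| by rewrite mulr_gt0.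
  have u2s : 2 * `|u| <= s by lra.
  have := l1_series_bound (h := u) _ (H2 _ u2 u2s); rewrite addr0.
  move=> /(_ (_ : `|u| < 2 * `|u|)) H; apply: le_trans (H _) _; first by lra.
  rewrite le_eqVlt; apply/orP; left; apply/eqP; field; by rewrite gt_eqF.
- by rewrite !mulr_ge0 ?invr_ge0 ?exprn_ge0 // ltW.
- by rewrite divr_gt0.
Qed.

Lemma near_line (R : realType) m (q u : 'rV[R]_m) (P : set 'rV[R]_m) :
  (\forall y \near q, P y) ->
  exists2 e : R, 0 < e & forall t : R, 0 < t -> t < e -> P (q + t *: u).
Proof.
move=> /nbhs_ballP[e /= e0 H]; have U0 : 0 < `|u| + 1 by exact: ltr_wpDl.
exists (e / (`|u| + 1)) => [|t t0]; first by rewrite divr_gt0.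
rewrite ltr_pdivlMr // => te; apply: H; rewrite -ball_normE /= opprD addNKr normrN.
rewrite normrZ gtr0_norm //; apply: le_lt_trans te.
by rewrite ler_pM2l // lerDl.
Qed.

Section OrderOfVanishing.
Variable R : realType.
Implicit Types (phi psi : R -> R[i]) (k : nat).

(** Order of vanishing as [t] tends to [0] from above. *)
Definition bigO k phi := exists K e, [/\ 0 <= K, 0 < e &
  forall t, 0 < t -> t < e -> normc (phi t) <= K * t ^+ k].

Lemma bigO_eq k phi psi : (exists2 e, 0 < e & forall t, 0 < t -> t < e -> phi t = psi t) ->
  bigO k phi -> bigO k psi.
Proof.
move=> [e e0 pp] [K [e' [K0 e'0 H]]]; exists K, (Num.min e e'); split => //.
  by rewrite lt_min e0.
by move=> t t0; rewrite lt_min => /andP[te te']; rewrite -pp //; exact: H.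
Qed.

Lemma bigOD k phi psi : bigO k phi -> bigO k psi -> bigO k (fun t => phi t + psi t).
Proof.
move=> [K [e [K0 e0 H]]] [K' [e' [K'0 e'0 H']]].
exists (K + K'), (Num.min e e'); split; [exact: addr_ge0|by rewrite lt_min e0|].
move=> t t0; rewrite lt_min => /andP[te te'].
by apply: (le_trans (le_normcD _ _)); rewrite mulrDl lerD ?H ?H'.
Qed.

Lemma bigON k phi : bigO k phi -> bigO k (fun t => - phi t).
Proof.
move=> [K [e [K0 e0 H]]]; exists K, e; split => // t t0 te.
by rewrite normcN; exact: H.
Qed.

Lemma bigOJ k phi : bigO k phi -> bigO k (fun t => conjc (phi t)).
Proof.
move=> [K [e [K0 e0 H]]]; exists K, e; split => // t t0 te.
by rewrite normc_conj; exact: H.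
Qed.

Lemma bigOM j k phi psi : bigO j phi -> bigO k psi ->
  bigO (j + k) (fun t => phi t * psi t).
Proof.
move=> [K [e [K0 e0 H]]] [K' [e' [K'0 e'0 H']]].
exists (K * K'), (Num.min e e'); split; [exact: mulr_ge0|by rewrite lt_min e0|].
move=> t t0; rewrite lt_min => /andP[te te'].
rewrite Normc.normcM exprD mulrACA; apply: ler_pM; rewrite ?normc_ge0 //.
  exact: H.
exact: H'.
Qed.

Lemma bigO_cst (c : R[i]) : bigO 0 (fun=> c).
Proof.
exists (normc c), 1; split; [exact: normc_ge0|exact: ltr01|].
by move=> t _ _; rewrite expr0 mulr1.
Qed.

Lemma bigO_id : bigO 1 (fun t => Complex t 0).
Proof.
exists 1, 1; split => // t t0 _.
by rewrite /= expr0n /= addr0 sqrtr_sqr mul1r expr1 ger0_norm // ltW.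
Qed.

Lemma bigO_weaken j k phi : (j <= k)%N -> bigO k phi -> bigO j phi.
Proof.
move=> jk [K [e [K0 e0 H]]]; exists K, (Num.min e 1); split => //.
  by rewrite lt_min e0 ltr01.
move=> t t0; rewrite lt_min => /andP[te t1].
apply: le_trans (H t t0 te) _; apply: ler_wpM2l => //.
by apply: ler_wiXn2l => //; exact: ltW.
Qed.

Lemma bigO_coef k (c : R[i]) : bigO k.+1 (fun t => Complex t 0 ^+ k * c) -> c = 0.
Proof.
move=> [K [e [K0 e0 H]]]; apply: Normc.eq0_normc; apply/eqP.
rewrite eq_le normc_ge0 andbT leNgt; apply/negP => c0.
have K1 : 0 < 2 * (K + 1) by rewrite mulr_gt0 // ltr_wpDl.
pose t := Num.min (e / 2) (normc c / (2 * (K + 1))).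
have t0 : 0 < t by rewrite lt_min !divr_gt0.
have te : t < e by apply: (@le_lt_trans _ _ (e / 2)); [rewrite ge_min lexx|lra].
have tK : t * (2 * (K + 1)) <= normc c by rewrite -ler_pdivlMr // ge_min lexx orbT.
have := H t t0 te; rewrite Normc.normcM.
have -> : normc (Complex t 0 ^+ k) = t ^+ k.
  elim: (k) => [|k' IH]; first by rewrite !expr0 Normc.normc1.
  rewrite !exprS Normc.normcM IH /= expr0n /= addr0 sqrtr_sqr ger0_norm //.
  exact: ltW.
rewrite exprS mulrA [K * t]mulrC -mulrA [t ^+ k * _]mulrC mulrA.
rewrite ler_pM2r ?exprn_gt0 //.
by nra.
Qed.

Lemma bigO_line m (f : 'rV[R]_m -> R[i]) q u : canalytic f q ->
  bigO 2 (fun t => f (q + t *: u) - f q - Complex t 0 * cder f q u).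
Proof.
move=> [/der_quadratic[K [e [K0 e0 H]]] /der_quadratic[K' [e' [K'0 e'0 H']]]].
have U0 : 0 < `|u| + 1 by exact: ltr_wpDl.
exists ((K + K') * `|u| ^+ 2), (Num.min e e' / (`|u| + 1)); split.
- by rewrite mulr_ge0 ?addr_ge0 ?exprn_ge0.
- by rewrite divr_gt0 // lt_min e0.
move=> t t0; rewrite ltr_pdivlMr // lt_min => /andP[te te'].
have nt : `|t *: u| = t * `|u| by rewrite normrZ gtr0_norm.
have tu : `|t *: u| <= t * (`|u| + 1) by rewrite nt ler_pM2l // lerDl.
apply: (le_trans (normc_le_ReIm _)).
rewrite !(ReD, ImD, ReN, ImN, ReM, ImM) /= !mul0r subr0 addr0.
have -> : (K + K') * `|u| ^+ 2 * t ^+ 2 = K * `|t *: u| ^+ 2 + K' * `|t *: u| ^+ 2.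
  by rewrite nt; ring.
rewrite -!der_scaler; by apply: lerD; [apply: H|apply: H']; exact: le_lt_trans tu _.
Qed.

Lemma bigO_zero m (f : 'rV[R]_m -> R[i]) q u : canalytic f q -> f q = 0 ->
  bigO 1 (fun t => f (q + t *: u)).
Proof.
move=> fq f0; have := bigOD (bigO_weaken (isT : (1 <= 2)%N) (bigO_line u fq))
  (bigOM bigO_id (bigO_cst (cder f q u))).
by apply: bigO_eq; exists 1 => // t _ _; rewrite f0; ring.
Qed.

Lemma bigO_zero2 m (f : 'rV[R]_m -> R[i]) q u : canalytic f q -> f q = 0 ->
  cder f q u = 0 -> bigO 2 (fun t => f (q + t *: u)).
Proof.
move=> fq f0 d0; have := bigO_line u fq.
by apply: bigO_eq; exists 1 => // t _ _; rewrite f0 d0; ring.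
Qed.

Lemma bigO_bounded m (f : 'rV[R]_m -> R[i]) q u : canalytic f q ->
  bigO 0 (fun t => f (q + t *: u)).
Proof.
move=> fq; have fc : canalytic (fun z => f z - f q) q.
  by apply: canalyticB => //; exact: canalytic_cst.
have := bigOD (bigO_weaken (isT : (0 <= 1)%N) (bigO_zero u fc (subrr _))) (bigO_cst (f q)).
by apply: bigO_eq; exists 1 => // t _ _; ring.
Qed.

(** Leading term of a product with two factors that vanish at [q]. *)
Lemma bigO_prod3 m (x y k : 'rV[R]_m -> R[i]) q u :
  canalytic x q -> canalytic y q -> canalytic k q -> x q = 0 -> y q = 0 ->
  bigO 3 (fun t => x (q + t *: u) * y (q + t *: u) * k (q + t *: u) -
    Complex t 0 ^+ 2 * (cder x q u * cder y q u * k q)).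
Proof.
move=> ax ay ak x0 y0.
have Ox := bigO_line u ax; have Oy := bigO_line u ay.
have Ok : bigO 1 (fun t => k (q + t *: u) - k q).
  have kc : canalytic (fun z => k z - k q) q.
    by apply: canalyticB => //; exact: canalytic_cst.
  exact: (bigO_zero u kc (subrr _)).
have c1 := bigOM bigO_id (bigO_cst (cder x q u)).
have c2 := bigOM bigO_id (bigO_cst (cder y q u)).
have := bigOD (bigOD (bigOM (bigOM Ox (bigO_zero u ay y0)) (bigO_bounded u ak))
  (bigOM (bigOM c1 Oy) (bigO_bounded u ak))) (bigOM (bigOM c1 c2) Ok).
by apply: bigO_eq; exists 1 => // t _ _; rewrite x0 y0; ring.
Qed.

Lemma bigO_div k phi (f : R -> R[i]) m' : 0 < m' ->
  (exists2 e, 0 < e & forall t, 0 < t -> t < e -> m' * t <= normc (f t)) ->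
  bigO k.+1 (fun t => f t * phi t) -> bigO k phi.
Proof.
move=> m0 [e e0 fm] [K [e' [K0 e'0 H]]].
exists (K / m'), (Num.min e e'); split; [by rewrite divr_ge0 // ltW|by rewrite lt_min e0|].
move=> t t0; rewrite lt_min => /andP[te te'].
have := H t t0 te'; rewrite Normc.normcM exprS => H1.
have mt : 0 < m' * t by rewrite mulr_gt0.
have : m' * t * normc (phi t) <= K * (t * t ^+ k).
  by apply: le_trans H1; rewrite ler_wpM2r ?normc_ge0 ?fm.
have -> : K * (t * t ^+ k) = m' * t * (K / m' * t ^+ k) by field; rewrite gt_eqF.
by rewrite ler_pM2l.
Qed.

Lemma bigO_zero_lower m (f : 'rV[R]_m -> R[i]) q u : canalytic f q -> f q = 0 ->
  cder f q u != 0 ->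
  exists2 m', 0 < m' & exists2 e, 0 < e & forall t, 0 < t -> t < e ->
    m' * t <= normc (f (q + t *: u)).
Proof.
move=> fq f0 d0; have [K [e [K0 e0 H]]] := bigO_line u fq.
set d := cder f q u in d0 H; have nd : 0 < normc d by rewrite normc_gt0.
have K1 : 0 < 2 * (K + 1) by rewrite mulr_gt0 // ltr_wpDl.
exists (normc d / 2); first by rewrite divr_gt0.
exists (Num.min e (normc d / (2 * (K + 1)))) => [|t t0].
  by rewrite lt_min e0 divr_gt0.
rewrite lt_min => /andP[te tK]; have := H t t0 te; rewrite f0 subr0.
rewrite ltr_pdivlMr // in tK.
have := normcB_le (f (q + t *: u)) (f (q + t *: u) - Complex t 0 * d).
have -> : f (q + t *: u) - (f (q + t *: u) - Complex t 0 * d) = Complex t 0 * d by ring.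
have -> : normc (Complex t 0 * d) = t * normc d.
  rewrite Normc.normcM; congr (_ * _).
  by rewrite /= expr0n /= addr0 sqrtr_sqr ger0_norm // ltW.
nra.
Qed.

End OrderOfVanishing.

(** * The singular locus in the coordinate space *)

Section SingularSet.
Variables (R : realType) (n : nat) (rho : 'rV[R]_(n + n) -> R[i]).
Variables (E1 E2 : 'rV[R]_(n + n)) (B : set 'rV[R]_(n + n)).
Implicit Types (q z u v b : 'rV[R]_(n + n)) (c : R[i]).

Local Notation w := (dbar rho).
Local Notation W := (grad_dbar rho).
Local Notation L := (levi rho).
Local Notation H := (hess02 rho).
Local Notation mu := (fun z => dbar rho z E1).

Hypothesis B_open : open B.
Hypothesis rho_analytic : forall z, B z -> canalytic rho z.
Hypothesis rho_flat : flat_graph rho B.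
Hypothesis rho_model : near_model rho E1 E2 B.

Variable g : 'rV[R]_(n + n) -> R[i].
Hypothesis g_analytic : forall z, B z -> canalytic g z.
Hypothesis g_section : forall z, B z -> mu (z + cscale (g z) E2) = 0.
Hypothesis g_zero : forall z, B z -> mu z = 0 -> g z = 0.

Let small_root_absurd (a x y s : R) : 0 < a -> a * 3 <= a * x -> a * y <= a * 2^-1 ->
  s <= (a + a) * 2^-1 -> a * x <= a * y + s -> False.
Proof. by lra. Qed.

Let big_small_absurd (x y : R) : x = y -> 3 <= x -> y <= 1 * 2^-1 -> False.
Proof. by lra. Qed.

Lemma nearB q : B q -> \forall y \near q, B y.
Proof. by move=> Bq; exact: open_nbhs_nbhs. Qed.

Lemma transversal_inj z c : B z -> W z (cscale c E2) E1 = 0 -> c = 0.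
Proof.
move=> Bz; have [L21 _ [H21 _] _] := rho_model Bz.
rewrite grad_dbarE levi_cscalel hess02_cscalel => /eqP.
rewrite mulf_eq0 invr_eq0 pnatr_eq0 orbF addr_eq0 => /eqP/(congr1 (@Normc.normc _)).
rewrite normcN !Normc.normcM normc_conj => E.
apply: Normc.eq0_normc; have c0 := normc_ge0 c; nra.
Qed.

(** The equation [a c + b conj c = s] is solved by conjugation, since its
    determinant [|a|^2 - |b|^2] is not zero. *)
Lemma transversal_solve z (s : R[i]) : B z -> exists c, W z (cscale c E2) E1 = s.
Proof.
move=> Bz; have [L21 _ [H21 _] _] := rho_model Bz.
set l := L z E2 E1 in L21; set h := H z E2 E1 in H21.
pose d := conjc l * l - conjc h * h.
have d0 : d != 0.
  rewrite subr_eq0; apply/negP => /eqP/(congr1 (@Normc.normc _)).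
  by rewrite !Normc.normcM !normc_conj; have := normc_ge0 h; nra.
have dJ : conjc d = d by rewrite /d conjcB !conjcM !conjcK; ring.
exists (2 * (conjc l * s - h * conjc s) / d).
rewrite grad_dbarE levi_cscalel hess02_cscalel -/l -/h.
rewrite conjcM conjc_inv dJ conjcM conjc_nat conjcB !conjcM !conjcK.
by rewrite /d in d0 *; field.
Qed.

(** The retraction onto the singular set along the direction [E2]. *)
Definition retract z := z + cscale (g z) E2.

Let retract_coord j : (fun z => retract z 0 j) = fun z => z 0 j +
  (complex.Re (g z) * E2 0 j + complex.Im (g z) * Jstr E2 0 j).
Proof. by apply/funext => z; rewrite /retract cscale.unlock !mxE. Qed.

Let analytic_coef z j : B z ->
  analytic_at (fun z => complex.Re (g z) * E2 0 j) z /\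
  analytic_at (fun z => complex.Im (g z) * Jstr E2 0 j) z.
Proof.
move=> /g_analytic[gr gi].
by split; apply: analyticM => //; exact: analytic_cst.
Qed.

Lemma retract_analytic z : B z -> analytic_map_at retract z.
Proof.
move=> Bz j; rewrite retract_coord; have [ar ai] := analytic_coef j Bz.
by apply: analyticD; [exact: analytic_coord|exact: analyticD].
Qed.

Lemma mder_retract z v : B z -> mder retract z v = v + cscale (cder g z v) E2.
Proof.
move=> Bz; apply/rowP => j; rewrite mder_coord retract_coord.
have [ar ai] := analytic_coef j Bz; have [gr gi] := g_analytic Bz.
have ac (a : R) : analytic_at (fun=> a) z by exact: analytic_cst.
rewrite (derD _ (analytic_coord j z) (analyticD ar ai)) der_coord (derD _ ar ai).
rewrite (derM _ gr (ac _)) (derM _ gi (ac _)) !der_cst cscale.unlock !mxE /=; ring.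
Qed.

Lemma retract_id z : B z -> mu z = 0 -> retract z = z.
Proof. by move=> Bz mz; rewrite /retract g_zero // cscale0 addr0. Qed.

Lemma retract_near z : B z -> mu z = 0 -> \forall y \near z, B (retract y).
Proof.
move=> Bz mz; have B' : nbhs (retract z) B by rewrite retract_id //; exact: nearB.
exact: (analytic_map_continuous (retract_analytic Bz) B').
Qed.

Lemma retract_tangent z v : B z -> B (retract z) ->
  W (retract z) (mder retract z v) E1 = 0.
Proof.
move=> Bz Br.
have mr : canalytic mu (retract z) by apply: canalytic_dbar; exact: rho_analytic.
rewrite -cder_dbar -(cder_comp _ mr (retract_analytic Bz)).
rewrite (@cder_eq_near _ _ _ (fun=> 0)) ?cder_cst //.
  by apply: filterS (nearB Bz) => y By; exact: g_section.
exact: (canalytic_comp mr (retract_analytic Bz)).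
Qed.

Lemma tangent_section z v : B z -> mu z = 0 -> W z v E1 = 0 -> cder g z v = 0.
Proof.
move=> Bz mz Wv; apply: (transversal_inj Bz).
have Br : B (retract z) by rewrite retract_id.
have := retract_tangent v Bz Br.
by rewrite retract_id // mder_retract // grad_dbar_addl Wv add0r.
Qed.

Lemma cder_section_E2 z c : B z -> mu z = 0 -> cder g z (cscale c E2) = - c.
Proof.
move=> Bz mz; have Br : B (retract z) by rewrite retract_id.
have := retract_tangent (cscale c E2) Bz Br.
rewrite retract_id // mder_retract // -cscaleD => /(transversal_inj Bz).
by move=> /eqP; rewrite addrC addr_eq0 => /eqP.
Qed.

(** A vector killed by the differential of [mu] is fixed by the differential of the
    retraction, which factors every function through the singular set. *)
Lemma tangent_zero (f : 'rV[R]_(n + n) -> R[i]) q v : B q -> mu q = 0 -> canalytic f q ->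
  (\forall z \near q, mu z = 0 -> f z = 0) -> W q v E1 = 0 -> cder f q v = 0.
Proof.
move=> Bq mq fq f0 Wv; have rq := retract_id Bq mq.
have ra := retract_analytic Bq.
have <- : mder retract q v = v.
  by rewrite mder_retract // tangent_section // cscale0 addr0.
have [fq' <-] := cder_comp_at v rq fq ra.
rewrite (@cder_eq_near _ _ _ (fun=> 0)) ?cder_cst //.
have f0' : nbhs (retract q) [set z | mu z = 0 -> f z = 0] by rewrite rq.
have near_f0 : \forall z \near q, mu (retract z) = 0 -> f (retract z) = 0.
  exact: (analytic_map_continuous ra f0').
by apply: filterS2 near_f0 (nearB Bq) => z H1 /g_section /H1.
Qed.

Lemma grad_dbar_tangent q v b : B q -> mu q = 0 -> W q v E1 = 0 -> W q v b = 0.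
Proof.
move=> Bq mq Wv; rewrite -cder_dbar; apply: (tangent_zero Bq mq) => //.
  by apply: canalytic_dbar; exact: rho_analytic.
apply: filterS (nearB Bq) => z Bz mz.
exact: (mu_zero B_open rho_analytic rho_flat rho_model Bz mz).
Qed.

(** Every term of the Levi identity has two factors that vanish at [q]; this is the
    coefficient of [t ^+ 2] along the line [q + t u]. *)
Lemma levi_identity2 q u b b' : B q -> mu q = 0 ->
  conjc (W q u E1) * W q u E1 * L q b b' - conjc (W q u E1) * W q u b' * L q b E1
  - conjc (W q u b) * W q u E1 * L q E1 b' + conjc (W q u b) * W q u b' * L q E1 E1 = 0.
Proof.
move=> Bq mq; have aq := rho_analytic Bq.
have w0 v : w q v = 0 by exact: (mu_zero B_open rho_analytic rho_flat rho_model Bq mq).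
have aw v : canalytic (fun z => w z v) q by exact: canalytic_dbar.
have aL v v' : canalytic (fun z => L z v v') q by exact: canalytic_levi.
have O v v' a a' := bigO_prod3 u (canalyticJ (aw v)) (aw v') (aL a a')
  (etrans (congr1 conjc (w0 v)) (conjc0 _)) (w0 v').
have := bigOD (bigOD (O E1 E1 b b') (bigON (O E1 b' b E1)))
  (bigOD (bigON (O b E1 E1 b')) (O b b' E1 E1)).
move=> /(bigO_eq (psi := fun t => Complex t 0 ^+ 2 * - _)) Oeq.
apply/eqP; rewrite -oppr_eq0; apply/eqP; apply: bigO_coef; apply: Oeq.
have [e e0 He] := near_line u (nearB Bq); exists e => // t t0 te.
have := levi_identity E1 rho_analytic rho_flat b b' (He t t0 te).
rewrite !(cderJ _ (aw _)); set Y := Complex t 0.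
set x1 := w (q + t *: u) E1; set x2 := w (q + t *: u) b; set x3 := w (q + t *: u) b'.
move=> I1; apply/eqP; rewrite -subr_eq0 -[X in _ == X]I1; apply/eqP.
rewrite ?cder_dbar; ring.
Qed.

(** The common antilinear factor: along the singular set every derivative of
    [dbar rho] is a multiple of this form. *)
Definition ratio q b := W q E2 b / W q E2 E1.

(** Along the CR singular set all derivatives of [dbar rho] are proportional to a
    single form: the quadratic equation that the Levi identity gives for the ratio
    has only one small root, so the directions [E2] and [J E2] give the same form,
    and in directions tangent to the set the derivative is zero. *)
Lemma grad_dbar_ratio q u b : B q -> mu q = 0 -> W q u b = ratio q b * W q u E1.
Proof.
move=> Bq mq; have [L21 [L11 L12 L22] [H21 H22] _] := rho_model Bq.
have [T1 T2] := transversal_ge1 rho_model Bq.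
have ne (a : R[i]) : 1 <= normc a -> a != 0.
  by rewrite -normc_gt0; exact: lt_le_trans.
pose rat v b0 := W q v b0 / W q v E1.
have eq_rat v b1 b2 : 1 <= normc (W q v E1) ->
    L q b1 b2 - rat v b2 * L q b1 E1 - conjc (rat v b1) * L q E1 b2 +
    conjc (rat v b1) * rat v b2 * L q E1 E1 = 0.
  move=> /ne v0; have := levi_identity2 v b1 b2 Bq mq.
  have vJ : conjc (W q v E1) != 0 by rewrite conjc_eq0.
  move=> I2; apply: (mulfI (mulf_neq0 vJ v0)); rewrite mulr0 -[RHS]I2.
  by rewrite /rat conjcM conjc_inv; field; rewrite v0.
have small v : 1 <= normc (W q v E1) -> normc (W q v E2) <= 1 -> normc (rat v E2) <= 1.
  move=> v1 v2; rewrite /rat Normc.normcM Normc.normcV.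
  by rewrite ler_pdivrMr ?mul1r ?(le_trans v2) // (lt_le_trans _ v1).
have s1 : normc (rat E2 E2) <= 1.
  apply: small => //; rewrite grad_dbarE normc_half.
  by have := le_normcD (L q E2 E2) (H q E2 E2); lra.
have s2 : normc (rat (Jstr E2) E2) <= 1.
  apply: small => //; rewrite grad_dbar_JE normc_half Normc.normcM normc_ii mul1r.
  by have := normcB_le (L q E2 E2) (H q E2 E2); lra.
(* the difference of two roots satisfies an equation in which the coefficient
   [L q E2 E1] dominates *)
have root_unique c d : normc c <= 1 -> normc d <= 1 ->
    L q E2 E2 - c * L q E2 E1 - conjc c * L q E1 E2 + conjc c * c * L q E1 E1 = 0 ->
    L q E2 E2 - d * L q E2 E1 - conjc d * L q E1 E2 + conjc d * d * L q E1 E1 = 0 ->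
    c = d.
  move=> c1 d1 Ec Ed; apply/eqP; rewrite -subr_eq0 -normc_eq0.
  have E : (c - d) * L q E2 E1 = - (conjc (c - d) * L q E1 E2) +
      (conjc c * (c - d) + conjc (c - d) * d) * L q E1 E1.
    apply/eqP; rewrite -subr_eq0; apply/eqP; move: Ec Ed.
    set ec := (X in X = 0 -> _); set ed := (X in _ -> X = 0 -> _) => Ec Ed.
    by transitivity (ed - ec); [rewrite /ec /ed !conjcB; ring|rewrite Ec Ed subr0].
  have : normc (c - d) * normc (L q E2 E1) <=
      normc (c - d) * normc (L q E1 E2) +
      (normc c * normc (c - d) + normc (c - d) * normc d) * normc (L q E1 E1).
    rewrite -Normc.normcM E; apply: (le_trans (le_normcD _ _)).
    rewrite normcN !Normc.normcM normc_conj lerD2l ler_wpM2r ?normc_ge0 //.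
    by apply: (le_trans (le_normcD _ _)); rewrite !Normc.normcM !normc_conj.
  set a := normc (c - d) => Ha.
  have a0 : 0 <= a by exact: normc_ge0.
  rewrite eq_le a0 andbT leNgt; apply/negP => a_gt0.
  have h1 : a * 3 <= a * normc (L q E2 E1) by rewrite ler_pM2l.
  have h2 : a * normc (L q E1 E2) <= a * 2^-1 by rewrite ler_pM2l.
  have h3 : (normc c * a + a * normc d) * normc (L q E1 E1) <= (a + a) * 2^-1.
    apply: ler_pM; rewrite ?normc_ge0 //.
      by rewrite addr_ge0 // mulr_ge0 ?normc_ge0.
    by rewrite lerD // ?ler_piMl // ler_piMr.
  exact: small_root_absurd a_gt0 h1 h2 h3 Ha.
have r2 : rat (Jstr E2) E2 = rat E2 E2.
  by apply: root_unique => //; apply: eq_rat.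
have den : L q E2 E1 - conjc (rat E2 E2) * L q E1 E1 != 0.
  rewrite subr_eq0; apply/negP => /eqP/(congr1 (@Normc.normc _)).
  rewrite Normc.normcM normc_conj => E.
  have E' : normc (rat E2 E2) * normc (L q E1 E1) <= 1 * 2^-1.
    by apply: ler_pM; rewrite ?normc_ge0.
  exact: big_small_absurd E L21 E'.
have rJ b0 : rat (Jstr E2) b0 = rat E2 b0.
  apply: (mulIf den); have e1 := eq_rat E2 E2 b0 T1; have e2 := eq_rat (Jstr E2) E2 b0 T2.
  rewrite r2 in e2; apply/eqP; rewrite -subr_eq0; apply/eqP; move: e1 e2.
  set x1 := (X in X = 0 -> _); set x2 := (X in _ -> X = 0 -> _) => e1 e2.
  by transitivity (x1 - x2); [rewrite /x1 /x2; ring|rewrite e1 e2 subr0].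
(* modulo a tangent vector, [u] lies in the complex line of [E2] *)
have [a Ea] := transversal_solve (W q u E1) Bq.
have tan : W q (u - cscale a E2) E1 = 0.
  by rewrite grad_dbar_addl grad_dbar_oppl Ea subrr.
have := grad_dbar_tangent b Bq mq tan; rewrite grad_dbar_addl grad_dbar_oppl.
move=> /eqP; rewrite subr_eq0 => /eqP ->; rewrite -Ea cscale.unlock.
rewrite !grad_dbar_addl !grad_dbar_scalel mulrDr ![ratio _ _ * _]mulrCA.
congr (_ * _ + _ * _).
  by rewrite /ratio divfK ?ne.
by rewrite -[ratio q b]/(rat E2 b) -rJ /rat divfK ?ne.
Qed.

(** By the symmetry of [hess02] the proportionality in its second vector carries
    over to the first one. *)
Lemma hess02_ratio q u : B q -> mu q = 0 -> H q u E1 = ratio q u * H q E1 E1.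
Proof.
move=> Bq mq; rewrite (hess02_sym (rho_analytic Bq)) hess02.unlock.
by rewrite (grad_dbar_ratio E1 u Bq mq) (grad_dbar_ratio (Jstr E1) u Bq mq); ring.
Qed.

(** Where the antiholomorphic Hessian is zero on [E1], the differential of [mu] is
    complex linear on the tangent space of the singular set, which is then complex. *)
Lemma tangent_complex q v : B q -> mu q = 0 -> H q E1 E1 = 0 -> W q v E1 = 0 ->
  W q (Jstr v) E1 = 0.
Proof.
move=> Bq mq H0 Wv; have := hess02_ratio v Bq mq; rewrite H0 mulr0 hess02.unlock Wv add0r.
by move=> /eqP; rewrite mulf_eq0 => /orP[|/eqP //]; rewrite eq_complex /= oner_eq0 andbF.
Qed.

(** A complex tangent vector [v] has [H q v E1 = 0], hence [ratio q v = 0]. *)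
Lemma CR_tangent_null q v : B q -> mu q = 0 -> H q E1 E1 != 0 ->
  W q v E1 = 0 -> W q (Jstr v) E1 = 0 -> forall u, W q u v = 0.
Proof.
move=> Bq mq H0 Wv WJv u; rewrite (grad_dbar_ratio u v Bq mq).
have Hv : H q v E1 = 0 by rewrite hess02.unlock Wv WJv mulr0 addr0.
have := hess02_ratio v Bq mq; rewrite Hv.
by move=> /esym/eqP; rewrite mulf_eq0 (negPf H0) orbF => /eqP ->; rewrite mul0r.
Qed.

Lemma null_CR_tangent q v : B q -> W q v E1 = 0 -> (forall u, W q u v = 0) ->
  W q (Jstr v) E1 = 0.
Proof.
move=> Bq Wv Wu; have := hess02_sym (rho_analytic Bq) v E1.
rewrite hess02.unlock Wv !Wu mulr0 !addr0 add0r.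
by move=> /eqP; rewrite mulf_eq0 => /orP[|/eqP //]; rewrite eq_complex /= oner_eq0 andbF.
Qed.

(** Take the Levi identity with [b = v], [b' = v'] along the line through [q] in the
    direction [E2].  The components on [v] and [v'] are of second order there, while
    [mu] is exactly of first order, so the value of the Levi form is O(t^2). *)
Lemma levi_second_order q v v' : B q -> mu q = 0 ->
  W q v E1 = 0 -> W q v' E1 = 0 ->
  (forall u, W q u v = 0) -> (forall u, W q u v' = 0) ->
  cder (fun z => L z v v') q E2 = 0.
Proof.
move=> Bq mq Wv Wv' Nv Nv'; have aq := rho_analytic Bq.
have w0 b : w q b = 0 by exact: (mu_zero B_open rho_analytic rho_flat rho_model Bq mq).
have aw b : canalytic (fun z => w z b) q by exact: canalytic_dbar.
have aL a b : canalytic (fun z => L z a b) q by exact: canalytic_levi.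
have L0 a : L q a v' = 0 by rewrite levi.unlock !Nv' mulr0 subr0.
have L1 : L q v E1 = 0.
  by rewrite levi.unlock Wv (null_CR_tangent Bq Wv Nv) mulr0 subr0.
have Omu : bigO 1 (fun t => mu (q + t *: E2)) by exact: (bigO_zero E2 (aw E1) (w0 E1)).
have Ov : bigO 2 (fun t => w (q + t *: E2) v).
  by apply: (bigO_zero2 (aw v)) => //; rewrite cder_dbar.
have Ov' : bigO 2 (fun t => w (q + t *: E2) v').
  by apply: (bigO_zero2 (aw v')) => //; rewrite cder_dbar.
have O1 : bigO 1 (fun t => L (q + t *: E2) v E1) by exact: (bigO_zero E2 (aL v E1) L1).
have O2 : bigO 1 (fun t => L (q + t *: E2) E1 v') by exact: (bigO_zero E2 (aL E1 v') (L0 E1)).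
have O3 : bigO 0 (fun t => L (q + t *: E2) E1 E1) by exact: (bigO_bounded E2 (aL E1 E1)).
have : bigO 4 (fun t => conjc (mu (q + t *: E2)) *
    (mu (q + t *: E2) * L (q + t *: E2) v v')).
  have := bigOD (bigOD (bigOM (bigOM (bigOJ Omu) Ov') O1) (bigOM (bigOM (bigOJ Ov) Omu) O2))
    (bigON (bigOM (bigOM (bigOJ Ov) Ov') O3)).
  apply: bigO_eq; have [e e0 He] := near_line E2 (nearB Bq).
  exists e => // t t0 te.
  have := levi_identity E1 rho_analytic rho_flat v v' (He t t0 te).
  by move=> /eqP; rewrite -subr_eq0 subr0 => /eqP I1; rewrite -[RHS]subr0 -I1; ring.
have mu1 : cder mu q E2 != 0.
  by rewrite cder_dbar -normc_gt0; have [T1 _] := transversal_ge1 rho_model Bq;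
    exact: lt_le_trans T1.
have [m' m0 low] := bigO_zero_lower (aw E1) (w0 E1) mu1.
have lowJ : exists2 e, 0 < e & forall t, 0 < t -> t < e ->
    m' * t <= normc (conjc (mu (q + t *: E2))).
  by have [e e0 He] := low; exists e => // t; rewrite normc_conj; exact: He.
move=> /(bigO_div m0 lowJ)/(bigO_div m0 low) OL.
have := bigO_line E2 (aL v v'); rewrite L0 => /bigON/(bigOD OL) Ofin.
apply: (@bigO_coef _ 1); apply: bigO_eq Ofin; exists 1 => // t _ _; ring.
Qed.

(** Antisymmetrizing removes the symmetric part [hess02] and leaves the Levi form. *)
Lemma d_dbar_second_order q v v' : B q -> mu q = 0 ->
  W q v E1 = 0 -> W q v' E1 = 0 ->
  (forall u, W q u v = 0) -> (forall u, W q u v' = 0) ->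
  cder (fun z => W z v v') q E2 = cder (fun z => W z v' v) q E2.
Proof.
move=> Bq mq Wv Wv' Nv Nv'; have aq := rho_analytic Bq.
have e1 := levi_second_order Bq mq Wv Wv' Nv Nv'.
have e2 := levi_second_order Bq mq Wv' Wv Nv' Nv.
have E a b : cder (fun z => W z a b) q E2 =
    2^-1 * (cder (fun z => L z a b) q E2 + cder (fun z => H z a b) q E2).
  rewrite -cderD; [|exact: canalytic_levi|exact: canalytic_hess02].
  rewrite -cderZ; last by apply: canalyticD; [exact: canalytic_levi|exact: canalytic_hess02].
  by congr (cder _ _ _); apply/funext => z; rewrite grad_dbarE mulrC.
rewrite !E e1 e2; congr (_ * (_ + _)); apply: cder_eq_near; last exact: canalytic_hess02.
by apply: filterS (nearB Bq) => z Bz; exact: hess02_sym (rho_analytic Bz) _ _.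
Qed.

(** Where the antiholomorphic Hessian does not vanish the complex tangent space of
    the singular set is defined by four independent real equations.  The values
    of [levi] and [hess02] on combinations of [E1] and [E2] can be prescribed
    independently, first in [b] and then in [a]. *)
Lemma CR_equations_onto q (s s' : R[i]) : B q -> mu q = 0 -> H q E1 E1 != 0 ->
  exists v, W q v E1 = s /\ W q (Jstr v) E1 = s'.
Proof.
move=> Bq mq H0; have [L21 [L11 _ _] [H21 H22] _] := rho_model Bq.
have h2 := hess02_ratio E2 Bq mq; set c := ratio q E2 in h2.
have c1 : normc c <= 1.
  have [T1 _] := transversal_ge1 rho_model Bq.
  have [_ [_ _ L22] _ _] := rho_model Bq.
  rewrite /c /ratio Normc.normcM Normc.normcV ler_pdivrMr ?mul1r ?(lt_le_trans _ T1) //.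
  apply: le_trans T1; rewrite grad_dbarE normc_half.
  by have := le_normcD (L q E2 E2) (H q E2 E2); lra.
have den : L q E2 E1 - conjc c * L q E1 E1 != 0.
  rewrite subr_eq0; apply/negP => /eqP/(congr1 (@Normc.normc _)).
  rewrite Normc.normcM normc_conj => E.
  have E' : normc c * normc (L q E1 E1) <= 1 * 2^-1.
    by apply: ler_pM; rewrite ?normc_ge0.
  exact: big_small_absurd E L21 E'.
(* the values that [levi] and [hess02] have to take *)
pose al := s - ii * s'; pose be := s + ii * s'.
have [ga gaJ] : exists ga, conjc ga = be / H q E1 E1.
  by exists (conjc (be / H q E1 E1)); rewrite conjcK.
pose b := (al - ga * L q E1 E1) / (L q E2 E1 - conjc c * L q E1 E1).
pose a := ga - b * conjc c.
exists (cscale a E1 + cscale b E2).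
have Lv : L q (cscale a E1 + cscale b E2) E1 = al.
  by rewrite levi_addl !levi_cscalel /a /b; field.
have Hv : H q (cscale a E1 + cscale b E2) E1 = be.
  rewrite hess02_addl !hess02_cscalel h2 /a conjcB conjcM conjcK gaJ.
  by field.
split; first by rewrite grad_dbarE Lv Hv /al /be; field.
rewrite grad_dbar_JE Lv Hv /al /be.
transitivity (- (ii * (ii * s'))); first by field.
by rewrite ii_mul opprK.
Qed.

End SingularSet.

(** * Consequences of the third order estimate *)

Lemma is_derive_line (R : realType) m (W : normedModType R) (f : 'rV[R]_m -> W) x u (t : R) :
  differentiable f (x + t *: u) ->
  is_derive t (1 : R) (fun s : R => f (x + s *: u)) ('d f (x + t *: u) u).
Proof.
move=> fx.
have hx : is_diff t (fun s : R => x + s *: u) (fun s => s *: u).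
  have := is_diffD (is_diff_cst x t) (is_diff_scalel t u).
  by move=> /is_diff_eq; apply; apply/funext => s; rewrite !fctE add0r.
case: hx => hd hv.
have hc : differentiable (f \o (fun s : R => x + s *: u)) t by exact: differentiable_comp.
have hder : 'd (f \o (fun s : R => x + s *: u)) t 1 = 'd f (x + t *: u) u.
  by rewrite (diff_comp hd fx) /comp hv scale1r.
split; first exact/derivable1_diffP.
by rewrite -hder -(deriveE _ hc).
Qed.

(** A third order bound kills the first derivative directly.  For the second one,
    a mean value point [s] in [(t / 2, t)] has derivative O(t^2), whereas a nonzero
    second derivative would make it of the order of [s]. *)
Lemma der2_of_cubic (R : realType) m (f : 'rV[R]_m -> R) u (C : R) : 0 <= C ->
  analytic_at f 0 ->
  (\forall z \near (0 : 'rV[R]_m), `|f z| <= C * `|z| ^+ 3) ->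
  f 0 = 0 /\ der f 0 u = 0 /\ der (fun z => der f z u) 0 u = 0.
Proof.
move=> C0 f0 fC.
have fz : f 0 = 0.
  have := nbhs_singleton fC; rewrite normr0 expr0n mulr0 => H.
  by apply/eqP; rewrite -normr_eq0 eq_le normr_ge0 H.
pose C' := C * `|u| ^+ 3; have C'0 : 0 <= C' by rewrite mulr_ge0 ?exprn_ge0.
have line : exists2 e, 0 < e & forall t : R, 0 < t -> t < e -> `|f (t *: u)| <= C' * t ^+ 3.
  have [e e0 H] := near_line u fC; exists e => // t t0 te.
  have := H t t0 te; rewrite add0r normrZ exprMn (gtr0_norm t0) /C'.
  by rewrite -mulrA [_ ^+ 3 * _]mulrC.
have df : der f 0 u = 0.
  apply: der_unique f0 => eps eps0; have [e e0 H] := line.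
  pose d := Num.min (Num.min e 1) (eps / (C' + 1)).
  have C1 : 0 < C' + 1 by exact: ltr_wpDl.
  exists d => [|t t0]; first by rewrite !lt_min e0 ltr01 divr_gt0.
  rewrite !lt_min ltr_pdivlMr // => /andP[/andP[te t1] td].
  rewrite add0r fz mulr0 !subr0; apply: le_trans (H t t0 te) _.
  have t2 : t ^+ 3 <= t * t by rewrite exprS ler_pM2l // expr2 ler_piMl // ltW.
  by apply: le_trans (ler_wpM2l C'0 t2) _; rewrite mulrA ler_pM2r //; nra.
split => //; split => //.
have fd := analytic_der u f0.
set c := der _ 0 u; apply/eqP; rewrite -normr_eq0 eq_le normr_ge0 andbT leNgt.
apply/negP => c0.
have [K [e1 [K0 e10 HK]]] := der_quadratic fd.
have [e2 e20 H2] := line.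
have [e3 e30 H3] := near_line u (analytic_near f0).
pose U := `|u| + 1; have U0 : 0 < U by exact: ltr_wpDl.
pose M := 4 * C' + K * U ^+ 2 + 1.
have U2 : 0 <= K * U ^+ 2 by apply: mulr_ge0 => //; apply: exprn_ge0; exact: ltW.
have M0 : 0 < M by rewrite /M; lra.
pose T := Num.min (Num.min (e1 / U) e2) (Num.min e3 (`|c| / (4 * M))).
have T0 : 0 < T by rewrite !lt_min e20 e30 !divr_gt0 ?mulr_gt0.
pose t := T / 2; have t0 : 0 < t by rewrite divr_gt0.
have tT : t < T by rewrite /t; lra.
move: (tT); rewrite /T !lt_min => /andP[/andP[te1 te2] /andP[te3 tc]].
have seg s : s \in `]t / 2, t[ -> 0 < s /\ s < t.
  by rewrite in_itv /= => /andP[s1 s2]; split => //; apply: lt_trans s1; rewrite divr_gt0.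
have an s : 0 < s -> s <= t -> analytic_at f (s *: u).
  by move=> s0 st; have := H3 s s0 (le_lt_trans st te3); rewrite add0r.
have dline s : 0 < s -> s <= t ->
    is_derive s (1 : R) (fun r : R => f (r *: u)) (der f (s *: u) u).
  move=> s0 st; have := @is_derive_line R m R^o f 0 u s; rewrite add0r derE.
  rewrite (_ : (fun r : R => f (0 + r *: u)) = fun r => f (r *: u)); last first.
    by apply/funext => r; rewrite add0r.
  by apply; apply: analytic_differentiable; exact: an.
have t2t : t / 2 < t by lra.
have t20 : 0 < t / 2 by rewrite divr_gt0.
have [s sin Hs] : exists2 s, s \in `]t / 2, t[ &
    f (t *: u) - f ((t / 2) *: u) = der f (s *: u) u * (t - t / 2).
  apply: (@MVT R (fun r => f (r *: u)) (fun s => der f (s *: u) u)) => //.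
    by move=> s /seg[s0 st]; apply: dline => //; exact: ltW.
  apply: continuous_in_subspaceT => s; rewrite inE /= in_itv /= => /andP[s1 s2].
  have s0 : 0 < s by exact: lt_le_trans s1.
  apply: differentiable_continuous; apply/derivable1_diffP.
  by have [] := dline s s0 s2.
have [s0 st] := seg s sin.
have s2 : t / 2 < s by move: sin; rewrite in_itv /= => /andP[].
have su : `|s *: u| < e1.
  rewrite normrZ gtr0_norm //; apply: (@le_lt_trans _ _ (s * U)).
    by rewrite ler_pM2l // /U lerDl.
  by rewrite -ltr_pdivlMr //; exact: lt_trans te1.
have := HK (s *: u) su; rewrite add0r df subr0 der_scaler -/c normrZ (gtr0_norm s0).
move=> Hq.
have b1 := H2 t t0 te2; have b2 := H2 (t / 2) t20 (lt_trans t2t te2).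
have d1 : `|der f (s *: u) u| * (t / 2) <= 2 * C' * t ^+ 3.
  have -> : `|der f (s *: u) u| * (t / 2) = `|f (t *: u) - f ((t / 2) *: u)|.
    rewrite Hs normrM; congr (_ * _).
    have -> : t - t / 2 = t / 2 by field.
    by rewrite gtr0_norm.
  apply: (le_trans (ler_normB _ _)).
  have : (t / 2) ^+ 3 <= t ^+ 3 by apply: lerXn2r; rewrite ?nnegrE ltW.
  by nra.
have d2 : `|der f (s *: u) u| <= 4 * C' * t ^+ 2.
  rewrite -(ler_pM2r t20); apply: le_trans d1 _.
  have -> // : 4 * C' * t ^+ 2 * (t / 2) = 2 * C' * t ^+ 3 by field.
have d3 : s * `|c| <= 4 * C' * t ^+ 2 + K * (t * U) ^+ 2.
  have -> : s * `|c| = `|s * c| by rewrite normrM gtr0_norm.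
  have -> : s * c = der f (s *: u) u - (der f (s *: u) u - s * c) by ring.
  apply: (le_trans (ler_normB _ _)); apply: lerD => //.
  apply: le_trans Hq _; apply: ler_wpM2l => //; apply: lerXn2r.
  - by rewrite nnegrE mulr_ge0 // ltW.
  - by rewrite nnegrE mulr_ge0 // ltW.
  - by apply: ler_pM => //; [exact: ltW|exact: ltW|rewrite /U lerDl].
have d4 : t * (`|c| / 2) <= t * (t * M).
  have : t / 2 * `|c| <= s * `|c| by rewrite ler_pM2r // ltW.
  have -> : t * (`|c| / 2) = t / 2 * `|c| by ring.
  move/le_trans; apply; apply: le_trans d3 _; rewrite /M.
  have : 0 <= t ^+ 2 by rewrite exprn_ge0 // ltW.
  by nra.
move: d4; rewrite ler_pM2l //.
move: tc; rewrite ltr_pdivlMr ?mulr_gt0 //.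
by nra.
Qed.

(** Polarization: the diagonal second derivatives determine the mixed ones. *)
Lemma cder2_of_cubic (R : realType) m (f : 'rV[R]_m -> R[i]) (C : R) : 0 <= C ->
  canalytic f 0 ->
  (\forall z \near (0 : 'rV[R]_m), normc (f z) <= C * `|z| ^+ 3) ->
  [/\ f 0 = 0, forall u, cder f 0 u = 0 &
     forall u v, cder (fun z => cder f z u) 0 v = 0].
Proof.
move=> C0 f0 fC; have [f1 f2] := f0.
have re : \forall z \near (0 : 'rV[R]_m), `|complex.Re (f z)| <= C * `|z| ^+ 3.
  by apply: filterS fC => z; apply: le_trans; exact: Re_le_normc.
have im : \forall z \near (0 : 'rV[R]_m), `|complex.Im (f z)| <= C * `|z| ^+ 3.
  by apply: filterS fC => z; apply: le_trans; exact: Im_le_normc.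
have diag u : cder (fun z => cder f z u) 0 u = 0.
  have [_ [_ r2]] := der2_of_cubic u C0 f1 re.
  have [_ [_ i2]] := der2_of_cubic u C0 f2 im.
  by apply: complex_eqP.
split.
- have [r0 _] := der2_of_cubic 0 C0 f1 re; have [i0 _] := der2_of_cubic 0 C0 f2 im.
  by apply: complex_eqP.
- move=> u; have [_ [r1 _]] := der2_of_cubic u C0 f1 re.
  by have [_ [i1 _]] := der2_of_cubic u C0 f2 im; apply: complex_eqP.
- move=> u v; have := diag (u + v).
  have -> : (fun z => cder f z (u + v)) = fun z => cder f z u + cder f z v.
    by apply/funext => z; exact: cder_addr.
  have cu := canalytic_cder u f0; have cv := canalytic_cder v f0.
  rewrite (cderD _ cu cv) !cder_addr !diag (cder_sym v u f0) add0r addr0 => /eqP.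
  by rewrite -mulr2n mulrn_eq0 /= => /eqP.
Qed.

Section Coordinates.
Variables (R : realType) (n : nat).
Implicit Types (z u v p : 'rV[R]_(n + n)) (i : 'I_n).

Lemma ccoord_add z u i : ccoord (z + u) i = ccoord z i + ccoord u i.
Proof. by apply: complex_eqP; rewrite ?ReD ?ImD /= mxE. Qed.

Lemma ccoord_scale (t : R) z i : ccoord (t *: z) i = Complex t 0 * ccoord z i.
Proof. by apply: complex_eqP; rewrite ?ReM ?ImM /= mxE; ring. Qed.

Lemma ccoord_J z i : ccoord (Jstr z) i = ii * ccoord z i.
Proof.
apply: complex_eqP; rewrite ?ReM ?ImM /= /Jstr.
  by rewrite row_mxEl !mxE; ring.
by rewrite row_mxEr !mxE; ring.
Qed.

Lemma ccoord_cscale (c : R[i]) z i : ccoord (cscale c z) i = c * ccoord z i.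
Proof.
by rewrite cscale.unlock ccoord_add !ccoord_scale ccoord_J [c in RHS]complex_split; ring.
Qed.

Lemma canalytic_ccoord i p : canalytic (fun z => ccoord z i) p.
Proof. by split; exact: analytic_coord. Qed.

Lemma cder_ccoord i p u : cder (fun z => ccoord z i) p u = ccoord u i.
Proof. by apply: complex_eqP; rewrite /= der_coord. Qed.

Lemma ccoord_delta i j : ccoord (delta_mx 0 (lshift n i) : 'rV[R]_(n + n)) j = (i == j)%:R.
Proof.
apply: complex_eqP; rewrite /= !mxE eqxx /= ?eq_lshift ?eq_rlshift.
  by rewrite eq_sym; case: eqP.
by case: eqP.
Qed.

Variables (i1 i2 : 'I_n) (eps : R[i]).
Hypothesis i12 : i1 != i2.
(** The quadratic models: type C.0 for [eps = 0] and type C.1 for [eps = 1]. *)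
Definition model z := conjc (ccoord z i1) * ccoord z i2 + eps * conjc (ccoord z i1) ^+ 2.

Lemma canalytic_model p : canalytic model p.
Proof.
have a1 := canalyticJ (canalytic_ccoord i1 p).
apply: canalyticD; first by apply: canalyticM => //; exact: canalytic_ccoord.
apply: canalyticM; first exact: canalytic_cst.
by rewrite (_ : (fun y => _) = fun y => conjc (ccoord y i1) * conjc (ccoord y i1)) //;
  exact: canalyticM.
Qed.

Lemma cder_model p u : cder model p u =
  conjc (ccoord u i1) * ccoord p i2 + conjc (ccoord p i1) * ccoord u i2 +
  eps * (2 * conjc (ccoord p i1) * conjc (ccoord u i1)).
Proof.
have a0 := canalytic_ccoord i1 p; have a1 := canalyticJ a0.
have a2 := canalytic_ccoord i2 p.
have a11 := canalyticM a1 a1.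
have -> : model = fun z => conjc (ccoord z i1) * ccoord z i2 +
  eps * (conjc (ccoord z i1) * conjc (ccoord z i1)) by [].
rewrite (cderD _ (canalyticM a1 a2) (canalyticM (canalytic_cst eps p) a11)).
rewrite (cderM _ a1 a2) (cderZ _ _ a11) (cderM _ a1 a1) (cderJ _ a0) !cder_ccoord.
ring.
Qed.

Variable rho : 'rV[R]_(n + n) -> R[i].
Hypothesis rho0 : canalytic rho 0.
Variable C : R.
Hypothesis rho_model : \forall z \near (0 : 'rV[R]_(n + n)),
  normc (rho z - model z) <= C * `|z| ^+ 3.

Let rho_diff : [/\ rho 0 = model 0, forall u, cder rho 0 u = cder model 0 u &
  forall u v, cder (fun z => cder rho z u) 0 v = cder (fun z => cder model z u) 0 v].
Proof.
have m0 := canalytic_model 0.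
have H : \forall z \near (0 : 'rV[R]_(n + n)),
    normc (rho z - model z) <= (`|C| + 1) * `|z| ^+ 3.
  apply: filterS rho_model => z /le_trans; apply; apply: ler_wpM2r.
    exact: exprn_ge0.
  by apply: le_trans (ler_norm C) _; rewrite lerDl.
have C0 : 0 <= `|C| + 1 by exact: addr_ge0.
have [d0 d1 d2] := cder2_of_cubic C0 (canalyticB rho0 m0) H.
split.
- by apply/eqP; rewrite -subr_eq0 d0.
- by move=> u; apply/eqP; rewrite -subr_eq0 -(cderB u rho0 m0) d1.
- move=> u v; apply/eqP; rewrite -subr_eq0.
  have cr := canalytic_cder u rho0; have cm := canalytic_cder u m0.
  rewrite -(cderB v cr cm) -[X in _ == X](d2 u v); apply/eqP.
  apply: cder_eq_near; last exact: canalyticB.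
  apply: filterS2 (canalytic_near rho0) (canalytic_near m0) => z rz mz.
  by rewrite (cderB u rz mz).
Qed.

Lemma graph_at_0 : rho 0 = 0.
Proof.
have [-> _ _] := rho_diff; rewrite /model.
have -> : ccoord (0 : 'rV[R]_(n + n)) i1 = 0 by apply: complex_eqP; rewrite /= mxE.
by rewrite conjc0 mul0r expr0n mulr0 addr0.
Qed.

Let coord0 i : ccoord (0 : 'rV[R]_(n + n)) i = 0.
Proof. by apply: complex_eqP; rewrite /= mxE. Qed.

Lemma dbar_at_0 u : dbar rho 0 u = 0.
Proof.
have [_ d1 _] := rho_diff.
by rewrite dbar.unlock !d1 !cder_model !coord0 conjc0; ring.
Qed.

Lemma grad_dbar_at_0 u v : grad_dbar rho 0 u v =
  2 * conjc (ccoord v i1) * ccoord u i2 +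
  4 * eps * conjc (ccoord u i1) * conjc (ccoord v i1).
Proof.
have [_ _ d2] := rho_diff.
have -> : grad_dbar rho 0 u v = cder (fun y => cder rho y v) 0 u +
    ii * cder (fun y => cder rho y (Jstr v)) 0 u.
  have cv := canalytic_cder v rho0; have cJ := canalytic_cder (Jstr v) rho0.
  rewrite grad_dbar.unlock dbar.unlock (cderD _ cv (canalyticM (canalytic_cst _ _) cJ)).
  by rewrite (cderZ _ _ cJ).
have D a : cder (fun z => cder model z a) 0 u = conjc (ccoord a i1) * ccoord u i2 +
    conjc (ccoord u i1) * ccoord a i2 + eps * (2 * conjc (ccoord u i1) * conjc (ccoord a i1)).
  pose k1 := fun z : 'rV[R]_(n + n) => conjc (ccoord a i1) * ccoord z i2.
  pose k2 := fun z : 'rV[R]_(n + n) =>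
    (ccoord a i2 + eps * (2 * conjc (ccoord a i1))) * conjc (ccoord z i1).
  have -> : (fun z => cder model z a) = fun z => k1 z + k2 z.
    by apply/funext => z; rewrite cder_model /k1 /k2; ring.
  have a0 := canalytic_ccoord i1 0; have a1 := canalyticJ a0.
  have a2 := canalytic_ccoord i2 0.
  rewrite (cderD _ (canalyticM (canalytic_cst _ _) a2) (canalyticM (canalytic_cst _ _) a1)).
  by rewrite (cderZ _ _ a2) (cderZ _ _ a1) (cderJ _ a0) !cder_ccoord; ring.
rewrite !d2 !D !ccoord_J conjcM conjc_ii.
set x := conjc (ccoord v i1); set y := ccoord u i2; set s := conjc (ccoord u i1).
set t := ccoord v i2.
transitivity (x * y + s * t + eps * (2 * s * x) - ii * (ii * (x * y)) +
  ii * (ii * (s * t)) - ii * (ii * (eps * (2 * s * x)))); first by ring.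
by rewrite !ii_mul; ring.
Qed.

Lemma levi_at_0 u v : levi rho 0 u v = 4 * conjc (ccoord v i1) * ccoord u i2.
Proof.
rewrite levi.unlock !grad_dbar_at_0 !ccoord_J conjcM conjc_ii.
set x := conjc (ccoord v i1); set y := ccoord u i2; set s := conjc (ccoord u i1).
transitivity (2 * x * y + 4 * eps * s * x - ii * (ii * (2 * x * y)) +
  ii * (ii * (4 * eps * s * x))); first by ring.
by rewrite !ii_mul; ring.
Qed.

Lemma hess02_at_0 u v :
  hess02 rho 0 u v = 8 * eps * conjc (ccoord u i1) * conjc (ccoord v i1).
Proof.
rewrite hess02.unlock !grad_dbar_at_0 !ccoord_J conjcM conjc_ii.
set x := conjc (ccoord v i1); set y := ccoord u i2; set s := conjc (ccoord u i1).
transitivity (2 * x * y + 4 * eps * s * x + ii * (ii * (2 * x * y)) -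
  ii * (ii * (4 * eps * s * x))); first by ring.
by rewrite !ii_mul; ring.
Qed.

Definition E1 : 'rV[R]_(n + n) := delta_mx 0 (lshift n i1).
Definition E2 : 'rV[R]_(n + n) := delta_mx 0 (lshift n i2).

Lemma canalytic_close (f : 'rV[R]_(n + n) -> R[i]) (d : R) : canalytic f 0 -> 0 < d ->
  \forall z \near (0 : 'rV[R]_(n + n)), normc (f z - f 0) <= d.
Proof.
move=> [f1 f2] d0; have d2 : 0 < d / 2 by rewrite divr_gt0.
have /continuous_normP/(_ _ d2) c1 := analytic_continuous f1.
have /continuous_normP/(_ _ d2) c2 := analytic_continuous f2.
apply: filterS2 c1 c2 => z h1 h2; apply: (le_trans (normc_le_ReIm _)).
rewrite ReD ImD ReN ImN -[X in X + _]normrN -[X in _ + X]normrN !opprB.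
by rewrite [d]splitr; exact: lerD.
Qed.

(** At the origin the values are [levi E2 E1 = 4] and zero for all others in the
    conditions, which are therefore open conditions satisfied there. *)
Lemma near_model_near0 : \forall z \near (0 : 'rV[R]_(n + n)), near_model rho E1 E2 [set z].
Proof.
have aL u v : canalytic (fun z => levi rho z u v) 0 by exact: canalytic_levi.
have aH u v : canalytic (fun z => hess02 rho z u v) 0 by exact: canalytic_hess02.
have h0 : 0 < 2^-1 :> R by rewrite invr_gt0.
have cE : [/\ ccoord E1 i1 = 1, ccoord E1 i2 = 0, ccoord E2 i1 = 0 & ccoord E2 i2 = 1].
  by rewrite /E1 /E2 !ccoord_delta !eqxx (negPf i12) eq_sym (negPf i12).
have [c11 c12 c21 c22] := cE.
have l21 : levi rho 0 E2 E1 = 4 by rewrite levi_at_0 c11 c22 conjc1; ring.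
have l11 : levi rho 0 E1 E1 = 0 by rewrite levi_at_0 c12; ring.
have l12 : levi rho 0 E1 E2 = 0 by rewrite levi_at_0 c12; ring.
have l22 : levi rho 0 E2 E2 = 0 by rewrite levi_at_0 c21 conjc0; ring.
have h21 : hess02 rho 0 E2 E1 = 0 by rewrite hess02_at_0 c21 conjc0; ring.
have h22 : hess02 rho 0 E2 E2 = 0 by rewrite hess02_at_0 c21 conjc0; ring.
pose k z := dbar rho z E2 * cder (fun y => levi rho y E1 E1) z E2.
have ak : canalytic k 0.
  by apply: canalyticM; [exact: canalytic_dbar|exact: canalytic_cder].
have k0 : k 0 = 0 by rewrite /k dbar_at_0 mul0r.
have n4 : normc (4 : R[i]) = 4.
  have -> : (4 : R[i]) = Complex 4 0 by apply: complex_eqP; rewrite /= ?addr0.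
  by rewrite /= expr0n /= addr0 sqrtr_sqr ger0_norm.
have C1 := canalytic_close (aL E2 E1) h0; have C2 := canalytic_close (aL E1 E1) h0.
have C3 := canalytic_close (aL E1 E2) h0; have C4 := canalytic_close (aL E2 E2) h0.
have C5 := canalytic_close (aH E2 E1) h0; have C6 := canalytic_close (aH E2 E2) h0.
have C7 := canalytic_close ak h0.
near=> z => y ->; split.
- have : normc (levi rho z E2 E1 - levi rho 0 E2 E1) <= 2^-1 by near: z.
  rewrite l21 => h; have := normcB_le (levi rho z E2 E1) (levi rho z E2 E1 - 4).
  by rewrite subKr n4; lra.
- split.
  + have : normc (levi rho z E1 E1 - levi rho 0 E1 E1) <= 2^-1 by near: z.
    by rewrite l11 subr0.
  + have : normc (levi rho z E1 E2 - levi rho 0 E1 E2) <= 2^-1 by near: z.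
    by rewrite l12 subr0.
  + have : normc (levi rho z E2 E2 - levi rho 0 E2 E2) <= 2^-1 by near: z.
    by rewrite l22 subr0.
- split.
  + have : normc (hess02 rho z E2 E1 - hess02 rho 0 E2 E1) <= 2^-1 by near: z.
    by rewrite h21 subr0.
  + have : normc (hess02 rho z E2 E2 - hess02 rho 0 E2 E2) <= 2^-1 by near: z.
    by rewrite h22 subr0.
- have : normc (k z - k 0) <= 2^-1 by near: z.
  by rewrite k0 subr0 /k Normc.normcM.
Unshelve. all: by end_near. Qed.

(** The implicit function theorem in the direction [E2]; the factor [1 / 2] turns
    the derivative of [dbar rho E1] along [cscale c E2] into [c]. *)
Lemma section_near0 : exists g : 'rV[R]_(n + n) -> R[i],
  [/\ canalytic g 0, g 0 = 0 &
    \forall z \near (0 : 'rV[R]_(n + n)),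
      dbar rho (z + cscale (g z) E2) E1 = 0 /\ (dbar rho z E1 = 0 -> g z = 0)].
Proof.
(* [f] is a multiple of [dbar rho E1] at [z + c E2], as a function of [(z, c)] *)
pose cpx (y : 'rV[R]_2) := Complex (y 0 0) (y 0 ord_max).
pose pt (x : 'rV[R]_((n + n) + 2)) := lsubmx x + cscale (cpx (rsubmx x)) E2.
pose f x := Complex 2^-1 0 * dbar rho (pt x) E1.
pose F x : 'rV[R]_2 := \row_j (if j == 0 then complex.Re (f x) else complex.Im (f x)).
have ptE x j : pt x 0 j = x 0 (lshift 2 j) + (x 0 (rshift _ 0) * E2 0 j +
    x 0 (rshift _ ord_max) * Jstr E2 0 j).
  by rewrite /pt cscale.unlock /cpx; move: E2 (Jstr E2) => a b; rewrite !mxE.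
have pt_an x : analytic_map_at pt x.
  move=> j; under eq_fun do rewrite ptE.
  by apply: analyticD; [|apply: analyticD; apply: analyticM];
    (exact: analytic_coord || exact: analytic_cst).
have pt0 : pt 0 = 0 by apply/rowP => j; rewrite ptE !mxE; ring.
have dpt h : mder pt 0 h = pt h.
  apply/rowP => j; rewrite mder_coord; under eq_fun do rewrite ptE.
  have co k : analytic_at (fun x : 'rV[R]_((n + n) + 2) => x 0 k) 0 by exact: analytic_coord.
  have cc k (c : R) := analyticM (co k) (analytic_cst c 0).
  rewrite (derD _ (co _) (analyticD (cc _ _) (cc _ _))) (derD _ (cc _ _) (cc _ _)).
  by rewrite !(derM _ (co _) (analytic_cst _ _)) !der_cst !der_coord ptE; ring.
have ad : canalytic (fun z => dbar rho z E1) 0 by exact: canalytic_dbar.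
have [af' df] : canalytic (fun x => dbar rho (pt x) E1) 0 /\ forall h,
    cder (fun x => dbar rho (pt x) E1) 0 h = grad_dbar rho 0 (pt h) E1.
  split; first by have [] := cder_comp_at 0 pt0 ad (pt_an 0).
  by move=> h; have [_ ->] := cder_comp_at h pt0 ad (pt_an 0); rewrite dpt cder_dbar.
have af : canalytic f 0 by apply: canalyticM => //; exact: canalytic_cst.
have FE0 x : F x 0 0 = complex.Re (f x) by rewrite mxE eqxx.
have FE1 x : F x 0 ord_max = complex.Im (f x) by rewrite mxE.
have two j : j = 0 \/ j = ord_max :> 'I_2.
  by case: j => [[|[|k]] hk] //; [left|right]; apply: val_inj.
have F_an : analytic_map_at F 0.
  move=> j; case: (two j) => ->.
    by under eq_fun do rewrite FE0; exact: af.1.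
  by under eq_fun do rewrite FE1; exact: af.2.
have Feq0 x : F x = 0 <-> dbar rho (pt x) E1 = 0.
  have half0 : Complex 2^-1 0 != 0 :> R[i].
    by rewrite eq_complex /= invr_eq0 pnatr_eq0.
  split=> [F0|d0].
    apply: (mulfI half0); rewrite mulr0 -/(f x); apply: complex_eqP.
      by rewrite -FE0 F0 mxE.
    by rewrite -FE1 F0 mxE.
  by apply/rowP => j; rewrite !mxE /f d0 mulr0 /=; case: ifP.
have F0 : F 0 = 0 by apply/Feq0; rewrite pt0 dbar_at_0.
have cE : ccoord E1 i1 = 1 /\ ccoord E2 i1 = 0 /\ ccoord E2 i2 = 1.
  by rewrite /E1 /E2 !ccoord_delta !eqxx eq_sym (negPf i12).
have [c11 [c21 c22]] := cE.
have dF (y : 'rV[R]_2) : cder f 0 (row_mx 0 y) = cpx y.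
  rewrite /f cderZ // df /pt row_mxKl row_mxKr add0r grad_dbar_at_0 !ccoord_cscale.
  rewrite c11 c21 c22 conjc1 mulr0 conjc0.
  by apply: complex_eqP; rewrite ?ReM ?ImM ?ReD ?ImD ?ReM ?ImM /=; field.
have [|g [g_an g0 [e [d [e0 d0 gP]]]]] := analytic_implicit F_an F0.
  move=> y j; rewrite derE; case: (two j) => ->.
    by under eq_fun do rewrite FE0; have /(congr1 (@complex.Re _)) := dF y.
  by under eq_fun do rewrite FE1; have /(congr1 (@complex.Im _)) := dF y.
exists (fun z => cpx (g z)); split.
- by split; exact: g_an.
- by rewrite g0 /cpx !mxE.
- near=> z; have ze : `|z| < e by near: z; exact: (@nbhs0_lt _ 'rV[R]_(n + n) _ e0).
  have [gd gu] := gP z ze; split.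
    have : F (row_mx z (g z)) = 0 by apply/gu.
    by move/Feq0; rewrite /pt row_mxKl row_mxKr.
  move=> mz; have : F (row_mx z 0) = 0.
    apply/Feq0; rewrite /pt row_mxKl row_mxKr.
    have -> : cpx 0 = 0 by rewrite /cpx !mxE.
    by rewrite cscale0 addr0.
  move/(gu 0); rewrite normr0 => /(_ d0) <-.
  by rewrite /cpx !mxE.
Unshelve. all: by end_near. Qed.

End Coordinates.

(** * Linear algebra and coordinates of the graph *)

Section LinearTools.
Variable R : realType.

Lemma is_derive_map m k (F : 'rV[R]_m -> 'rV[R]_k) (gamma : R -> 'rV[R]_m) (t : R) v :
  analytic_map_at F (gamma t) -> is_derive t (1 : R) gamma v ->
  is_derive t (1 : R) (fun s => F (gamma s)) (mder F (gamma t) v).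
Proof.
move=> /analytic_map_diff[dF EF] [gd gv].
have gdiff : differentiable gamma t by exact/derivable1_diffP.
have hc : differentiable (F \o gamma) t by exact: differentiable_comp.
split; first exact/derivable1_diffP.
rewrite -[fun s => _]/(F \o gamma) deriveE // (diff_comp gdiff dF) /comp EF.
by rewrite -gv deriveE.
Qed.

Lemma is_derive_unique (V : normedModType R) (f g : R -> V) (t : R) v v' :
  is_derive t (1 : R) f v -> is_derive t (1 : R) g v' ->
  (\forall s \near t, f s = g s) -> v = v'.
Proof.
move=> [fd <-] [gd <-] fg; apply: near_eq_derive => //; exact: oner_neq0.
Qed.

Lemma is_derive_linemap m (x u : 'rV[R]_m) (t : R) :
  is_derive t (1 : R) (fun s : R => x + s *: u) u.
Proof.
have := is_derive_line (f := id) (x := x) (u := u) (t := t).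
have idd : differentiable (id : 'rV[R]_m -> 'rV[R]_m) (x + t *: u) by exact: ex_diff.
by move=> /(_ idd); rewrite (mderE _ (@analytic_map_id R m _)) mder_id.
Qed.

(** A matrix for a map that carries no linear structure. *)
Definition linear_mx m k (f : 'rV[R]_m -> 'rV[R]_k) : 'M[R]_(m, k) :=
  \matrix_(i, j) f (delta_mx 0 i) 0 j.

Lemma mul_linear_mx m k (f : 'rV[R]_m -> 'rV[R]_k) v :
  (forall u u', f (u + u') = f u + f u') -> (forall t u, f (t *: u) = t *: f u) ->
  v *m linear_mx f = f v.
Proof.
move=> fD fZ; have f0 : f 0 = 0 by rewrite -(scale0r 0) fZ scale0r.
have -> : f v = \sum_i v 0 i *: f (delta_mx 0 i).
  rewrite {1}(row_sum_delta v); elim: (index_enum _) => [|i r IH]; first by rewrite !big_nil.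
  by rewrite !big_cons fD fZ IH.
apply/rowP => j; rewrite mxE summxE; apply: eq_bigr => i _.
by rewrite [RHS]mxE mxE.
Qed.

Definition mderM m k (F : 'rV[R]_m -> 'rV[R]_k) x := linear_mx (mder F x).

Lemma mul_mderM m k (F : 'rV[R]_m -> 'rV[R]_k) x v : v *m mderM F x = mder F x v.
Proof. by apply: mul_linear_mx => [u u'|t u]; [exact: mder_addr|exact: mder_scaler]. Qed.

Lemma jacobianE m k (F : 'rV[R]_m -> 'rV[R]_k) x v : analytic_map_at F x ->
  v *m 'J F x = mder F x v.
Proof. by move=> Fx; rewrite /jacobian mul_rV_lin1 mderE. Qed.

Lemma row_full_onto m k (A : 'M[R]_(m, k)) :
  (forall y : 'rV[R]_k, exists x : 'rV[R]_m, x *m A = y) -> row_full A.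
Proof.
move=> onto; rewrite -sub1mx; apply/row_subP => i.
by have [x <-] := onto (row i 1%:M); exact: submxMl.
Qed.

Lemma row_free_inj m k (A : 'M[R]_(m, k)) :
  (forall x : 'rV[R]_m, x *m A = 0 -> x = 0) -> row_free A.
Proof.
move=> inj; rewrite -kermx_eq0; apply/eqP/row_matrixP => i; rewrite row0.
by apply: inj; apply/eqP; rewrite -sub_kermx row_sub.
Qed.

Lemma has_dim_kernel_image m l k r (A : set 'rV[R]_m) (P : 'M[R]_(l, m))
    (C : 'M[R]_(l, k)) : row_free P -> \rank C = r ->
  (forall w, A w <-> exists v : 'rV[R]_l, w = v *m P /\ v *m C = 0) ->
  has_dim A (l - r).
Proof.
move=> Pfree Cr AE; have kr : \rank (kermx C) = (l - r)%N by rewrite mxrank_ker Cr.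
rewrite -kr; exists (row_base (kermx C) *m P); split.
  by rewrite /row_free mxrankMfree // eq_row_base.
move=> w; rewrite AE; split=> [[v [-> vC]]|/submxP[d ->]].
  apply: submxMr; rewrite eq_row_base; apply/sub_kermxP; exact: vC.
exists (d *m row_base (kermx C)); rewrite mulmxA; split => //.
by apply/sub_kermxP; rewrite -(eq_row_base (kermx C)) submxMl.
Qed.

Lemma has_dim_unique m (A : set 'rV[R]_m) k l : has_dim A k -> has_dim A l -> k = l.
Proof.
move=> [P [/eqP Pf PE]] [Q [/eqP Qf QE]]; rewrite -Pf -Qf.
by apply/eqP; rewrite eqn_leq; apply/andP; split; apply: mxrankS; apply/row_subP => i;
  [apply/QE/PE|apply/PE/QE]; exact: row_sub.
Qed.

Lemma submanifold_at_intro m (d k : nat) (e : (m - d)%N = k) (M : set 'rV[R]_m) p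
    (rho : 'rV[R]_m -> 'rV[R]_k) : (d <= m)%N -> M p -> analytic_map_at rho p ->
  (forall y, exists x, mder rho p x = y) -> (\forall x \near p, M x <-> rho x = 0) ->
  submanifold_at d M p.
Proof.
subst k => dm Mp rp onto near; split => //; exists rho; split => //.
by apply: row_full_onto => y; have [x <-] := onto y; exists x; rewrite jacobianE.
Qed.

Lemma complex_submanifold_at_intro N (k l : nat) (e : (N - k)%N = l)
    (M : set 'rV[R]_(N + N)) p (h : 'rV[R]_(N + N) -> 'rV[R]_(l + l)) :
  (k <= N)%N -> M p -> (\forall x \near p, analytic_map_at h x) ->
  (\forall x \near p, forall v, mder h x (Jstr v) = Jstr (mder h x v)) ->
  (forall y, exists x, mder h p x = y) -> (\forall x \near p, M x <-> h x = 0) ->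
  complex_submanifold_at k M p.
Proof.
subst l => kN Mp han hJ onto near; split => //; exists h.
have hp : analytic_map_at h p by exact: nbhs_singleton han.
split => //; last first.
  by apply: row_full_onto => y; have [x <-] := onto y; exists x; rewrite jacobianE.
split => //; apply: filterS2 han hJ => x hx hJx v.
by rewrite !mderE.
Qed.

End LinearTools.

(** The inverse of the pair of coordinates [(zpart, wpart)]. *)
HB.lock Definition emb (R : realType) n (z : 'rV[R]_(n + n)) (c : R[i]) :
    'rV[R]_(n.+1 + n.+1) :=
  row_mx (\row_i if unlift ord_max i is Some j then z 0 (lshift n j) else complex.Re c)
         (\row_i if unlift ord_max i is Some j then z 0 (rshift n j) else complex.Im c).

Section GraphCoordinates.
Variables (R : realType) (n : nat).
Implicit Types (z v : 'rV[R]_(n + n)) (c : R[i]) (y : 'rV[R]_(n.+1 + n.+1)).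

Lemma emb_lshift z c i : emb z c 0 (lshift n.+1 i) =
  if unlift ord_max i is Some j then z 0 (lshift n j) else complex.Re c.
Proof. by rewrite emb.unlock row_mxEl mxE. Qed.

Lemma emb_rshift z c i : emb z c 0 (rshift n.+1 i) =
  if unlift ord_max i is Some j then z 0 (rshift n j) else complex.Im c.
Proof. by rewrite emb.unlock row_mxEr mxE. Qed.

Lemma widen_ord_lift (j : 'I_n) : widen_ord (leqnSn n) j = lift ord_max j.
Proof. by apply: val_inj; rewrite /= /bump leqNgt ltn_ord. Qed.

Lemma zpart_emb z c : zpart (emb z c) = z.
Proof.
apply/rowP => i; rewrite /zpart; case: (split_ordP i) => j ->.
  by rewrite row_mxEl mxE emb_lshift widen_ord_lift liftK.
by rewrite row_mxEr mxE emb_rshift widen_ord_lift liftK.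
Qed.

Lemma wpart_emb z c : wpart (emb z c) = c.
Proof.
by apply: complex_eqP; rewrite /wpart /= ?emb_lshift ?emb_rshift unlift_none.
Qed.

Lemma emb_parts y : emb (zpart y) (wpart y) = y.
Proof.
apply/rowP => i; case: (split_ordP i) => j ->.
  rewrite emb_lshift; case: unliftP => [k ->|->] //.
  by rewrite /zpart row_mxEl mxE widen_ord_lift.
rewrite emb_rshift; case: unliftP => [k ->|->] //.
by rewrite /zpart row_mxEr mxE widen_ord_lift.
Qed.

Lemma zpartD y y' : zpart (y + y') = zpart y + zpart y'.
Proof.
apply/rowP => i; rewrite [RHS]mxE /zpart; case: (split_ordP i) => j ->.
  by rewrite !row_mxEl !mxE.
by rewrite !row_mxEr !mxE.
Qed.

Lemma zpart0 : zpart (0 : 'rV[R]_(n.+1 + n.+1)) = 0.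
Proof. by apply: (@addIr _ (zpart 0)); rewrite -zpartD !add0r. Qed.

Lemma wpart0 : wpart (0 : 'rV[R]_(n.+1 + n.+1)) = 0.
Proof. by apply: complex_eqP; rewrite /wpart /= mxE. Qed.

Lemma Jstr_emb z c : Jstr (emb z c) = emb (Jstr z) (ii * c).
Proof.
rewrite -[LHS]emb_parts; congr emb; last first.
  by rewrite /wpart ccoord_J -/(wpart (emb z c)) wpart_emb.
apply/rowP => i; rewrite /zpart /Jstr; case: (split_ordP i) => j ->.
  rewrite !row_mxEl mxE row_mxEl !mxE emb_rshift widen_ord_lift liftK.
  by [].
rewrite !row_mxEr mxE row_mxEr !mxE emb_lshift widen_ord_lift liftK.
by [].
Qed.

Lemma zpart_J y : zpart (Jstr y) = Jstr (zpart y).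
Proof. by rewrite -{1}(emb_parts y) Jstr_emb zpart_emb. Qed.

Lemma wpart_J y : wpart (Jstr y) = ii * wpart y.
Proof. by rewrite -{1}(emb_parts y) Jstr_emb wpart_emb. Qed.

Lemma zpart_analytic y : analytic_map_at (@zpart R n) y.
Proof.
move=> i; rewrite /zpart; case: (split_ordP i) => j ->.
  by under eq_fun do rewrite row_mxEl mxE; exact: analytic_coord.
by under eq_fun do rewrite row_mxEr mxE; exact: analytic_coord.
Qed.

Lemma mder_zpart y u : mder (@zpart R n) y u = zpart u.
Proof.
apply/rowP => i; rewrite mder_coord /zpart; case: (split_ordP i) => j ->.
  by under eq_fun do rewrite row_mxEl mxE; rewrite der_coord row_mxEl mxE.
by under eq_fun do rewrite row_mxEr mxE; rewrite der_coord row_mxEr mxE.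
Qed.

Lemma wpart_analytic y : canalytic (@wpart R n) y.
Proof. exact: canalytic_ccoord. Qed.

Lemma cder_wpart y u : cder (@wpart R n) y u = wpart u.
Proof. exact: cder_ccoord. Qed.

Section EmbeddedGraph.
Variables (m : nat) (a : 'rV[R]_m -> 'rV[R]_(n + n)) (f : 'rV[R]_m -> R[i]).

Lemma emb_analytic x : analytic_map_at a x -> canalytic f x ->
  analytic_map_at (fun x => emb (a x) (f x)) x.
Proof.
move=> ax [f1 f2] i; case: (split_ordP i) => j ->.
  under eq_fun do rewrite emb_lshift.
  by case: (unlift ord_max j) => [k|//]; exact: ax.
under eq_fun do rewrite emb_rshift.
by case: (unlift ord_max j) => [k|//]; exact: ax.
Qed.

Lemma mder_emb x u :
  mder (fun x => emb (a x) (f x)) x u = emb (mder a x u) (cder f x u).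
Proof.
apply/rowP => i; rewrite mder_coord; case: (split_ordP i) => j ->.
  under eq_fun do rewrite emb_lshift.
  rewrite emb_lshift; case: (unlift ord_max j) => [k|//].
  by rewrite mder_coord.
under eq_fun do rewrite emb_rshift.
rewrite emb_rshift; case: (unlift ord_max j) => [k|//].
by rewrite mder_coord.
Qed.

End EmbeddedGraph.

End GraphCoordinates.

(** * Tangent spaces of the graph *)

Section VectorFieldCalculus.
Variables (R : realType) (m k : nat).
Implicit Types (z u v w : 'rV[R]_m).

Lemma mder_sum_delta (F : 'rV[R]_m -> 'rV[R]_k) z v j :
  mder F z v 0 j = \sum_i v 0 i * der (fun y => F y 0 j) z (delta_mx 0 i).
Proof. by rewrite mder_coord der_sum_delta. Qed.

Lemma der_sum_fun l n (F : 'I_n -> 'rV[R]_l -> R) (x h : 'rV[R]_l) :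
  (forall i, analytic_at (F i) x) ->
  der (fun y => \sum_i F i y) x h = \sum_i der (F i) x h.
Proof.
move=> Fx; elim: (index_enum _) => [|i r IH].
  rewrite big_nil (_ : (fun y => _) = fun=> 0) ?der_cst //.
  by apply/funext => y; rewrite big_nil.
rewrite big_cons -IH (_ : (fun y => _) = fun y => F i y + \sum_(j <- r) F j y).
  rewrite derD //; elim: r {IH} => [|j r IHr].
    rewrite (_ : (fun y => _) = fun=> 0); first exact: analytic_cst.
    by apply/funext => y; rewrite big_nil.
  rewrite (_ : (fun y => _) = fun y => F j y + \sum_(j <- r) F j y).
    exact: analyticD.
  by apply/funext => y; rewrite big_cons.
by apply/funext => y; rewrite big_cons.
Qed.

Lemma analytic_map_apply (F : 'rV[R]_m -> 'rV[R]_k) (V : 'rV[R]_m -> 'rV[R]_m) z :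
  analytic_map_at F z -> analytic_map_at V z ->
  analytic_map_at (fun y => mder F y (V y)) z.
Proof.
move=> Fz Vz j; under eq_fun do rewrite mder_sum_delta.
by apply: analytic_sum => i; apply: analyticM; [exact: Vz|exact: analytic_der].
Qed.

Lemma mder_apply (F : 'rV[R]_m -> 'rV[R]_k) (V : 'rV[R]_m -> 'rV[R]_m) z u :
  analytic_map_at F z -> analytic_map_at V z ->
  mder (fun y => mder F y (V y)) z u =
  mder (fun y => mder F y (V z)) z u + mder F z (mder V z u).
Proof.
move=> Fz Vz; apply/rowP => j; rewrite [RHS]mxE !mder_coord.
under [in LHS]eq_fun do rewrite mder_sum_delta.
under [in RHS]eq_fun do rewrite mder_sum_delta.
have da i : analytic_at (fun y => der (fun y' => F y' 0 j) y (delta_mx 0 i)) z.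
  exact: analytic_der.
rewrite der_sum_fun; last by move=> i; apply: analyticM => //; exact: Vz.
rewrite der_sum_fun; last by move=> i; apply: analyticM => //; exact: analytic_cst.
rewrite [X in _ = _ + X]der_sum_delta -big_split /=; apply: eq_bigr => i _.
rewrite (derM _ (Vz i) (da i)) (derM _ (analytic_cst _ _) (da i)) der_cst mulr0 addr0.
by rewrite mder_coord [X in _ + X]mulrC.
Qed.

Lemma mder_sym (F : 'rV[R]_m -> 'rV[R]_k) z v w : analytic_map_at F z ->
  mder (fun y => mder F y v) z w = mder (fun y => mder F y w) z v.
Proof.
move=> Fz; apply/rowP => j; rewrite !mder_coord.
under [in LHS]eq_fun do rewrite mder_coord.
under [in RHS]eq_fun do rewrite mder_coord.
exact: der_sym.
Qed.

End VectorFieldCalculus.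

Section DbarField.
Variables (R : realType) (n : nat) (rho : 'rV[R]_(n + n) -> R[i]).
Implicit Types (z u v w : 'rV[R]_(n + n)).

Lemma cscaleA (N : nat) (c d : R[i]) (v : 'rV[R]_(N + N)) :
  cscale c (cscale d v) = cscale (c * d) v.
Proof.
rewrite ![in LHS]cscale.unlock Jstr_add !Jstr_scale JstrK cscale.unlock ReM ImM.
rewrite scalerBl scalerDl !scalerDr !scalerA !scalerN.
by rewrite -!addrA; congr (_ + _); rewrite [RHS]addrC -!addrA; congr (_ + _); rewrite addrC.
Qed.

Lemma canalytic_sum m l (F : 'I_l -> 'rV[R]_m -> R[i]) x :
  (forall i, canalytic (F i) x) -> canalytic (fun y => \sum_i F i y) x.
Proof.
move=> Fx; elim: (index_enum _) => [|i r IH].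
  rewrite (_ : (fun y => _) = fun=> 0); first exact: canalytic_cst.
  by apply/funext => y; rewrite big_nil.
rewrite (_ : (fun y => _) = fun y => F i y + \sum_(j <- r) F j y).
  exact: canalyticD.
by apply/funext => y; rewrite big_cons.
Qed.

Lemma cder_sum_fun m l (F : 'I_l -> 'rV[R]_m -> R[i]) (x h : 'rV[R]_m) :
  (forall i, canalytic (F i) x) ->
  cder (fun y => \sum_i F i y) x h = \sum_i cder (F i) x h.
Proof.
move=> Fx; suff [] : canalytic (fun y => \sum_i F i y) x /\
  cder (fun y => \sum_i F i y) x h = \sum_i cder (F i) x h by [].
elim: (index_enum _) => [|i r [IHc IH]].
  rewrite big_nil (_ : (fun y => _) = fun=> 0).
    by split; [exact: canalytic_cst|exact: cder_cst].
  by apply/funext => y; rewrite big_nil.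
rewrite big_cons -IH (_ : (fun y => _) = fun y => F i y + \sum_(j <- r) F j y).
  by split; [exact: canalyticD|rewrite cderD].
by apply/funext => y; rewrite big_cons.
Qed.

Lemma canalytic_near_neq0 m (f : 'rV[R]_m -> R[i]) x : canalytic f x -> f x != 0 ->
  \forall y \near x, f y != 0.
Proof.
move=> [fr fi] f0; have nb : 0 < normc (f x) / 4 by rewrite divr_gt0 // normc_gt0.
have /continuous_normP/(_ _ nb) c1 := analytic_continuous fr.
have /continuous_normP/(_ _ nb) c2 := analytic_continuous fi.
apply: filterS2 c1 c2 => y h1 h2; apply/negP => /eqP fy.
rewrite fy subr0 in h1; rewrite fy subr0 in h2.
have := normc_le_ReIm (f x).
by move: nb h1 h2; set N := normc _; lra.
Qed.

Lemma canalytic_real m (f : 'rV[R]_m -> R) x : analytic_at f x ->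
  canalytic (fun y => Complex (f y) 0) x.
Proof. by split => //=; exact: analytic_cst. Qed.

Lemma cder_real m (f : 'rV[R]_m -> R) (x h : 'rV[R]_m) :
  cder (fun y => Complex (f y) 0) x h = Complex (der f x h) 0.
Proof. by apply: complex_eqP => //=; rewrite der_cst. Qed.

(** Product rule for a field of linear forms applied to a vector field.  Linearity
    is required only near the point, since [grad_dbar] is additive in its last
    argument only where [rho] is analytic. *)
Lemma form_apply (F : 'rV[R]_(n + n) -> 'rV[R]_(n + n) -> R[i]) z u
    (V : 'rV[R]_(n + n) -> 'rV[R]_(n + n)) :
  (\forall y \near z, forall v v', F y (v + v') = F y v + F y v') ->
  (\forall y \near z, forall t v, F y (t *: v) = Complex t 0 * F y v) ->
  (forall v, canalytic (fun y => F y v) z) -> analytic_map_at V z ->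
  canalytic (fun y => F y (V y)) z /\
  cder (fun y => F y (V y)) z u =
    cder (fun y => F y (V z)) z u + F z (mder V z u).
Proof.
move=> FD FZ Fz Vz.
have Fsum : \forall y \near z, forall v,
    F y v = \sum_i Complex (v 0 i) 0 * F y (delta_mx 0 i).
  apply: filterS2 FD FZ => y yD yZ v.
  rewrite {1}(row_sum_delta v); elim: (index_enum _) => [|i r IH].
    rewrite !big_nil -(scale0r (0 : 'rV[R]_(n + n))) yZ.
    by rewrite (_ : Complex 0 0 = 0) // mul0r.
  by rewrite !big_cons yD yZ IH.
have Fsum_z := nbhs_singleton Fsum.
have ac i : canalytic (fun y => Complex (V y 0 i) 0) z.
  exact: canalytic_real.
have aS : canalytic (fun y => \sum_i Complex (V y 0 i) 0 * F y (delta_mx 0 i)) z.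
  by apply: canalytic_sum => i; exact: canalyticM.
have aS' : canalytic (fun y => \sum_i Complex (V z 0 i) 0 * F y (delta_mx 0 i)) z.
  by apply: canalytic_sum => i; apply: canalyticM => //; exact: canalytic_cst.
have E : \forall y \near z, \sum_i Complex (V y 0 i) 0 * F y (delta_mx 0 i) = F y (V y).
  by apply: filterS Fsum => y ->.
have E' : \forall y \near z, \sum_i Complex (V z 0 i) 0 * F y (delta_mx 0 i) = F y (V z).
  by apply: filterS Fsum => y ->.
split; first exact: canalytic_eq_near E aS.
rewrite -(cder_eq_near u E aS) -(cder_eq_near u E' aS').
rewrite cder_sum_fun; last by move=> i; exact: canalyticM.
rewrite cder_sum_fun; last by move=> i; apply: canalyticM => //; exact: canalytic_cst.
rewrite Fsum_z -big_split /=; apply: eq_bigr => i _.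
by rewrite (cderM _ (ac i) (Fz _)) cder_real (cderZ _ _ (Fz _)) mder_coord addrC.
Qed.

Lemma dbar_apply z u (V : 'rV[R]_(n + n) -> 'rV[R]_(n + n)) :
  canalytic rho z -> analytic_map_at V z ->
  cder (fun y => dbar rho y (V y)) z u =
    grad_dbar rho z u (V z) + dbar rho z (mder V z u).
Proof.
move=> rz Vz; rewrite -cder_dbar.
apply: (form_apply u _ _ _ Vz).2 => [||v]; last exact: canalytic_dbar.
- by apply: filterE => y v v'; exact: dbar_addr.
- by apply: filterE => y t v; exact: dbar_scaler.
Qed.

End DbarField.

Section ComplexEquations.
Variables (R : realType) (l : nat).

Definition form_mx (f : 'rV[R]_l -> R[i]) : 'M[R]_(l, 1 + 1) :=
  row_mx (\col_i complex.Re (f (delta_mx 0 i))) (\col_i complex.Im (f (delta_mx 0 i))).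

Variable f : 'rV[R]_l -> R[i].
Hypothesis fD : forall u v, f (u + v) = f u + f v.
Hypothesis fZ : forall t u, f (t *: u) = Complex t 0 * f u.

Lemma form_mxE v : v *m form_mx f =
  row_mx (const_mx (complex.Re (f v))) (const_mx (complex.Im (f v))).
Proof.
have E : f v = \sum_i Complex (v 0 i) 0 * f (delta_mx 0 i).
  rewrite {1}(row_sum_delta v); elim: (index_enum _) => [|i r IH].
    by rewrite !big_nil -(scale0r (0 : 'rV[R]_l)) fZ (_ : Complex 0 0 = 0) // mul0r.
  by rewrite !big_cons fD fZ IH.
have Re_sum : complex.Re (f v) = \sum_i v 0 i * complex.Re (f (delta_mx 0 i)).
  rewrite E; elim/big_ind2 : _ => //= [a b c d <- <-|i _]; first by rewrite ReD.
  by rewrite ReM /=; ring.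
have Im_sum : complex.Im (f v) = \sum_i v 0 i * complex.Im (f (delta_mx 0 i)).
  rewrite E; elim/big_ind2 : _ => //= [a b c d <- <-|i _]; first by rewrite ImD.
  by rewrite ImM /=; ring.
rewrite /form_mx mul_mx_row; congr row_mx; apply/matrixP => i j.
  by rewrite !mxE Re_sum; apply: eq_bigr => k _; rewrite !ord1 mxE.
by rewrite !mxE Im_sum; apply: eq_bigr => k _; rewrite !ord1 mxE.
Qed.

Lemma form_mx_eq0 v : v *m form_mx f = 0 <-> f v = 0.
Proof.
rewrite form_mxE; split=> [/(congr1 (fun A => (lsubmx A, rsubmx A)))|->].
  rewrite row_mxKl row_mxKr => -[/matrixP/(_ 0 0) + /matrixP/(_ 0 0)].
  by rewrite !mxE => r0 i0; apply: complex_eqP.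
by rewrite -[RHS]row_mx0; congr row_mx; apply/matrixP => i j; rewrite !mxE.
Qed.

Lemma form_mx_rank : (forall s, exists v, f v = s) -> \rank (form_mx f) = 2%N.
Proof.
move=> onto; apply/eqP; apply: row_full_onto => y.
have [v fv] := onto (Complex (y 0 (lshift 1 0)) (y 0 (rshift 1 0))).
exists v; rewrite form_mxE fv /= -[RHS]hsubmxK.
by congr row_mx; apply/matrixP => i j; rewrite !mxE !ord1.
Qed.

End ComplexEquations.

Section GraphManifold.
Variables (R : realType) (n : nat) (rho : 'rV[R]_(n + n) -> R[i]).
Variables (Phi Psi : 'rV[R]_(n.+1 + n.+1) -> 'rV[R]_(n.+1 + n.+1)).
Variables (M Ox Oy : set 'rV[R]_(n.+1 + n.+1)) (B : set 'rV[R]_(n + n)).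
Implicit Types (z u v : 'rV[R]_(n + n)) (x y w : 'rV[R]_(n.+1 + n.+1)).

Hypotheses (Ox_open : open Ox) (Oy_open : open Oy) (B_open : open B).
Hypothesis Phi_maps : forall x, Ox x -> Oy (Phi x) /\ Psi (Phi x) = x.
Hypothesis Psi_maps : forall y, Oy y -> Ox (Psi y) /\ Phi (Psi y) = y.
Hypothesis Phi_an : forall x, Ox x -> analytic_map_at Phi x.
Hypothesis Psi_an : forall y, Oy y -> analytic_map_at Psi y.
Hypothesis Psi_J : forall y w, Oy y -> mder Psi y (Jstr w) = Jstr (mder Psi y w).
Hypothesis M_graph : forall x, Ox x -> M x <-> wpart (Phi x) = rho (zpart (Phi x)).
Hypothesis rho_an : forall z, B z -> canalytic rho z.
Hypothesis B_Oy : forall z, B z -> Oy (emb z (rho z)).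

Definition param z := Psi (emb z (rho z)).
Definition chart x := zpart (Phi x).
Definition domain : set 'rV[R]_(n.+1 + n.+1) := [set x | Ox x /\ B (chart x)].

Lemma chart_analytic x : Ox x -> analytic_map_at chart x.
Proof.
by move=> oxx; apply: analytic_map_comp; [exact: zpart_analytic|exact: Phi_an].
Qed.

Lemma mder_chart x w : Ox x -> mder chart x w = zpart (mder Phi x w).
Proof.
move=> oxx; rewrite /chart mder_comp ?mder_zpart //; first exact: zpart_analytic.
exact: Phi_an.
Qed.

Lemma domain_open : open domain.
Proof.
rewrite openE => x [oxx Bx]; apply: filterI; first exact: open_nbhs_nbhs.
apply: (analytic_map_continuous (chart_analytic oxx)).
exact: open_nbhs_nbhs.
Qed.

Lemma domain_near x : domain x -> \forall y \near x, domain y.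
Proof. by move=> dx; apply: open_nbhs_nbhs; split => //; exact: domain_open. Qed.

Lemma B_near z : B z -> \forall y \near z, B y.
Proof. by move=> Bz; exact: open_nbhs_nbhs. Qed.

Lemma param_domain z : B z -> [/\ domain (param z), M (param z) & chart (param z) = z].
Proof.
move=> Bz; have [oy1 oy2] := Psi_maps (B_Oy Bz).
have cz : chart (param z) = z by rewrite /chart /param oy2 zpart_emb.
split=> //; first by split => //; rewrite cz.
by apply/M_graph => //; rewrite /param oy2 wpart_emb zpart_emb.
Qed.

Lemma param_chart x : domain x -> M x -> param (chart x) = x.
Proof.
move=> [oxx Bx] /(M_graph oxx) Mx; rewrite /param /chart -Mx emb_parts.
by have [] := Phi_maps oxx.
Qed.

Lemma graph_analytic z : B z -> analytic_map_at (fun z => emb z (rho z)) z.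
Proof.
by move=> Bz; apply: emb_analytic; [exact: analytic_map_id|exact: rho_an].
Qed.

Lemma param_analytic z : B z -> analytic_map_at param z.
Proof.
by move=> Bz; apply: analytic_map_comp (graph_analytic Bz); exact/Psi_an/B_Oy.
Qed.

Lemma mder_param z v : B z ->
  mder param z v = mder Psi (emb z (rho z)) (emb v (cder rho z v)).
Proof.
move=> Bz; rewrite /param (mder_comp _ (Psi_an (B_Oy Bz)) (graph_analytic Bz)).
by rewrite mder_emb mder_id.
Qed.

Lemma mder_chart_param z v : B z -> mder chart (param z) (mder param z v) = v.
Proof.
move=> Bz; have [[op _] _ _] := param_domain Bz.
rewrite -(mder_comp _ (chart_analytic op) (param_analytic Bz)).
rewrite -[RHS](mder_id z); apply: mder_eq_near.
  by apply: filterS (B_near Bz) => y /param_domain[].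
apply: analytic_map_comp (param_analytic Bz); exact: chart_analytic.
Qed.

Lemma mder_param_inj z v v' : B z -> mder param z v = mder param z v' -> v = v'.
Proof.
by move=> Bz /(congr1 (mder chart (param z))); rewrite !mder_chart_param.
Qed.

Lemma mder_Phi_Psi y w : Oy y -> mder Phi (Psi y) (mder Psi y w) = w.
Proof.
move=> oyy; have [oy1 oy2] := Psi_maps oyy; have dP := Psi_an oyy.
rewrite -(mder_comp _ (Phi_an oy1) dP) -[RHS](mder_id y); apply: mder_eq_near.
  have : \forall y' \near y, Oy y' by exact: open_nbhs_nbhs.
  by apply: filterS => y' /Psi_maps[].
by apply: analytic_map_comp dP; exact: Phi_an.
Qed.

Lemma Psi_inj y w w' : Oy y -> mder Psi y w = mder Psi y w' -> w = w'.
Proof.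
by move=> oyy /(congr1 (mder Phi (Psi y))); rewrite !mder_Phi_Psi.
Qed.

(** The Cauchy-Riemann equations in the complex direction of [v]. *)
Lemma dbar_eq0 z v : dbar rho z v = 0 <-> cder rho z (Jstr v) = ii * cder rho z v.
Proof.
rewrite dbar.unlock; split=> [/eqP|->]; last by rewrite ii_mul subrr.
rewrite addr_eq0 => /eqP ->; rewrite mulrN ii_mul opprK.
by [].
Qed.

Lemma mder_param_J z v : B z -> dbar rho z v = 0 ->
  mder param z (Jstr v) = Jstr (mder param z v).
Proof.
move=> Bz /dbar_eq0 dv; rewrite !mder_param // -Psi_J; last exact: B_Oy.
by rewrite Jstr_emb dv.
Qed.

(** A complex tangent vector of the graph lies over a null vector of [dbar rho]. *)
Lemma param_J_inv z v v' : B z -> mder param z v = Jstr (mder param z v') ->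
  v = Jstr v' /\ dbar rho z v' = 0.
Proof.
move=> Bz; rewrite !mder_param // -Psi_J; last exact: B_Oy.
move=> /(Psi_inj (B_Oy Bz)); rewrite Jstr_emb => E.
have Ev : v = Jstr v' by rewrite -(zpart_emb v (cder rho z v)) E zpart_emb.
split => //; apply/dbar_eq0; rewrite -Ev.
by rewrite -(wpart_emb v (cder rho z v)) E wpart_emb.
Qed.

Lemma curve_continuous (V : normedModType R) (gamma : R -> V) (d : V) :
  is_derive (0 : R) (1 : R) gamma d -> {for (0 : R), continuous gamma}.
Proof.
by move=> [gd _]; apply: differentiable_continuous; exact/derivable1_diffP.
Qed.

Section Subset.
Variables (X : set 'rV[R]_(n.+1 + n.+1)) (Sigma : set 'rV[R]_(n + n)).
Hypothesis XE : forall x, domain x -> X x <-> M x /\ Sigma (chart x).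

(** Curves in [X] and curves in [Sigma] correspond under [chart] and [param]. *)
Lemma tangent_image z w : B z ->
  tangent_space X (param z) w <->
  exists v, tangent_space Sigma z v /\ w = mder param z v.
Proof.
move=> Bz; have [dz Mz cz] := param_domain Bz; split.
  move=> [gamma [g0 gX gd]].
  have gc := curve_continuous gd.
  have gdom : \forall t \near (0 : R), domain (gamma t).
    by apply: gc; rewrite g0; exact: domain_near.
  have chg : analytic_map_at chart (gamma 0) by rewrite g0; apply: chart_analytic; case: dz.
  have dd := is_derive_map chg gd; rewrite g0 in dd.
  exists (mder chart (param z) w); split.
    exists (fun t => chart (gamma t)); split => //; first by rewrite g0.
    by apply: filterS2 gX gdom => t Xt /XE H; case: (H.1 Xt).
  have Bc : analytic_map_at param (chart (gamma 0)).
    by rewrite g0 cz; exact: param_analytic.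
  have dd2 := is_derive_map Bc dd; rewrite g0 cz in dd2.
  apply: is_derive_unique gd dd2 _.
  apply: filterS2 gX gdom => t Xt dt; have [Mt _] := (XE dt).1 Xt.
  by rewrite param_chart.
move=> [v [[delta [d0 dS dd]] ->]].
exists (fun t => param (delta t)); split; first by rewrite d0.
  have dB : \forall t \near (0 : R), B (delta t).
    by apply: (curve_continuous dd); rewrite d0; exact: B_near.
  apply: filterS2 dS dB => t St Bt; have [dt Mt ct] := param_domain Bt.
  by apply/XE => //; rewrite ct.
have pa : analytic_map_at param (delta 0) by rewrite d0; exact: param_analytic.
by have := is_derive_map pa dd; rewrite d0.
Qed.

Lemma Tc_image z w : B z ->
  (forall v, tangent_space Sigma z v -> tangent_space Sigma z (- v)) ->
  Tc X (param z) w <-> exists v, [/\ w = mder param z v, tangent_space Sigma z v,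
    tangent_space Sigma z (Jstr v) & dbar rho z v = 0].
Proof.
move=> Bz Topp; split.
  move=> [/(tangent_image _ Bz)[v [Tv ->]] [w' /(tangent_image _ Bz)[v' [Tv' ->]]]].
  move=> /esym /(param_J_inv Bz)[Ev dv']; exists v; split => //.
    by rewrite Ev JstrK; exact: Topp.
  by rewrite Ev dbar_J dv' mulr0.
move=> [v [-> Tv TJv dv]]; split; first by apply/(tangent_image _ Bz); exists v.
exists (mder param z (- Jstr v)).
  by apply/(tangent_image _ Bz); exists (- Jstr v); split => //; exact: Topp.
by rewrite mder_oppr mder_param_J // Jstr_opp JstrK opprK.
Qed.

End Subset.

Lemma tangent_setT z v : tangent_space (setT : set 'rV[R]_(n + n)) z v.
Proof.
exists (fun t : R => z + t *: v); split; first by rewrite scale0r addr0.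
  exact: filterE.
exact: is_derive_linemap.
Qed.

Lemma Tc_M z w : B z -> Tc M (param z) w <->
  exists v, w = mder param z v /\ dbar rho z v = 0.
Proof.
move=> Bz; have ME x : domain x -> M x <-> M x /\ setT (chart x) by split => // -[].
rewrite (Tc_image ME) //; last by move=> v _; exact: tangent_setT.
split=> [[v [-> _ _ dv]]|[v [-> dv]]]; exists v => //.
by split => //; exact: tangent_setT.
Qed.

Lemma paramM_free z : B z -> row_free (mderM param z).
Proof.
move=> Bz; apply: row_free_inj => v; rewrite mul_mderM => H.
apply: (mder_param_inj Bz); rewrite H.
by rewrite -(scale0r (0 : 'rV[R]_(n + n))) mder_scaler scale0r.
Qed.

Lemma dbar_onto z b (s : R[i]) : dbar rho z b != 0 -> exists v, dbar rho z v = s.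
Proof.
move=> b0; exists (cscale (conjc (s / dbar rho z b)) b).
by rewrite dbar_cscale conjcK divfK.
Qed.

Lemma Tc_M_dim z b : B z -> dbar rho z b != 0 -> has_dim (Tc M (param z)) (n + n - 2).
Proof.
move=> Bz b0; apply: (@has_dim_kernel_image R _ _ _ _ _ (mderM param z)
  (form_mx (dbar rho z)) (paramM_free Bz)).
  apply: form_mx_rank => [u v|t u|s]; first exact: dbar_addr.
    exact: dbar_scaler.
  exact: dbar_onto b0.
move=> w; rewrite Tc_M //; split=> -[v [-> dv]]; exists v; rewrite mul_mderM; split => //.
  by apply/form_mx_eq0 => // [u u'|t u]; [exact: dbar_addr|exact: dbar_scaler].
by move/form_mx_eq0 : dv => H; apply: H => [u u'|t u]; [exact: dbar_addr|exact: dbar_scaler].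
Qed.

Lemma Tc_M_dim_singular z : B z -> (forall b, dbar rho z b = 0) ->
  has_dim (Tc M (param z)) (n + n).
Proof.
move=> Bz d0; rewrite -[X in has_dim _ X]subn0.
apply: (@has_dim_kernel_image R _ _ _ _ _ (mderM param z)
  (0 : 'M[R]_(n + n, 1)) (paramM_free Bz)); first exact: mxrank0.
move=> w; rewrite Tc_M //; split=> -[v [-> dv]]; exists v; rewrite mul_mderM; split => //.
exact: mulmx0.
Qed.

Lemma param_CR z b : B z -> dbar rho z b != 0 -> CR_points M (param z).
Proof.
move=> Bz b0; have [dz Mz cz] := param_domain Bz; split => //.
exists (n + n - 2)%N.
have dcont : \forall y \near z, dbar rho y b != 0.
  by apply: canalytic_near_neq0 b0; exact: canalytic_dbar (rho_an Bz) b.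
have dcont' : nbhs (chart (param z)) [set y | dbar rho y b != 0] by rewrite cz.
have chc : \forall x \near param z, dbar rho (chart x) b != 0.
  exact: (analytic_map_continuous (chart_analytic dz.1) dcont').
apply: filterS2 (domain_near dz) chc => x dx bx Mx.
by rewrite -(param_chart dx Mx); apply: (Tc_M_dim _ bx); case: dx.
Qed.

(** Sections of the complex tangent bundle of the graph are the images of null fields
    of [dbar rho]; the fields [conj (dbar rho b) v - conj (dbar rho v) b] are null,
    analytic, and proportional to [v] at a point where [v] is null.  The bracket
    of two of them is null exactly when the exterior derivative of [dbar rho]
    vanishes on the pair. *)
Lemma flat_graph_of_Levi_flat : Levi_flat M -> flat_graph rho B.
Proof.
move=> flat z v v' Bz [b b0] dv dv'; have rz := rho_an Bz.
have [dz Mz cz] := param_domain Bz.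
pose field v0 z0 := cscale (conjc (dbar rho z0 b)) v0 + cscale (- conjc (dbar rho z0 v0)) b.
have field_dbar v0 z0 : dbar rho z0 (field v0 z0) = 0.
  by rewrite /field dbar_addr !dbar_cscale conjcN !conjcK; ring.
have field_an v0 : analytic_map_at (field v0) z.
  move=> j; rewrite /field cscale.unlock.
  have ab := canalyticJ (canalytic_dbar rz b).
  have av := canalyticN (canalyticJ (canalytic_dbar rz v0)).
  under eq_fun do rewrite !mxE.
  by apply: analyticD; apply: analyticD; apply: analyticM;
    (exact: analytic_cst || exact: ab.1 || exact: ab.2 || exact: av.1 || exact: av.2).
have key v0 v1 : dbar rho z v0 = 0 -> dbar rho z v1 = 0 ->
    grad_dbar rho z (field v0 z) (field v1 z) = grad_dbar rho z (field v1 z) (field v0 z).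
  move=> d0 d1.
  pose push v0 z0 := mder param z0 (field v0 z0).
  pose X v0 x := push v0 (chart x).
  have push_an u : analytic_map_at (push u) z.
    by apply: analytic_map_apply => //; exact: param_analytic.
  have X_an u : analytic_map_at (X u) (param z).
    have pc : analytic_map_at (push u) (chart (param z)) by rewrite cz.
    exact: (analytic_map_comp pc (chart_analytic dz.1)).
  have X_sec u : Tc_section_at M (param z) (X u).
    split => //; apply: filterS (domain_near dz) => x dx Mx.
    rewrite -{1}(param_chart dx Mx); apply/Tc_M; first by case: dx.
    by exists (field u (chart x)).
  have := flat _ (param_CR Bz b0) _ _ (X_sec v0) (X_sec v1).
  have DX u u' : 'D_(X u (param z)) (X u') (param z) =
      mder (push u') z (field u z).
    have Xz u0 : X u0 (param z) = push u0 z by rewrite /X cz.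
    rewrite deriveE_mder // Xz.
    have pz : analytic_map_at (push u') (chart (param z)) by rewrite cz.
    rewrite (mder_comp _ pz (chart_analytic dz.1)) cz.
    by rewrite /push mder_chart_param.
  have Dpush u u' : mder (push u') z (field u z) =
      mder (fun z0 => mder param z0 (field u' z)) z (field u z) +
      mder param z (mder (field u') z (field u z)).
    by rewrite /push mder_apply //; exact: param_analytic.
  rewrite /lie_bracket !DX !Dpush.
  rewrite (mder_sym (field v1 z) (field v0 z)); last exact: param_analytic.
  rewrite opprD addrACA subrr add0r -mder_oppr -mder_addr.
  move=> /(Tc_M _ Bz)[u [/(mder_param_inj Bz) Eu du]].
  have e1 := dbar_apply (field v0 z) rz (field_an v1).
  have e0 := dbar_apply (field v1 z) rz (field_an v0).
  have z1 u0 : (fun z0 => dbar rho z0 (field u0 z0)) = fun=> 0.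
    by apply/funext => z0; exact: field_dbar.
  rewrite z1 cder_cst in e1; rewrite z1 cder_cst in e0.
  apply/eqP; rewrite -subr_eq0 -oppr_eq0 -du -Eu dbar_addr dbar_oppr.
  apply/eqP; move: e0 e1 => /esym/eqP + /esym/eqP.
  by rewrite !addr_eq0 => /eqP -> /eqP ->; ring.
(* at [z] the field of a null vector is a multiple of it; start from the right one *)
have b0' : conjc (dbar rho z b) != 0 by rewrite conjc_eq0.
pose v0 := cscale (conjc (dbar rho z b))^-1 v; pose v1 := cscale (conjc (dbar rho z b))^-1 v'.
have d0 : dbar rho z v0 = 0 by rewrite /v0 dbar_cscale dv mulr0.
have d1 : dbar rho z v1 = 0 by rewrite /v1 dbar_cscale dv' mulr0.
have := key v0 v1 d0 d1; rewrite /field d0 d1 conjc0 oppr0 cscale0 !addr0.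
by rewrite /v0 /v1 !cscaleA !mulfV // !cscale1.
Qed.

End GraphManifold.

(** * Pairs of complex equations *)

Section PairOfEquations.
Variable R : realType.
Implicit Types a b : R[i].

(** Two complex numbers as a point of C^2, in the coordinates of [Jstr]. *)
Definition cpair a b : 'rV[R]_((1 + 1) + (1 + 1)) :=
  row_mx (row_mx (const_mx (complex.Re a)) (const_mx (complex.Re b)))
         (row_mx (const_mx (complex.Im a)) (const_mx (complex.Im b))).

Lemma cpair_inj a b a' b' : cpair a b = cpair a' b' -> a = a' /\ b = b'.
Proof.
move=> /eq_row_mx[/eq_row_mx[/rowP/(_ 0) + /rowP/(_ 0)]].
rewrite !mxE => r1 r2 /eq_row_mx[/rowP/(_ 0) + /rowP/(_ 0)].
by rewrite !mxE => i1 i2; split; exact: complex_eqP.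
Qed.

Lemma cpair0 : cpair 0 0 = 0.
Proof.
have E : const_mx 0 = 0 :> 'rV[R]_1 by apply/rowP => i; rewrite !mxE.
by rewrite /cpair /= E !row_mx0.
Qed.

Lemma cpair_eq0 a b : cpair a b = 0 <-> a = 0 /\ b = 0.
Proof.
by split=> [|[-> ->]]; [rewrite -cpair0; exact: cpair_inj|exact: cpair0].
Qed.

Lemma cpairD a b a' b' : cpair (a + a') (b + b') = cpair a b + cpair a' b'.
Proof.
rewrite /cpair !add_row_mx.
by congr (row_mx (row_mx _ _) (row_mx _ _)); apply/matrixP => i j; rewrite !mxE ?ReD ?ImD.
Qed.

Lemma cpairZ t a b : cpair (Complex t 0 * a) (Complex t 0 * b) = t *: cpair a b.
Proof.
rewrite /cpair !scale_row_mx.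
congr (row_mx (row_mx _ _) (row_mx _ _)); apply/matrixP => i j;
  by rewrite !mxE ?ReM ?ImM /=; ring.
Qed.

Lemma cpair_onto (y : 'rV[R]_((1 + 1) + (1 + 1))) : exists a b, y = cpair a b.
Proof.
exists (Complex (y 0 (lshift 2 (lshift 1 0))) (y 0 (rshift 2 (lshift 1 0)))).
exists (Complex (y 0 (lshift 2 (rshift 1 0))) (y 0 (rshift 2 (rshift 1 0)))).
apply/rowP => i; rewrite /cpair.
case: (split_ordP i) => j ->; rewrite ?row_mxEl ?row_mxEr;
  case: (split_ordP j) => k ->; rewrite ?row_mxEl ?row_mxEr mxE /=;
  by rewrite (ord1 k).
Qed.

Lemma Jstr_cpair a b : Jstr (cpair a b) = cpair (ii * a) (ii * b).
Proof.
rewrite /Jstr /cpair row_mxKl row_mxKr opp_row_mx.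
congr (row_mx (row_mx _ _) (row_mx _ _)); apply/matrixP => i j;
  by rewrite !mxE ?ReM ?ImM /=; ring.
Qed.

Lemma cpair_analytic m (f h : 'rV[R]_m -> R[i]) x : canalytic f x -> canalytic h x ->
  analytic_map_at (fun y => cpair (f y) (h y)) x.
Proof.
move=> [f1 f2] [h1 h2] i; rewrite /cpair.
case: (split_ordP i) => j ->; case: (split_ordP j) => k ->;
  by under eq_fun do rewrite ?row_mxEl ?row_mxEr ?row_mxEl ?row_mxEr mxE.
Qed.

Lemma mder_cpair m (f h : 'rV[R]_m -> R[i]) x u :
  mder (fun y => cpair (f y) (h y)) x u = cpair (cder f x u) (cder h x u).
Proof.
apply/rowP => i; rewrite mder_coord /cpair.
case: (split_ordP i) => j ->; case: (split_ordP j) => k ->;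
  under eq_fun do rewrite ?row_mxEl ?row_mxEr ?row_mxEl ?row_mxEr mxE;
  by rewrite ?row_mxEl ?row_mxEr ?row_mxEl ?row_mxEr mxE.
Qed.

Lemma curve_zero_der m (f : 'rV[R]_m -> R[i]) (gamma : R -> 'rV[R]_m) x v :
  gamma 0 = x -> canalytic f x -> is_derive (0 : R) (1 : R) gamma v ->
  (\forall t \near (0 : R), f (gamma t) = 0) -> cder f x v = 0.
Proof.
move=> <- fx dg f0.
have d1 := is_derive_map (cpair_analytic fx fx) dg.
have d2 : is_derive (0 : R) (1 : R) (fun=> cpair 0 0) 0 by exact: is_derive_cst.
have E : \forall t \near (0 : R), cpair (f (gamma t)) (f (gamma t)) = cpair 0 0.
  by apply: filterS f0 => t ->.
have := is_derive_unique d1 d2 E.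
by rewrite mder_cpair => /cpair_eq0[].
Qed.

End PairOfEquations.

(** * The CR singular set *)

Section SingularManifold.
Variables (R : realType) (n : nat) (rho : 'rV[R]_(n + n) -> R[i]).
Variables (Phi Psi : 'rV[R]_(n.+1 + n.+1) -> 'rV[R]_(n.+1 + n.+1)).
Variables (M Ox Oy : set 'rV[R]_(n.+1 + n.+1)) (B : set 'rV[R]_(n + n)).
Variables (E1 E2 : 'rV[R]_(n + n)) (g : 'rV[R]_(n + n) -> R[i]).
Implicit Types (z u v : 'rV[R]_(n + n)) (x y w : 'rV[R]_(n.+1 + n.+1)).

Hypothesis n_ge2 : (2 <= n)%N.
Hypotheses (Ox_open : open Ox) (Oy_open : open Oy) (B_open : open B).
Hypothesis Phi_maps : forall x, Ox x -> Oy (Phi x) /\ Psi (Phi x) = x.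
Hypothesis Psi_maps : forall y, Oy y -> Ox (Psi y) /\ Phi (Psi y) = y.
Hypothesis Phi_an : forall x, Ox x -> analytic_map_at Phi x.
Hypothesis Psi_an : forall y, Oy y -> analytic_map_at Psi y.
Hypothesis Phi_J : forall x w, Ox x -> mder Phi x (Jstr w) = Jstr (mder Phi x w).
Hypothesis Psi_J : forall y w, Oy y -> mder Psi y (Jstr w) = Jstr (mder Psi y w).
Hypothesis M_graph : forall x, Ox x -> M x <-> wpart (Phi x) = rho (zpart (Phi x)).
Hypothesis rho_an : forall z, B z -> canalytic rho z.
Hypothesis B_Oy : forall z, B z -> Oy (emb z (rho z)).
Hypothesis M_flat : Levi_flat M.
Hypothesis rho_model : near_model rho E1 E2 B.
Hypothesis g_an : forall z, B z -> canalytic g z.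
Hypothesis g_section : forall z, B z -> dbar rho (z + cscale (g z) E2) E1 = 0.
Hypothesis g_zero : forall z, B z -> dbar rho z E1 = 0 -> g z = 0.

Local Notation W := (grad_dbar rho).
Local Notation H := (hess02 rho).
Local Notation mu := (fun z => dbar rho z E1).
Local Notation param := (param rho Psi).
Local Notation chart := (chart Phi).
Local Notation domain := (domain Phi Ox B).
Local Notation S := (CR_singular_set M).
Local Notation iota := (retract E2 g).
Local Notation Sigma := [set z | mu z = 0].

Let rho_flat : flat_graph rho B.
Proof.
exact: (flat_graph_of_Levi_flat Ox_open Oy_open B_open Phi_maps Psi_maps Phi_an
  Psi_an Psi_J M_graph rho_an B_Oy M_flat).
Qed.

Let mu_zero z : B z -> mu z = 0 -> forall b, dbar rho z b = 0.
Proof. exact: (mu_zero B_open rho_an rho_flat rho_model). Qed.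

Let param_domain z (Bz : B z) := param_domain Psi_maps M_graph B_Oy Bz.
Let param_chart x (dx : domain x) (Mx : M x) := param_chart Phi_maps M_graph dx Mx.
Let param_an z (Bz : B z) := param_analytic Psi_an rho_an B_Oy Bz.
Let chart_an x (ox : Ox x) := chart_analytic Phi_an ox.
Let domain_near x (dx : domain x) := domain_near Ox_open B_open Phi_an dx.
Let tangent_vanish f z v (Bz : B z) (mz : mu z = 0) (fz : canalytic f z) :=
  tangent_zero B_open rho_an rho_model g_an g_section g_zero (v := v) Bz mz fz.

Lemma param_dense z : B z -> mu z = 0 -> forall P, (\forall x \near param z, P x) ->
  exists z', [/\ B z', P (param z') & mu z' != 0].
Proof.
move=> Bz mz P Pz.
have near_P : \forall z' \near z, B z' /\ P (param z').
  apply: filterI; first exact: open_nbhs_nbhs.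
  exact: (analytic_map_continuous (param_an Bz) Pz).
have [e e0 He] := near_line E2 near_P.
have am : canalytic mu z by apply: canalytic_dbar; exact: rho_an.
have m1 : cder mu z E2 != 0.
  rewrite cder_dbar -normc_gt0; have [T1 _] := transversal_ge1 rho_model Bz.
  exact: lt_le_trans T1.
have [c c0 [d d0 Hd]] := bigO_zero_lower am mz m1.
pose t := Num.min e d / 2.
have md : 0 < Num.min e d by rewrite lt_min e0 d0.
have t0 : 0 < t by rewrite divr_gt0.
have tm : t < Num.min e d by rewrite ltr_pdivrMr // ltr_pMr // ltr1n.
have [te td] : t < e /\ t < d by split; apply: (lt_le_trans tm); rewrite ge_min lexx ?orbT.
have [By Py] := He t t0 te; exists (z + t *: E2); split => //.
by rewrite -normc_gt0; apply: lt_le_trans (Hd t t0 td); exact: mulr_gt0.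
Qed.

(** At a zero of [mu] the complex tangent space of [M] has dimension [2 n], and at
    points nearby where [mu] is not zero only [2 n - 2]. *)
Lemma singularE x : domain x -> S x <-> M x /\ Sigma (chart x).
Proof.
move=> dx; have Bx : B (chart x) by case: dx.
split=> [[Mx nCR]|[Mx mx]].
  split => //; apply/eqP; apply: contra_notT nCR => m0.
  have := param_CR Ox_open Oy_open B_open Phi_maps Psi_maps Phi_an Psi_an Psi_J M_graph
    rho_an B_Oy Bx m0.
  by rewrite param_chart.
split => // -[_ [k Hk]].
have px := param_chart dx Mx.
have d0 : \forall q \near param (chart x), M q -> has_dim (Tc M q) k by rewrite px.
have [z' [By Hy my]] := param_dense Bx mx d0.
have My : M (param z') by have [] := param_domain By.
have k1 := has_dim_unique (Hy My)
  (Tc_M_dim Ox_open Oy_open B_open Phi_maps Psi_maps Phi_an Psi_an Psi_J M_graph rho_an B_Oy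
    By my).
have k2 : has_dim (Tc M (param (chart x))) k by rewrite px; exact: nbhs_singleton Hk Mx.
have k3 := has_dim_unique k2
  (Tc_M_dim_singular Ox_open Oy_open B_open Phi_maps Psi_maps Phi_an Psi_an Psi_J M_graph
    rho_an B_Oy Bx (mu_zero Bx mx)).
by move: k1; rewrite k3; lia.
Qed.

Lemma param_singular z : B z -> mu z = 0 -> S (param z).
Proof.
move=> Bz mz; have [dz Mz cz] := param_domain Bz.
by apply/singularE => //; rewrite cz.
Qed.

(** A null vector is the velocity of the retraction of a straight line. *)
Lemma tangent_Sigma z v : B z -> mu z = 0 -> tangent_space Sigma z v <-> W z v E1 = 0.
Proof.
move=> Bz mz; split=> [[gamma [g0 gS dg]]|Wv].
  rewrite -cder_dbar; apply: (curve_zero_der g0) dg gS.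
  by apply: canalytic_dbar; exact: rho_an.
have iz : iota z = z := retract_id E2 g_zero Bz mz.
have ia := retract_analytic E2 g_an Bz.
have dl := is_derive_linemap z v 0.
exists (fun t => iota (z + t *: v)); split.
- by rewrite scale0r addr0.
- have nB : nbhs (z + (0 : R) *: v) B by rewrite scale0r addr0; exact: open_nbhs_nbhs.
  have : \forall t \near (0 : R), B (z + t *: v) := curve_continuous dl nB.
  by apply: filterS => t Bt; exact: g_section.
- have ia' : analytic_map_at iota (z + (0 : R) *: v) by rewrite scale0r addr0.
  have := is_derive_map ia' dl; rewrite scale0r addr0 (mder_retract E2 g_an _ Bz).
  rewrite (tangent_section B_open rho_an rho_model g_an g_section g_zero Bz mz Wv).
  by rewrite cscale0 addr0.
Qed.

(** Above the singular locus [dbar rho] is zero, so [param] is complex linear there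
    and the complex tangent vectors of the two sets correspond. *)
Lemma Tc_S z w : B z -> mu z = 0 -> Tc S (param z) w <->
  exists v, [/\ w = mder param z v, W z v E1 = 0 & W z (Jstr v) E1 = 0].
Proof.
move=> Bz mz.
have opp v : tangent_space Sigma z v -> tangent_space Sigma z (- v).
  move=> /(tangent_Sigma _ Bz mz) Wv; apply/(tangent_Sigma _ Bz mz).
  by rewrite grad_dbar_oppl Wv oppr0.
rewrite (Tc_image Ox_open Oy_open B_open Phi_maps Psi_maps Phi_an Psi_an Psi_J
  M_graph rho_an B_Oy singularE w Bz opp).
split=> [[v [-> /(tangent_Sigma _ Bz mz) Tv /(tangent_Sigma _ Bz mz) TJv _]]|[v [-> Wv WJv]]];
  exists v; split => //; [exact/(tangent_Sigma _ Bz mz)|exact/(tangent_Sigma _ Bz mz)|].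
exact: mu_zero.
Qed.

(** * Equations of the singular set *)

Lemma mder_Phi_onto x w : Ox x -> exists w', mder Phi x w' = w.
Proof.
move=> ox; have [oy xE] := Phi_maps ox; exists (mder Psi (Phi x) w).
by rewrite -{1}xE (mder_Phi_Psi Oy_open Psi_maps Phi_an Psi_an).
Qed.

Lemma section_zero z : B z -> g z = 0 <-> mu z = 0.
Proof.
move=> Bz; split=> [gz|]; last exact: g_zero.
by have := g_section Bz; rewrite gz cscale0 addr0.
Qed.

Let chart_comp (f : 'rV[R]_(n + n) -> R[i]) x : Ox x -> canalytic f (chart x) ->
  canalytic (fun y => f (chart y)) x /\
  forall w, cder (fun y => f (chart y)) x w = cder f (chart x) (zpart (mder Phi x w)).
Proof.
move=> ox fx; split; first exact: (canalytic_comp fx (chart_an ox)).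
by move=> w; rewrite (cder_comp _ fx (chart_an ox)) (mder_chart Phi_an _ ox).
Qed.

Let wpart_Phi x : Ox x -> canalytic (fun y => wpart (Phi y)) x /\
  forall w, cder (fun y => wpart (Phi y)) x w = wpart (mder Phi x w).
Proof.
move=> ox; have wa := wpart_analytic (Phi x); split.
  exact: (canalytic_comp wa (Phi_an ox)).
by move=> w; rewrite (cder_comp _ wa (Phi_an ox)) cder_wpart.
Qed.

(** Where the equations below are analytic. *)
Definition regular_point x := domain x /\ B (iota (chart x)).

(** The equations [g = 0, w = f z] for any [f] that agrees with [rho] on the
    singular locus. *)
Section Equations.
Variable f : 'rV[R]_(n + n) -> R[i].
Hypothesis f_an : forall z, B z -> B (iota z) -> canalytic f z.
Hypothesis f_rho : forall z, B z -> mu z = 0 -> f z = rho z.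

Definition equations x := cpair (g (chart x)) (wpart (Phi x) - f (chart x)).

Lemma equations_analytic x : regular_point x -> analytic_map_at equations x.
Proof.
move=> [[ox Bx] Bi]; have [ga _] := chart_comp ox (g_an Bx).
have [fa _] := chart_comp ox (f_an Bx Bi); have [wa _] := wpart_Phi ox.
by apply: cpair_analytic => //; exact: canalyticB.
Qed.

Lemma mder_equations x w : regular_point x -> mder equations x w =
  cpair (cder g (chart x) (zpart (mder Phi x w)))
    (wpart (mder Phi x w) - cder f (chart x) (zpart (mder Phi x w))).
Proof.
move=> [[ox Bx] Bi]; have [_ gd] := chart_comp ox (g_an Bx).
have [fa fd] := chart_comp ox (f_an Bx Bi); have [wa wd] := wpart_Phi ox.
by rewrite /equations mder_cpair gd cderB // fd wd.
Qed.

Lemma equations_onto x : regular_point x -> S x -> forall c, exists w, mder equations x w = c.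
Proof.
move=> gx Sx c; have [dx _] := gx; have [ox Bx] := dx.
have [_ mx] := (singularE dx).1 Sx.
have [a [b ->]] := cpair_onto c; pose v := cscale (- a) E2.
have [w Ew] := mder_Phi_onto (emb v (b + cder f (chart x) v)) ox.
exists w; rewrite mder_equations // Ew zpart_emb wpart_emb addrK.
by rewrite (cder_section_E2 B_open rho_an rho_model g_an g_section g_zero) // opprK.
Qed.

Lemma equations_zero x : domain x -> S x <-> equations x = 0.
Proof.
move=> dx; have [ox Bx] := dx; rewrite (singularE dx) cpair_eq0 (section_zero Bx).
have ME := M_graph ox; split=> [[/ME Mx mx]|[mx /eqP]].
  by split => //; rewrite f_rho // -/(chart x) Mx subrr.
by rewrite subr_eq0 f_rho // => /eqP/ME.
Qed.

End Equations.

Lemma regular_point_near x : domain x -> S x -> \forall y \near x, regular_point y.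
Proof.
move=> dx Sx; have [_ mx] := (singularE dx).1 Sx; have [ox Bx] := dx.
apply: filterI; first exact: domain_near.
exact: (analytic_map_continuous (chart_an ox) (retract_near E2 B_open g_an g_zero Bx mx)).
Qed.

Lemma singular_submanifold (X : set 'rV[R]_(n.+1 + n.+1)) x : domain x -> X x ->
  (\forall y \near x, X y <-> S y) -> submanifold_at (2 * n - 2) X x.
Proof.
move=> dx Xx XS; have Sx : S x by apply/(nbhs_singleton XS).
have gn := regular_point_near dx Sx; have gx := nbhs_singleton gn.
have e : (n.+1 + n.+1 - (2 * n - 2))%N = (2 + 2)%N by lia.
have ra z : B z -> B (iota z) -> canalytic rho z by move=> Bz _; exact: rho_an.
apply: (submanifold_at_intro e (rho := equations rho)) => //.
- by lia.
- exact: equations_analytic.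
- exact: equations_onto.
- by apply: filterS2 XS gn => y -> [dy _]; exact: equations_zero.
Qed.

(** * The complex case *)

(** [mder iota] maps onto the tangent space of the singular locus, a complex space
    transverse to the complex line of [E2]; both images of [Jstr v] in it have the
    same component along [v]. *)
Lemma section_J z v : B z -> B (iota z) -> H (iota z) E1 E1 = 0 ->
  cder g z (Jstr v) = ii * cder g z v.
Proof.
move=> Bz Bi H0; have mi : mu (iota z) = 0 by exact: g_section.
have T u := retract_tangent B_open rho_an g_an g_section u Bz Bi.
have TJ := tangent_complex B_open rho_an rho_flat rho_model g_an g_section g_zero Bi mi H0
  (T v).
have TD := T (Jstr v); rewrite !(mder_retract E2 g_an _ Bz) in TJ TD.
rewrite Jstr_add Jstr_cscale in TJ.
apply/eqP; rewrite -subr_eq0; apply/eqP; apply: (transversal_inj rho_model Bi).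
rewrite cscaleD cscaleN grad_dbar_addl grad_dbar_oppl.
apply/eqP; rewrite subr_eq0; apply/eqP/(addrI (W (iota z) (Jstr v) E1)).
by rewrite -!grad_dbar_addl TD TJ.
Qed.

Lemma rho_retract_an z : B z -> B (iota z) -> canalytic (fun z => rho (iota z)) z.
Proof. by move=> Bz Bi; exact: (canalytic_comp (rho_an Bi) (retract_analytic E2 g_an Bz)). Qed.

(** On the singular locus [rho] satisfies the Cauchy-Riemann equations, and the
    retraction is holomorphic. *)
Lemma rho_retract_J z v : B z -> B (iota z) -> H (iota z) E1 E1 = 0 ->
  cder (fun z => rho (iota z)) z (Jstr v) = ii * cder (fun z => rho (iota z)) z v.
Proof.
move=> Bz Bi H0; have ia := retract_analytic E2 g_an Bz.
have mi : mu (iota z) = 0 by exact: g_section.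
rewrite !(cder_comp _ (rho_an Bi) ia) !(mder_retract E2 g_an _ Bz) section_J //.
rewrite -Jstr_cscale -Jstr_add; apply/dbar_eq0; exact: mu_zero.
Qed.

(** With [g] and [rho o iota] holomorphic the equations [g = 0, w = rho (iota z)]
    define a complex submanifold. *)
Lemma singular_complex x : domain x -> S x ->
  (\forall y \near x, S y -> H (chart y) E1 E1 = 0) -> complex_submanifold_at (n - 1) S x.
Proof.
move=> dx Sx H0; have [Mx mx] := (singularE dx).1 Sx; have [ox Bx] := dx.
have px := param_chart dx Mx.
have H1 : \forall z \near chart x, B z -> mu z = 0 -> H z E1 E1 = 0.
  have H0' : \forall y \near param (chart x), S y -> H (chart y) E1 E1 = 0 by rewrite px.
  have : \forall z \near chart x, S (param z) -> H (chart (param z)) E1 E1 = 0.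
    exact: (analytic_map_continuous (param_an Bx) H0').
  apply: filterS => z Hz Bz mz; have [_ _ cz] := param_domain Bz.
  by rewrite -cz; apply: Hz; exact: param_singular.
have H2 : \forall z \near chart x, B (iota z) -> mu (iota z) = 0 -> H (iota z) E1 E1 = 0.
  have H1' : nbhs (iota (chart x)) [set z | B z -> mu z = 0 -> H z E1 E1 = 0].
    by rewrite (retract_id E2 g_zero Bx mx).
  exact: (analytic_map_continuous (retract_analytic E2 g_an Bx) H1').
have gn := regular_point_near dx Sx; have gx := nbhs_singleton gn.
have H3 : \forall y \near x, regular_point y -> H (iota (chart y)) E1 E1 = 0.
  have : \forall y \near x, B (iota (chart y)) -> mu (iota (chart y)) = 0 ->
      H (iota (chart y)) E1 E1 = 0 by exact: (analytic_map_continuous (chart_an ox) H2).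
  apply: filterS => y Hy [[_ By] Bi].
  by apply: Hy => //; exact: g_section.
have e : (n.+1 - (n - 1))%N = 2%N by lia.
pose f z := rho (iota z).
have f_an z : B z -> B (iota z) -> canalytic f z by exact: rho_retract_an.
have f_rho z : B z -> mu z = 0 -> f z = rho z.
  by move=> Bz mz; rewrite /f (retract_id E2 g_zero Bz mz).
apply: (complex_submanifold_at_intro e (h := equations f)) => //.
- by lia.
- by apply: filterS gn => y; exact: equations_analytic.
- apply: filterS2 gn H3 => y gy /(_ gy) Hy w; have [[oy By] Bi] := gy.
  rewrite !(mder_equations f_an _ gy) (Phi_J _ oy) zpart_J wpart_J Jstr_cpair.
  by rewrite section_J // rho_retract_J // mulrBr.
- exact: equations_onto.
- by apply: filterS gn => y [dy _]; exact: equations_zero.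
Qed.

(** * The CR case *)

Lemma Tc_S_dim z : B z -> mu z = 0 -> H z E1 E1 != 0 ->
  has_dim (Tc S (param z)) (2 * (n - 2)).
Proof.
move=> Bz mz H0.
pose C := linear_mx (fun v => cpair (W z v E1) (W z (Jstr v) E1)).
have CE v : v *m C = cpair (W z v E1) (W z (Jstr v) E1).
  apply: mul_linear_mx => [u u'|t u]; first by rewrite Jstr_add !grad_dbar_addl cpairD.
  by rewrite Jstr_scale !grad_dbar_scalel cpairZ.
have -> : (2 * (n - 2))%N = (n + n - 4)%N by lia.
have P_free := paramM_free B_open Psi_maps Phi_an Psi_an M_graph rho_an
  B_Oy Bz.
apply: (has_dim_kernel_image (C := C) P_free).
  apply/eqP; apply: row_full_onto => y; have [a [b ->]] := cpair_onto y.
  have [v [v1 v2]] := CR_equations_onto B_open rho_an rho_flat rho_model g_an g_section g_zero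
    a b Bz mz H0.
  by exists v; rewrite CE v1 v2.
move=> w; rewrite (Tc_S w Bz mz); split=> -[v].
  move=> [-> Wv WJv]; exists v; rewrite mul_mderM CE Wv WJv; split => //.
  exact: cpair0.
rewrite mul_mderM CE => -[-> /cpair_eq0[Wv WJv]].
by exists v.
Qed.

Section LeviMap.
Variable z0 : 'rV[R]_(n + n).
Implicit Types X Y : 'rV[R]_(n.+1 + n.+1) -> 'rV[R]_(n.+1 + n.+1).
Hypotheses (Bz0 : B z0) (mz0 : mu z0 = 0) (H0 : H z0 E1 E1 != 0).

(** The vector field on the coordinate space that represents a section of the
    complex tangent bundle of the singular set. *)
Definition pullback X z := mder chart (param z) (X (param z)).

Lemma pullback_section X : Tc_section_at S (param z0) X ->
  [/\ analytic_map_at (pullback X) z0,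
      analytic_map_at (fun z => X (param z)) z0 &
      \forall z \near z0, [/\ B z, H z E1 E1 != 0 & mu z = 0 ->
        [/\ X (param z) = mder param z (pullback X z), W z (pullback X z) E1 = 0 &
            forall u, W z u (pullback X z) = 0]]].
Proof.
move=> [Xa XT]; have [dz _ _] := param_domain Bz0; have pa := param_an Bz0.
have Xp : analytic_map_at (fun z => X (param z)) z0 by exact: (analytic_map_comp Xa pa).
split => //.
  have ox : Ox (param z0) by case: dz.
  have Va : analytic_map_at (fun x => mder chart x (X x)) (param z0).
    by apply: analytic_map_apply => //; exact: chart_an.
  exact: (analytic_map_comp Va pa).
have XT' : \forall z \near z0, S (param z) -> Tc S (param z) (X (param z)).
  exact: (analytic_map_continuous pa XT).
have nB : \forall z \near z0, B z by exact: open_nbhs_nbhs.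
have nH : \forall z \near z0, H z E1 E1 != 0.
  by apply: (canalytic_near_neq0 (f := fun z => H z E1 E1)) H0;
    apply: canalytic_hess02; exact: rho_an.
apply: filterS3 XT' nB nH => z Tz Bz Hz; split => // mz.
have [v [Xv Wv WJv]] := (Tc_S _ Bz mz).1 (Tz (param_singular Bz mz)).
have Vv : pullback X z = v.
  rewrite /pullback Xv.
  exact: (mder_chart_param B_open Psi_maps Phi_an Psi_an M_graph rho_an B_Oy).
rewrite Vv; split => //.
exact: (CR_tangent_null B_open rho_an rho_flat rho_model g_an g_section g_zero Bz mz Hz Wv WJv).
Qed.

(** The section and the image of its coordinate field agree only on the singular
    set, but the derivative is taken in a direction tangent to it. *)
Lemma derive_section X Y : Tc_section_at S (param z0) X -> Tc_section_at S (param z0) Y ->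
  'D_(X (param z0)) Y (param z0) =
  mder (fun z => mder param z (pullback Y z0)) z0 (pullback X z0) +
  mder param z0 (mder (pullback Y) z0 (pullback X z0)).
Proof.
move=> XT YT; have [_ _ /nbhs_singleton[_ _ /(_ mz0)[Xz WX _]]] := pullback_section XT.
have [Va Ya nY] := pullback_section YT; have pa := param_an Bz0.
rewrite (deriveE_mder _ YT.1) Xz -(mder_comp _ YT.1 pa) -(mder_apply _ pa Va).
have Fa : analytic_map_at (fun z => mder param z (pullback Y z)) z0.
  exact: analytic_map_apply.
apply/rowP => j; rewrite !mder_coord.
have da : canalytic (fun z => Complex (Y (param z) 0 j - mder param z (pullback Y z) 0 j) 0) z0.
  by apply: canalytic_real; apply: analyticB; [exact: Ya|exact: Fa].
have := tangent_vanish (v := pullback X z0) Bz0 mz0 da _ WX.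
have dn : \forall z \near z0, mu z = 0 ->
    Complex (Y (param z) 0 j - mder param z (pullback Y z) 0 j) 0 = 0.
  by apply: filterS nY => z [_ _ Hz] /Hz[-> _ _]; rewrite subrr.
move=> /(_ dn); rewrite cder_real => /(congr1 (@complex.Re R)) /=.
rewrite (derD _ (Ya j) (analyticN (Fa j))) (derN _ (Fa j)).
by move=> /eqP; rewrite subr_eq0 => /eqP.
Qed.

(** The bracket lies over [b = D_V V' - D_V' V].  Differentiating [W E2 V' = 0] and
    [W E2 V = 0] along the singular locus expresses [W E2 b] by the derivative
    along [E2] of the exterior derivative of [dbar rho] on the pair, which is zero.
    Hence [ratio] kills [b], which is tangent for a similar reason. *)
Lemma singular_Levi_flat : Levi_map_vanishes_at S (param z0).
Proof.
move=> X Y XT YT.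
have [Va _ nX] := pullback_section XT; have [Va' _ nY] := pullback_section YT.
rewrite /lie_bracket (derive_section XT YT) (derive_section YT XT).
set V := pullback X in Va nX *; set V' := pullback Y in Va' nY *.
rewrite (mder_sym (V z0) (V' z0)); last exact: param_an.
rewrite opprD addrACA subrr add0r -mder_oppr -mder_addr.
have [_ _ /(_ mz0)[_ WV NV]] := nbhs_singleton nX.
have [_ _ /(_ mz0)[_ WV' NV']] := nbhs_singleton nY.
set b := _ - _; have rz := rho_an Bz0.
(* the product rule for a form that vanishes on a field along the singular locus,
   in a direction tangent to this locus *)
have vanish (G : 'rV[R]_(n + n) -> 'rV[R]_(n + n) -> R[i])
    (F : 'rV[R]_(n + n) -> 'rV[R]_(n + n)) v :
    (\forall z \near z0, forall u u', G z (u + u') = G z u + G z u') ->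
    (\forall z \near z0, forall t u, G z (t *: u) = Complex t 0 * G z u) ->
    (forall u, canalytic (fun z => G z u) z0) -> analytic_map_at F z0 ->
    (\forall z \near z0, mu z = 0 -> G z (F z) = 0) -> W z0 v E1 = 0 ->
    G z0 (mder F z0 v) = - cder (fun z => G z (F z0)) z0 v.
  move=> GD GZ Ga Fa GF Wv; have [fa fd] := form_apply v GD GZ Ga Fa.
  have := tangent_vanish Bz0 mz0 fa GF Wv; rewrite fd => /eqP.
  by rewrite addrC addr_eq0 => /eqP.
have aw u : canalytic (fun z => dbar rho z u) z0 by exact: canalytic_dbar.
have aW u u' : canalytic (fun z => W z u u') z0 by exact: canalytic_grad_dbar.
have W_sym u v u' : cder (fun z => W z u u') z0 v = cder (fun z => W z v u') z0 u.
  under eq_fun do rewrite -cder_dbar.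
  under [in RHS]eq_fun do rewrite -cder_dbar.
  exact: cder_sym.
have W_V u : \forall z \near z0, mu z = 0 -> W z u (V z) = 0.
  by apply: filterS nX => z [_ _ Hz] /Hz[_ _ ->].
have W_V' u : \forall z \near z0, mu z = 0 -> W z u (V' z) = 0.
  by apply: filterS nY => z [_ _ Hz] /Hz[_ _ ->].
have nB : \forall z \near z0, B z by exact: open_nbhs_nbhs.
have E2b : W z0 E2 b = 0.
  have scaleW z t u : B z -> W z E2 (t *: u) = Complex t 0 * W z E2 u.
    move=> Bz; rewrite -cscale_real (grad_dbar_cscaler (rho_an Bz)).
    by congr (_ * _); apply: complex_eqP; rewrite //= oppr0.
  have GD : \forall z \near z0, forall u u', W z E2 (u + u') = W z E2 u + W z E2 u'.
    by apply: filterS nB => z Bz u u'; exact: grad_dbar_addr (rho_an Bz) _ _ _.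
  have GZ : \forall z \near z0, forall t u, W z E2 (t *: u) = Complex t 0 * W z E2 u.
    by apply: filterS nB => z Bz t u; exact: scaleW.
  rewrite /b (grad_dbar_addr rz) -[- mder _ _ _]scaleN1r scaleW //.
  rewrite (vanish _ _ _ GD GZ (aW E2) Va' (W_V' E2) WV).
  rewrite (vanish _ _ _ GD GZ (aW E2) Va (W_V E2) WV').
  rewrite (W_sym E2) (W_sym E2 (V' z0)).
  rewrite (d_dbar_second_order B_open rho_an rho_flat rho_model Bz0 mz0 WV WV' NV NV').
  have -> : Complex (-1) 0 = -1 :> R[i] by apply: complex_eqP; rewrite //= oppr0.
  by rewrite mulN1r opprK addNr.
have Nb u : W z0 u b = 0.
  rewrite (grad_dbar_ratio B_open rho_an rho_flat rho_model g_an g_section g_zero u b Bz0 mz0).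
  by rewrite /ratio E2b !mul0r.
have E1b : W z0 b E1 = 0.
  have GD : \forall z \near z0, forall u u', W z (u + u') E1 = W z u E1 + W z u' E1.
    by apply: filterE => z u u'; exact: grad_dbar_addl.
  have GZ : \forall z \near z0, forall t u, W z (t *: u) E1 = Complex t 0 * W z u E1.
    by apply: filterE => z t u; exact: grad_dbar_scalel.
  have nV : \forall z \near z0, mu z = 0 -> W z (V z) E1 = 0.
    by apply: filterS nX => z [_ _ Hz] /Hz[].
  have nV' : \forall z \near z0, mu z = 0 -> W z (V' z) E1 = 0.
    by apply: filterS nY => z [_ _ Hz] /Hz[].
  have aW1 u : canalytic (fun z => W z u E1) z0 by exact: aW.
  rewrite /b grad_dbar_addl grad_dbar_oppl.
  rewrite (vanish (fun z u => W z u E1) _ _ GD GZ aW1 Va' nV' WV).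
  rewrite (vanish (fun z u => W z u E1) _ _ GD GZ aW1 Va nV WV').
  by rewrite (W_sym (V' z0)) opprK addNr.
apply/(Tc_S _ Bz0 mz0); exists b; split => //.
exact: (null_CR_tangent rho_an Bz0 E1b Nb).
Qed.

End LeviMap.

Lemma hess02_near x : domain x -> H (chart x) E1 E1 != 0 ->
  \forall y \near x, domain y /\ H (chart y) E1 E1 != 0.
Proof.
move=> dx Hx; have [ox Bx] := dx; apply: filterI; first exact: domain_near.
have Ha : canalytic (fun z => H z E1 E1) (chart x) by apply: canalytic_hess02; exact: rho_an.
exact: (analytic_map_continuous (chart_an ox) (canalytic_near_neq0 Ha Hx)).
Qed.

Lemma singular_CR_Levi_flat x : domain x -> S x -> H (chart x) E1 E1 != 0 ->
  CR_Levi_flat_at (2 * n - 2) (n - 2) S x.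
Proof.
move=> dx Sx Hx; have near_x := hess02_near dx Hx.
have at_param y : S y -> domain y -> [/\ param (chart y) = y, B (chart y) & mu (chart y) = 0].
  move=> Sy dy; have [My my] := (singularE dy).1 Sy; split => //; first exact: param_chart.
  by case: dy.
have dimS y : S y -> domain y -> H (chart y) E1 E1 != 0 -> has_dim (Tc S y) (2 * (n - 2)).
  by move=> Sy dy Hy; have [py By my] := at_param y Sy dy; rewrite -py; exact: Tc_S_dim.
split.
- by apply: singular_submanifold => //; exact: filterE.
- split; last exact: dimS.
  split => //; exists (2 * (n - 2))%N.
  by apply: filterS near_x => y [dy Hy] Sy; exact: dimS.
- apply: filterS near_x => y [dy Hy] [Sy _]; have [py By my] := at_param y Sy dy; rewrite -py.
  exact: singular_Levi_flat.
Qed.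

(** The open dense part of the singular set is where [H E1 E1] is not zero or is
    locally zero. *)
Lemma singular_generic : exists D : set 'rV[R]_(n.+1 + n.+1),
  [/\ D `<=` S `&` domain, exists V, open V /\ D = S `&` domain `&` V,
      S `&` domain `<=` closure D &
      forall p, D p -> CR_Levi_flat_at (2 * n - 2) (n - 2) S p \/
        complex_submanifold_at (n - 1) S p].
Proof.
pose P := [set x | domain x /\ H (chart x) E1 E1 != 0].
pose Z := [set x | S x -> H (chart x) E1 E1 = 0].
exists (S `&` domain `&` (P `|` interior Z)); split.
- by move=> x [].
- exists (P `|` interior Z); split => //; apply: openU; last exact: open_interior.
  by rewrite openE => x [dx Hx]; exact: hess02_near.
- move=> x [Sx dx] A Ax.
  (* either some point of [A] has [H E1 E1 != 0], or this function is locally zero *)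
  have [[y [[Ay dy] Sy Hy]]|none] := pselect
    (exists y, [/\ (A `&` domain) y, S y & H (chart y) E1 E1 != 0]).
    by exists y; split => //; split => //; left.
  exists x; split; last exact: nbhs_singleton Ax.
  split => //; right; apply: filterS2 Ax (domain_near dx) => y Ay dy Sy.
  by apply/eqP/negPn/negP => Hy; apply: none; exists y.
- move=> x [[Sx dx] [[_ Hx]|Zx]]; first by left; exact: singular_CR_Levi_flat.
  by right; exact: singular_complex.
Qed.

Lemma singular_submanifold_domain : submanifold (2 * n - 2) (S `&` domain).
Proof.
move=> x [Sx dx]; apply: singular_submanifold => //.
by apply: filterS (domain_near dx) => y dy; split=> [[]|].
Qed.

End SingularManifold.

(** * Conclusion *)

Lemma open_analytic_preimage (R : realType) m k (F : 'rV[R]_m -> 'rV[R]_k)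
    (A : set 'rV[R]_m) (A' : set 'rV[R]_k) : open A -> open A' ->
  (forall x, A x -> analytic_map_at F x) -> open [set x | A x /\ A' (F x)].
Proof.
move=> Ao A'o FA; rewrite openE => x [Ax A'x]; apply: filterI.
  exact: open_nbhs_nbhs.
apply: (analytic_map_continuous (FA x Ax)); exact: open_nbhs_nbhs.
Qed.

(** The domains are shrunk so that the coordinate changes are mutually inverse
    between open sets, over which all the conditions near the origin hold. *)
Lemma form_structure (R : realType) (n : nat) (i1 i2 : 'I_n) (eps : R[i])
    (M : set 'rV[R]_(n.+1 + n.+1)) :
  (2 <= n)%N -> i1 != i2 -> Levi_flat M -> has_form (model i1 i2 eps) M ->
  let S := CR_singular_set M in
  (exists U : set 'rV[R]_(n.+1 + n.+1),
    [/\ open U, (S `&` U) 0, submanifold (2 * n - 2) (S `&` U) &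
      exists D : set 'rV[R]_(n.+1 + n.+1),
        [/\ D `<=` S `&` U,
            exists V, open V /\ D = S `&` U `&` V,
            S `&` U `<=` closure D &
            forall p, D p ->
              CR_Levi_flat_at (2 * n - 2) (n - 2) S p \/
              complex_submanifold_at (n - 1) S p]]) /\
  (eps != 0 -> CR_Levi_flat_at (2 * n - 2) (n - 2) S 0).
Proof.
move=> n2 i12 M_flat [Phi [Psi [rho [[Phi0 [Phi_hol Psi_hol] PsiK PhiK] rho0 [C rho_C] M_eq]]]].
have ra0 : canalytic rho 0 by [].
have [g [ga0 g0 g_near]] := section_near0 i12 ra0 rho_C.
have r0 := graph_at_0 ra0 rho_C.
pose Gx := interior [set x | [/\ analytic_map_at Phi x,
  forall v, 'd Phi x (Jstr v) = Jstr ('d Phi x v), Psi (Phi x) = x &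
  M x <-> wpart (Phi x) = rho (zpart (Phi x))]].
pose Gy := interior [set y | [/\ analytic_map_at Psi y,
  forall v, 'd Psi y (Jstr v) = Jstr ('d Psi y v) & Phi (Psi y) = y]].
pose Gz := interior [set z | [/\ canalytic rho z, near_model rho (E1 R i1) (E2 R i2) [set z],
  canalytic g z & dbar rho (z + cscale (g z) (E2 R i2)) (E1 R i1) = 0 /\
    (dbar rho z (E1 R i1) = 0 -> g z = 0)]].
have Gx0 : Gx 0.
  have [Pa PJ] := Phi_hol; have Pn := analytic_map_near Pa.
  by near=> x; split; near: x.
have Gy0 : Gy 0.
  have [Pa PJ] := Psi_hol; have Pn := analytic_map_near Pa.
  by near=> y; split; near: y.
have Gz0 : Gz 0.
  have rn := canalytic_near ra0; have gn := canalytic_near ga0.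
  have mn := near_model_near0 i12 ra0 rho_C.
  by near=> z; split; near: z.
have GxP x : Gx x -> _ := @interior_subset _ _ x.
have GyP y : Gy y -> _ := @interior_subset _ _ y.
have GzP z : Gz z -> _ := @interior_subset _ _ z.
pose Ox := [set x | Gx x /\ Gy (Phi x)]; pose Oy := [set y | Gy y /\ Gx (Psi y)].
pose B := [set z | Gz z /\ Oy (emb z (rho z))].
have Ox_open : open Ox.
  by apply: open_analytic_preimage; [exact: open_interior|exact: open_interior|move=> x /GxP[]].
have Oy_open : open Oy.
  by apply: open_analytic_preimage; [exact: open_interior|exact: open_interior|move=> y /GyP[]].
have B_open : open B.
  apply: open_analytic_preimage => //; first exact: open_interior.
  by move=> z /GzP[rz _ _ _]; apply: emb_analytic; [exact: analytic_map_id|].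
have Phi_maps x : Ox x -> Oy (Phi x) /\ Psi (Phi x) = x.
  by move=> [/[dup] Gxx /GxP[_ _ E _] Gy']; rewrite /Oy /= E.
have Psi_maps y : Oy y -> Ox (Psi y) /\ Phi (Psi y) = y.
  by move=> [/[dup] Gyy /GyP[_ _ E] Gx']; rewrite /Ox /= E.
have Phi_an x : Ox x -> analytic_map_at Phi x by move=> [/GxP[]].
have Psi_an y : Oy y -> analytic_map_at Psi y by move=> [/GyP[]].
have Phi_J x w : Ox x -> mder Phi x (Jstr w) = Jstr (mder Phi x w).
  by move=> [/GxP[a J _ _] _]; rewrite -!mderE.
have Psi_J y w : Oy y -> mder Psi y (Jstr w) = Jstr (mder Psi y w).
  by move=> [/GyP[a J _] _]; rewrite -!mderE.
have M_graph x : Ox x -> M x <-> wpart (Phi x) = rho (zpart (Phi x)) by move=> [/GxP[]].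
have rho_an z : B z -> canalytic rho z by move=> [/GzP[]].
have B_Oy z : B z -> Oy (emb z (rho z)) by case.
have rho_model : near_model rho (E1 R i1) (E2 R i2) B.
  by move=> z [/GzP[_ /(_ z erefl) rz _ _] _].
have g_an z : B z -> canalytic g z by move=> [/GzP[]].
have g_section z : B z -> dbar rho (z + cscale (g z) (E2 R i2)) (E1 R i1) = 0.
  by move=> [/GzP[_ _ _ []]].
have g_zero z : B z -> dbar rho z (E1 R i1) = 0 -> g z = 0 by move=> [/GzP[_ _ _ []]].
have emb0 : emb (0 : 'rV[R]_(n + n)) 0 = 0 by rewrite -[RHS]emb_parts zpart0 wpart0.
have Psi0 : Psi 0 = 0 by rewrite -{1}Phi0; have [] := GxP _ Gx0.
have O0 : Ox 0 by split; rewrite ?Phi0.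
have O'0 : Oy 0 by split; rewrite ?Psi0.
have B0 : B 0 by split; rewrite // r0 emb0.
have c0 : chart Phi 0 = 0 by rewrite /chart Phi0 zpart0.
have d0 : domain Phi Ox B 0 by split; rewrite ?c0.
have M0 : M 0 by apply/M_graph; rewrite ?Phi0 ?wpart0 ?zpart0 ?r0.
have S0 : CR_singular_set M 0.
  apply/(singularE n2 Ox_open Oy_open B_open Phi_maps Psi_maps Phi_an Psi_an Psi_J M_graph
    rho_an B_Oy M_flat rho_model d0); split => //=.
  by rewrite c0; exact: (dbar_at_0 ra0 rho_C).
move=> S; split.
  exists (domain Phi Ox B); split.
  - exact: domain_open.
  - by split.
  - exact: (singular_submanifold_domain n2 Ox_open Oy_open B_open Phi_maps Psi_maps Phi_an
      Psi_an Psi_J M_graph rho_an B_Oy M_flat rho_model g_an g_section g_zero).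
  - exact: (singular_generic n2 Ox_open Oy_open B_open Phi_maps Psi_maps Phi_an Psi_an Phi_J
      Psi_J M_graph rho_an B_Oy M_flat rho_model g_an g_section g_zero).
move=> eps0.
apply: (singular_CR_Levi_flat n2 Ox_open Oy_open B_open Phi_maps Psi_maps Phi_an
      Psi_an Psi_J M_graph rho_an B_Oy M_flat rho_model g_an g_section g_zero d0 S0).
rewrite c0 (hess02_at_0 ra0 rho_C) /E1 !ccoord_delta !eqxx conjc1 !mulr1.
by rewrite mulf_neq0 // pnatr_eq0.
Unshelve. all: by end_near. Qed.

Theorem corollary8p1 (R : realType) (n : nat) (hn : (2 <= n)%N)
    (M : set 'rV[R]_(n.+1 + n.+1))
    (hM : submanifold (2 * n) M)
    (hsing : CR_singular_set M !=set0)
    (hflat : Levi_flat M)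
    (htype : type_C1 hn M \/ type_C0 hn M) :
  let S := CR_singular_set M in
  (exists U : set 'rV[R]_(n.+1 + n.+1),
    [/\ open U, (S `&` U) 0, submanifold (2 * n - 2) (S `&` U) &
      exists D : set 'rV[R]_(n.+1 + n.+1),
        [/\ D `<=` S `&` U,
            exists V, open V /\ D = S `&` U `&` V,
            S `&` U `<=` closure D &
            forall p, D p ->
              CR_Levi_flat_at (2 * n - 2) (n - 2) S p \/
              complex_submanifold_at (n - 1) S p]]) /\
  (type_C1 hn M -> CR_Levi_flat_at (2 * n - 2) (n - 2) S 0).
Proof.
pose i1 := Ordinal (ltnW hn); pose i2 := Ordinal hn.
have i12 : i1 != i2 by [].
have C1 : type_C1 hn M -> has_form (model i1 i2 1) M.
  rewrite /type_C1; congr (has_form _ M); apply/funext => z.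
  by rewrite /model mul1r.
have C0 : type_C0 hn M -> has_form (model i1 i2 0) M.
  rewrite /type_C0; congr (has_form _ M); apply/funext => z.
  by rewrite /model mul0r addr0.
split.
  case: htype => [/C1|/C0] F; first exact: (form_structure hn i12 hflat F).1.
  exact: (form_structure hn i12 hflat F).1.
by move=> /C1 F; apply: (form_structure hn i12 hflat F).2; exact: oner_neq0.
Qed.
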